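(* Let $p>3$ be a prime. (i) If $p\equiv 1\pmod{12}$ and $p=x^2+3y^2$ with $x,y\in\mathbb Z$ and $x\equiv 1\pmod 4$, then $$\sum_{k=0}^{p-1}\binom{2k}k^2\frac{v_k(4,1)}{64^k}\equiv 4x-\frac px\pmod{p^2}$$ and $$\sum_{k=0}^{p-1}\binom{2k}k^2\frac{(k-1)v_k(4,1)}{64^k}\equiv-2x\pmod{p^2}.$$ (ii) If $p\equiv 7\pmod{12}$ and $p=x^2+3y^2$ with $x,y\in\mathbb Z$ and $y\equiv 1\pmod 4$, then $$\sum_{k=0}^{p-1}\frac{u_k(4,1)}{64^k}\binom{2k}k^2\equiv 2y-\frac p{6y}\pmod{p^2}$$ and also $$y\equiv\sum_{k=0}^{p-1}\binom{2k}k^2\frac{ku_k(4,1)}{64^k}\equiv\frac14\sum_{k=0}^{p-1}\binom{2k}k^2\frac{kv_k(4,1)}{64^k}\pmod{p^2}.$$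
   Context: For $A,B\in\mathbb Z$, the Lucas sequences $u_n=u_n(A,B)$ and $v_n=v_n(A,B)$ ($n\ge0$) are defined by $u_0=0$, $u_1=1$, $u_{n+1}=Au_n-Bu_{n-1}$ and $v_0=2$, $v_1=A$, $v_{n+1}=Av_n-Bv_{n-1}$ for $n\ge1$. A congruence $a\equiv b\pmod{p^2}$ between rational numbers means $a-b\in p^2\mathbb Z_{(p)}$, where $\mathbb Z_{(p)}$ is the ring of rational numbers with denominator prime to $p$. *)

(* Defs.v *)
From mathcomp Require Import all_boot all_order all_algebra.

Set Implicit Arguments.
Unset Strict Implicit.
Unset Printing Implicit Defensive.

Import GRing.Theory.
Local Open Scope ring_scope.

Fixpoint lucas_u (A B : int) (n : nat) : int :=
  match n with
  | 0%N => 0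
  | 1%N => 1
  | (n'.+1 as m).+1 => A * lucas_u A B m - B * lucas_u A B n'
  end.

Fixpoint lucas_v (A B : int) (n : nat) : int :=
  match n with
  | 0%N => 2
  | 1%N => A
  | (n'.+1 as m).+1 => A * lucas_v A B m - B * lucas_v A B n'
  end.

(* [denq r] is the denominator of [r] in lowest terms, so for a prime [p] this
   is membership in the localization Z_(p). *)
Definition Zloc (p : nat) (r : rat) : bool := coprime `|denq r|%N p.

Definition rat_congr_mod_p2 (p : nat) (a b : rat) : Prop :=
  exists2 c : rat, Zloc p c & a - b = p%:R ^+ 2 * c.

(* Main.v *)
(* Put p = 6m + 1 and n = 3m = (p - 1) / 2. Modulo p^2, 'C(2k, k)^2 / 16^k is the coefficient
   of X^k in the Legendre polynomial P_n(1 - 2X), so the sums are combinations of the values of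
   P_n and its derivative at +-sqrt(3)/2. Clausen's formula writes P_n(1 - 2X)^2 as a polynomial
   in X - X^2, here equal to 1/16, and a terminating form of a series of Ramanujan then gives a
   linear relation between (P_n)^2 and P_n P_n' modulo p^2. Hence the sums weighted by k follow
   from the unweighted ones.

   The value P_n(sqrt(3)/2) is (3/4)^(n/2) times F(1), where F(c) = 2F1(-n/2, (1-n)/2; c; -1/3).
   F(1 + p/2) and F(1 - p/6) are products, and F(c) is affine in c modulo p^2 for c = 1 mod p,
   whence F(1)^4 = F(1 + p/2) F(1 - p/6)^3. Up to powers of 2 and 3 this is J^4, where J is the
   Jacobi sum of a cubic and the quadratic character with values in Z/p^2, whose expression by
   factorials and harmonic numbers comes from Teichmueller lifts. Finally J = a + b sqrt(-3)
   with p = a^2 + 3b^2, and J times its conjugate is p, which is why a term p/x occurs. The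
   fourth root is pinned down modulo p, where quadratic reciprocity gives the sign. *)

(* The ring Z/p^2 has zero divisors and, for p = 7 mod 12, no square root of 3. The hypergeometric
   and Legendre identities are therefore proved in fields of characteristic zero, with sqrt(3) taken
   among the algebraic numbers, and only rational identities are reduced. Congruence modulo p is
   expressed inside Z/p^2, as equality after multiplication by p. The exponents 1 and 3 reflect the
   ratio of the displacements p/2 and -p/6: they change F(1) by 3y and -y with y^2 = 0, and (F +
   3y)(F - y)^3 = F^4. Going back from fourth powers is a Hensel argument: a unit modulo p^2 is
   determined by its fourth power and its residue modulo p. Clausen's formula and its derivative
   control only P_n^2 and P_n P_n', so the weighted sums are reached by dividing by the unweighted
   one, which is a unit because J is. *)
Require Import Defs.
From mathcomp Require Import all_boot all_order all_algebra all_solvable all_field.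
From mathcomp Require Import ring lra zify.

Set Implicit Arguments.
Unset Strict Implicit.
Unset Printing Implicit Defensive.

Import Order.TTheory GRing.Theory Num.Theory.
Local Open Scope ring_scope.

(** * Closed forms of terminating hypergeometric sums *)

Section HypergeometricSums.
Variable F : realFieldType.
Implicit Types a c : F.

Definition poch (a : F) (k : nat) : F := \prod_(i < k) (a + i%:R).

Lemma poch0 a : poch a 0 = 1. Proof. exact: big_ord0. Qed.

Lemma pochS a k : poch a k.+1 = poch a k * (a + k%:R).
Proof. exact: big_ord_recr. Qed.

Lemma pochSl a k : poch a k.+1 = a * poch (a + 1) k.
Proof.
rewrite /poch big_ord_recl addr0; congr (_ * _).
by apply: eq_bigr => i _; rewrite -addrA -natr1 [1 + _]addrC.
Qed.

Lemma poch_shift a k : a != 0 -> poch (a + 1) k = poch a k * (a + k%:R) / a.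
Proof. by move=> a0; rewrite -pochS pochSl mulrAC mulfV ?mul1r. Qed.

Lemma poch_neq0 a k : (forall i, (i < k)%N -> a + i%:R != 0) -> poch a k != 0.
Proof. by move=> h; apply/prodf_neq0 => i _; apply: h. Qed.

Lemma poch1 k : poch 1 k = k`!%:R.
Proof.
elim: k => [|k IH]; first by rewrite poch0.
by rewrite pochS IH factS natrM mulrC nat1r.
Qed.

Lemma natrS k : k.+1%:R = k%:R + 1 :> F. Proof. by rewrite natr1. Qed.

Lemma natr_ffactS n k : (n ^_ k.+1)%:R = (n ^_ k)%:R * (n%:R - k%:R) :> F.
Proof.
rewrite ffactnSr natrM; case: (leqP k n) => [le_kn|lt_nk]; first by rewrite natrB.
by rewrite ffact_small ?mul0r.
Qed.

(* [hsum n c] is 2F1(-n/2, (1-n)/2; c; -1/3). *)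
Definition term (n : nat) (c : F) (j : nat) : F :=
  (n ^_ (2 * j))%:R / (j`!%:R * poch c j) * (- (1 / 12)) ^+ j.

Definition hsum (n : nat) (c : F) : F := \sum_(j < n.+1) term n c j.

(** Terms with 2j > n vanish, so sums for different n can be taken over one common range before they
    telescope. *)
Lemma hsumE n c N : (n < 2 * N)%N -> hsum n c = \sum_(j < N) term n c j.
Proof.
have small M M' : (n < 2 * M)%N -> (M <= M')%N ->
    \sum_(j < M) term n c j = \sum_(j < M') term n c j.
  move=> lt_nM le_MM'; rewrite -!(big_mkord xpredT (term n c)).
  rewrite (big_cat_nat (leq0n M) le_MM') /= -[LHS]addr0; congr (_ + _).
  rewrite big_nat_cond big1 // => j; rewrite andbT => /andP[le_Mj _].
  by rewrite /term ffact_small ?mul0r //; lia.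
move=> lt_nN; rewrite /hsum.
by rewrite (small n.+1 (n.+1 + N)%N) ?(small N (n.+1 + N)%N) ?leq_addl ?leq_addr //; lia.
Qed.

(* The right-hand sides of the three [_tele] identities are telescoping certificates found
   with Zeilberger's algorithm; they vanish once the summation range exceeds n. *)
Lemma hsum1_tele (n J : nat) :
  \sum_(j < J.+1) (term n.+1 (n.+1%:R + 3 / 2) j
     - 8 / 9 * (n%:R + 3 / 2) / (n%:R + 4 / 3) * term n (n%:R + 3 / 2) j) =
  (-6 -4 * J.+1%:R - 8 * n%:R - 8 / 3 * n%:R * J.+1%:R - 8 / 3 * n%:R ^+ 2)
   / ((n%:R + 4 / 3) * (2 * n%:R + 3 + 2 * J.+1%:R)) * (n ^_ (2 * J + 1))%:R
   / (J`!%:R * poch (n%:R + 3 / 2) J.+1) * (- (1 / 12)) ^+ J.+1.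
Proof.
have nneg (k : nat) : 0 <= k%:R :> F by [].
elim: J => [|J IH].
  rewrite big_ord_recl big_ord0 /term muln0 !ffactn0 !poch0 !fact0 !expr0 /=.
  rewrite pochS poch0 ffactn1 expr1.
  have := nneg n => n0; field; do ?[apply/andP; split]; lra.
rewrite big_ord_recr IH /= /term.
have -> : (2 * J.+1 = (2 * J + 1).+1)%N by lia.
have -> : ((2 * J + 1).+1 + 1 = (2 * J + 1).+2)%N by lia.
rewrite ffactSS natrM !natr_ffactS !factS !natrM.
have -> : n.+1%:R + 3 / 2 = (n%:R + 3 / 2) + 1 :> F by rewrite natrS; ring.
have n0 := nneg n; have J0 := nneg J.
rewrite poch_shift; last by lra.
rewrite !pochS !exprS !(natrS J.+1, natrS J) natrD natrM.
have P0 : poch (n%:R + 3 / 2) J != 0.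
  by apply: poch_neq0 => i _; have := nneg i; lra.
have f0 : J`!%:R != 0 :> F by rewrite pnatr_eq0 -lt0n fact_gt0.
field.
rewrite P0 f0 /=; do ?[apply/andP; split]; lra.
Qed.

Lemma hsum1_rec n :
  hsum n.+1 (n.+1%:R + 3 / 2) =
  8 / 9 * (n%:R + 3 / 2) / (n%:R + 4 / 3) * hsum n (n%:R + 3 / 2).
Proof.
apply/eqP; rewrite -subr_eq0 (@hsumE n.+1 _ n.+3) ?(@hsumE n _ n.+3); try lia.
rewrite mulr_sumr -sumrB hsum1_tele ffact_small; last by lia.
by rewrite mulr0 !mul0r.
Qed.

(** For n = 3m and p = 6m + 1 the parameter n + 3/2 is 1 + p/2. *)
Lemma hsum1_eval n :
  hsum n (n%:R + 3 / 2) = \prod_(i < n) (8 / 9 * (i%:R + 3 / 2) / (i%:R + 4 / 3)).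
Proof.
elim: n => [|n IH]; last by rewrite hsum1_rec IH big_ord_recr mulrC.
by rewrite /hsum big_ord1 big_ord0 /term muln0 ffactn0 fact0 poch0; field.
Qed.

Lemma six_neq0 (m i : nat) : 5 / 6 - m%:R + i%:R != 0 :> F.
Proof.
apply/eqP => h; have : (5 + 6 * i)%:R = (6 * m)%:R :> F.
  by rewrite natrD !natrM; lra.
by move/eqP; rewrite eqr_nat => /eqP; lia.
Qed.

Lemma hsum2_tele (m J : nat) :
  \sum_(j < J.+2) (term (3 * m.+1) (5 / 6 - m.+1%:R) j
     - 4 * (3 * m%:R + 1) / (6 * m%:R + 1) * term (3 * m) (5 / 6 - m%:R) j) =
  (-10 + 64 * J.+2%:R - 24 * J.+2%:R ^+ 2 - 102 * m%:R + 288 * m%:R * J.+2%:R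
   - 72 * m%:R * J.+2%:R ^+ 2 - 288 * m%:R ^+ 2 + 288 * m%:R ^+ 2 * J.+2%:R
   - 216 * m%:R ^+ 3) / (6 * m%:R + 1) * ((3 * m) ^_ (2 * J + 1))%:R
   / (J.+1`!%:R * poch (5 / 6 - m%:R) J.+2) * (- (1 / 12)) ^+ J.+2.
Proof.
have nneg (k : nat) : 0 <= k%:R :> F by [].
have shift j : poch (5 / 6 - m.+1%:R) j.+1
    = poch (5 / 6 - m%:R) j.+1 * (5 / 6 - m.+1%:R) / (5 / 6 - m.+1%:R + j.+1%:R).
  have -> : 5 / 6 - m%:R = 5 / 6 - m.+1%:R + 1 :> F by rewrite natrS; ring.
  rewrite poch_shift; last by have := six_neq0 m.+1 0; rewrite addr0.
  rewrite mulfVK ?mulfK ?six_neq0 //.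
  by have := six_neq0 m.+1 0; rewrite addr0.
have n0 := nneg m.
(* Raising n by 3 adds three factors to the falling factorial, so the certificate for N terms
   carries the exponent 2N - 3; hence the base case has two terms. *)
elim: J => [|J IH].
  rewrite 2!big_ord_recr big_ord0 /term /= muln0 !ffactn0 !poch0 !fact0 !expr0 /=.
  rewrite muln1 shift !pochS poch0 !natr_ffactS !ffactn0 expr1.
  rewrite !natrM (natrS m).
  have := six_neq0 m 0; have := six_neq0 m 1; have := six_neq0 m.+1 0.
  rewrite !(natrS m) !mulr0n !addr0 => h1 h2 h3.
  by field; do ?[apply/andP; split]; lra.
rewrite big_ord_recr IH /= /term.
have -> : (2 * J.+2 = (2 * J + 1).+3)%N by lia.
have -> : (2 * J.+1 + 1 = (2 * J + 1).+2)%N by lia.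
have -> : (3 * m.+1 = (3 * m).+3)%N by lia.
rewrite !ffactSS !natr_ffactS !factS !natrM shift.
rewrite !pochS !exprS !(natrS m, natrS J.+2, natrS J.+1, natrS J).
rewrite !(natrS (3 * m).+2, natrS (3 * m).+1, natrS (3 * m)).
rewrite !(natrS (2 * J + 1).+1, natrS (2 * J + 1)) natrD !natrM.
have P0 : poch (5 / 6 - m%:R) J != 0 by apply: poch_neq0 => i _; apply: six_neq0.
have f0 : J`!%:R != 0 :> F by rewrite pnatr_eq0 -lt0n fact_gt0.
have J0 := nneg J.
have := six_neq0 m J; have := six_neq0 m J.+1; have := six_neq0 m J.+2.
have := six_neq0 m.+1 0; have := six_neq0 m.+1 J.+2.
rewrite !(natrS m, natrS J.+1, natrS J) ?mulr0n ?addr0 => h1 h2 h3 h4 h5.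
field.
rewrite P0 f0 /=; do ?[apply/andP; split]; lra.
Qed.

(** For p = 6m + 1 the parameter 5/6 - m is 1 - p/6. The first-order recurrence advances n in steps
    of 3. *)
Lemma hsum2_eval m :
  hsum (3 * m) (5 / 6 - m%:R) = \prod_(i < m) (4 * (3 * i%:R + 1) / (6 * i%:R + 1)).
Proof.
elim: m => [|m IH].
  by rewrite muln0 /hsum big_ord1 big_ord0 /term muln0 ffactn0 fact0 poch0; field.
rewrite big_ord_recr -IH /= [RHS]mulrC; apply/eqP; rewrite -subr_eq0.
rewrite (@hsumE (3 * m.+1) _ (3 * m + 4)) ?(@hsumE (3 * m) _ (3 * m + 4)); try lia.
rewrite mulr_sumr -sumrB addn4 hsum2_tele ffact_small; last by lia.
by rewrite mulr0 !mul0r.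
Qed.

(* A terminating form of Ramanujan's series with terms (6k+1) 'C(2k,k)^3 / 256^k. *)
Definition rterm (n k : nat) : F :=
  (6 * k%:R + 1) * poch (1 / 2) k * (n ^_ k)%:R * poch (n%:R + 1) k
  / (k`!%:R * poch (3 / 4 - n%:R / 2) k * poch (5 / 4 + n%:R / 2) k)
  * (- (1 / 4)) ^+ k.

Lemma four_neq0 (n i : nat) : 3 / 4 - n%:R / 2 + i%:R != 0 :> F.
Proof.
apply/eqP => h; have : (3 + 4 * i)%:R = (2 * n)%:R :> F.
  by rewrite natrD !natrM; lra.
by move/eqP; rewrite eqr_nat => /eqP; lia.
Qed.

Lemma rterm_tele (n J : nat) :
  \sum_(k < J.+2) (rterm n.+2 k - (2 * n%:R + 5) / (2 * n%:R + 1) * rterm n k) =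
  (10 - 60 * J.+2%:R + 80 * J.+2%:R ^+ 2 + 24 * n%:R - 64 * n%:R * J.+2%:R
   + 32 * n%:R * J.+2%:R ^+ 2 + 8 * n%:R ^+ 2 - 16 * n%:R ^+ 2 * J.+2%:R)
  / (2 * n%:R + 1) * poch (1 / 2) J.+2 * (n ^_ J)%:R * poch (n%:R + 1) J.+2
  / (J.+1`!%:R * poch (3 / 4 - n%:R / 2) J.+2 * poch (5 / 4 + n%:R / 2) J.+2)
  * (- (1 / 4)) ^+ J.+2.
Proof.
have nneg (k : nat) : 0 <= k%:R :> F by [].
have n0 := nneg n.
have z2 : 3 / 4 - n.+2%:R / 2 != 0 :> F by have := four_neq0 n.+2 0; rewrite addr0.
have shift1 j : poch (3 / 4 - n.+2%:R / 2) j.+1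
    = poch (3 / 4 - n%:R / 2) j.+1 * (3 / 4 - n.+2%:R / 2) / (3 / 4 - n.+2%:R / 2 + j.+1%:R).
  have -> : 3 / 4 - n%:R / 2 = 3 / 4 - n.+2%:R / 2 + 1 :> F by rewrite !(natrS n.+1, natrS n); field.
  by rewrite poch_shift // mulfVK ?mulfK ?four_neq0.
have shift2 j : poch (5 / 4 + n.+2%:R / 2) j
    = poch (5 / 4 + n%:R / 2) j * (5 / 4 + n%:R / 2 + j%:R) / (5 / 4 + n%:R / 2).
  have -> : 5 / 4 + n.+2%:R / 2 = 5 / 4 + n%:R / 2 + 1 :> F by rewrite !(natrS n.+1, natrS n); field.
  by rewrite poch_shift //; lra.
have shift3 j : poch (n.+2%:R + 1) j
    = poch (n%:R + 1) j * ((n%:R + 1 + j%:R) * (n%:R + 2 + j%:R)) / ((n%:R + 1) * (n%:R + 2)).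
  have -> : n.+2%:R + 1 = n%:R + 1 + 1 + 1 :> F by rewrite !(natrS n.+1, natrS n); ring.
  rewrite (@poch_shift (n%:R + 1 + 1)) ?(@poch_shift (n%:R + 1)); try lra.
  by field; apply/andP; split; lra.
elim: J => [|J IH].
  rewrite 2!big_ord_recr big_ord0 /rterm /= !ffactn0 !poch0 !fact0 !expr0 /=.
  rewrite shift1 shift2 shift3 !pochS !poch0 !natr_ffactS !ffactn0 !expr1 !factS !fact0.
  have := four_neq0 n 0; have := four_neq0 n 1; have := four_neq0 n.+2 0.
  have := four_neq0 n.+2 1.
  rewrite !(natrS n.+1, natrS n) ?mulr0n ?addr0 => h0 h1 h2 h3.
  by field; do ?[apply/andP; split]; lra.
rewrite big_ord_recr IH /= /rterm.
rewrite !ffactSS !natr_ffactS !factS !natrM shift1 shift2 shift3.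
rewrite !pochS !exprS !(natrS n.+1, natrS n, natrS J.+2, natrS J.+1, natrS J).
have P0 : poch (3 / 4 - n%:R / 2) J != 0 by apply: poch_neq0 => i _; apply: four_neq0.
have P1 : poch (5 / 4 + n%:R / 2) J != 0.
  by apply: poch_neq0 => i _; have := nneg i; lra.
have f0 : J`!%:R != 0 :> F by rewrite pnatr_eq0 -lt0n fact_gt0.
have J0 := nneg J.
have := four_neq0 n J; have := four_neq0 n J.+1; have := four_neq0 n J.+2.
have := four_neq0 n.+2 0; have := four_neq0 n.+2 J.+2.
rewrite !(natrS n.+1, natrS n, natrS J.+1, natrS J) ?mulr0n ?addr0 => h1 h2 h3 h4 h5.
field.
rewrite P0 P1 f0 /=; do ?[apply/andP; split]; lra.
Qed.

(** The certificate links n to n + 2, hence the induction on pairs. At n = (p - 1) / 2 the factor 2n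
    + 1 is p. *)
Lemma rsum_eval n : \sum_(k < n.+1) rterm n k = (-1) ^+ n * (2 * n%:R + 1).
Proof.
suff H : \sum_(k < n.+1) rterm n k = (-1) ^+ n * (2 * n%:R + 1) /\
  \sum_(k < n.+2) rterm n.+1 k = (-1) ^+ n.+1 * (2 * n.+1%:R + 1) by case: H.
elim: n => [|n [IH1 IH2]]; split => //.
- by rewrite big_ord1 /rterm /= !poch0 ffactn0 fact0 !expr0; field.
- rewrite 2!big_ord_recr big_ord0 /rterm /= !pochS !poch0 !natr_ffactS !ffactn0 ?factS ?fact0 ?expr1.
  by field.
have nneg (k : nat) : 0 <= k%:R :> F by [].
have n0 := nneg n.
have tail : \sum_(k < n.+3) rterm n k = \sum_(k < n.+1) rterm n k.
  by rewrite 2!big_ord_recr /= /rterm !ffact_small ?mulr0 ?mul0r ?addr0.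
have /eqP := rterm_tele n n.+1.
rewrite sumrB -mulr_sumr tail ffact_small // mulr0 !mul0r subr_eq0 => /eqP ->.
by rewrite IH1 !exprS !(natrS n.+1, natrS n); field; lra.
Qed.

End HypergeometricSums.

(** * Legendre polynomials and Clausen's formula *)

Lemma mul_central_bin (R : pzSemiRingType) k :
  k.+1%:R * 'C(2 * k.+1, k.+1)%:R = 2 * (2 * k%:R + 1) * 'C(2 * k, k)%:R :> R.
Proof.
have e : (k.+1 * 'C(2 * k.+1, k.+1) = 2 * (2 * k + 1) * 'C(2 * k, k))%N.
  have := mul_bin_diag (2 * k).+2 k; have := mul_bin_down (2 * k).+1 k.
  rewrite /= (_ : (2 * k).+1 - k = k.+1)%N; last lia.
  rewrite (_ : (2 * k).+2 = 2 * k.+1)%N; last lia.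
  by move=> h1 <-; rewrite -!mulnA (addn1 (2 * k)) h1.
by have := congr1 (fun i : nat => i%:R : R) e; rewrite !natrM natrD natrM.
Qed.

Section Coefficients.
Variables (F : comNzRingType) (n : nat).
Local Notation M := (n%:R * (n%:R + 1) : F).

Definition legendre_coef (k : nat) : F := (-1) ^+ k * ('C(n, k) * 'C(n + k, k))%:R.
Definition clausen_coef (k : nat) : F := legendre_coef k * 'C(2 * k, k)%:R.

(** This is the Legendre equation read coefficientwise. It involves n only through n(n + 1), on
    which the comparison modulo p^2 in [legendre_coef_central] rests. *)
Lemma legendre_coefS k :
  (k.+1%:R) ^+ 2 * legendre_coef k.+1 = (k%:R * (k%:R + 1) - M) * legendre_coef k.
Proof.
have H1 : k.+1%:R * 'C(n, k.+1)%:R = (n%:R - k%:R) * 'C(n, k)%:R :> F.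
  case: (leqP k n) => [le_kn|lt_nk]; last by rewrite !bin_small ?mulr0 //; lia.
  by rewrite -natrB // -!natrM mul_bin_left.
have H2 : k.+1%:R * 'C(n + k.+1, k.+1)%:R = (n%:R + k.+1%:R) * 'C(n + k, k)%:R :> F.
  by rewrite -natrD -!natrM addnS mul_bin_diag.
rewrite /legendre_coef [(-1) ^+ k.+1]exprS !natrM.
transitivity (- ((-1) ^+ k * (k.+1%:R * 'C(n, k.+1)%:R) * (k.+1%:R * 'C(n + k.+1, k.+1)%:R)) : F).
  by ring.
by rewrite H1 H2 -[k.+1%:R]natr1; ring.
Qed.

Lemma clausen_coefS k :
  (k.+1%:R) ^+ 3 * clausen_coef k.+1
  = 2 * (2 * k%:R + 1) * (k%:R * (k%:R + 1) - M) * clausen_coef k.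
Proof.
rewrite /clausen_coef.
transitivity ((k.+1%:R ^+ 2 * legendre_coef k.+1) * (k.+1%:R * 'C(2 * k.+1, k.+1)%:R)).
  by ring.
by rewrite mul_central_bin legendre_coefS; ring.
Qed.

End Coefficients.

Section Legendre.
Variables (F : numFieldType) (n : nat).
Implicit Types d : {poly F}.

(* [legendre] is the Legendre polynomial P_n(1 - 2X). *)
Definition legendre : {poly F} := \poly_(k < n.+1) legendre_coef F n k.
Definition clausen : {poly F} := \poly_(k < n.+1) clausen_coef F n k.

Local Notation w := ('X - 'X ^+ 2 : {poly F}).
Local Notation M := (n%:R * (n%:R + 1) : F).

Lemma coef_legendre k : legendre`_k = legendre_coef F n k.
Proof.
rewrite coef_poly; case: ltnP => // lt_nk.
by rewrite /legendre_coef bin_small ?mul0n ?mulr0.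
Qed.

Lemma coef_clausen k : clausen`_k = clausen_coef F n k.
Proof.
rewrite coef_poly; case: ltnP => // lt_nk.
by rewrite /clausen_coef /legendre_coef bin_small ?mul0n ?mulr0 ?mul0r.
Qed.

Lemma coef_derivE d k : d^`()`_k = k.+1%:R * d`_k.+1.
Proof. by rewrite coef_deriv mulr_natl. Qed.

Lemma coef_wM d k : (w * d)`_k.+1 = d`_k - (if k is k'.+1 then d`_k' else 0).
Proof.
rewrite mulrBl coefB coefXM /=; congr (_ - _).
by rewrite expr2 -mulrA coefXM /= coefXM; case: k.
Qed.

Lemma coef_sturm d k :
  ((w * d^`())^`())`_k = k.+1%:R * (k.+1%:R * d`_k.+1 - k%:R * d`_k).
Proof.
rewrite coef_derivE coef_wM coef_derivE.
congr (_ * (_ - _)).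
by case: k => [|k]; rewrite ?mul0r // coef_derivE.
Qed.

Lemma legendre_ode : (w * legendre^`())^`() = - (M%:P * legendre).
Proof.
apply/polyP => k; rewrite coef_sturm coefN coefCM !coef_legendre.
by rewrite mulrBr mulrA -expr2 legendre_coefS -[k.+1%:R]natr1; ring.
Qed.

(* The symmetric square of the Legendre equation, solved by the squares of its solutions. *)
Definition square_ode d :=
  (w * ((w * d^`())^`() + 2 * M%:P * d))^`() + 2 * M%:P * (w * d^`()).

(** With f the Legendre polynomial, f'' disappears from the inner bracket, which is 2 w f'^2;
    multiplying by w gives 2 (w f')^2, whose derivative is known from the Legendre equation. *)
Lemma square_ode_legendre : square_ode (legendre ^+ 2) = 0.
Proof.
have e1 : (w * (legendre ^+ 2)^`()) = 2 * legendre * (w * legendre^`()).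
  by rewrite expr2 derivM; ring.
have e2 : (w * (legendre ^+ 2)^`())^`() + 2 * M%:P * legendre ^+ 2
    = 2 * w * legendre^`() ^+ 2.
  rewrite e1 derivM legendre_ode derivM.
  by rewrite (_ : (2 : {poly F})^`() = 0) -?polyC_natr ?derivC //; ring.
rewrite /square_ode e2 e1.
have -> : w * (2 * w * legendre^`() ^+ 2) = 2 * (w * legendre^`()) * (w * legendre^`()).
  by ring.
rewrite derivM derivM legendre_ode.
by rewrite (_ : (2 : {poly F})^`() = 0) -?polyC_natr ?derivC //; ring.
Qed.

(** Coefficient k of the equation expresses (k + 1)^3 times coefficient k + 1 of d by earlier ones.
    In characteristic 0 the constant term thus determines d. *)
Lemma square_ode_uniq d : square_ode d = 0 -> d`_0 = 0 -> d = 0.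
Proof.
move=> ode d0; apply/polyP => k; rewrite coef0.
suff : forall i, (i <= k)%N -> d`_i = 0 by apply.
elim: k => [|k IH] i; first by rewrite leqn0 => /eqP ->.
rewrite leq_eqVlt => /orP[/eqP ->|]; last exact: IH.
have := congr1 (fun q : {poly F} => q`_k) ode.
rewrite /square_ode coef0 coefD coef_derivE coef_wM -mulrA -polyC_natr.
have wd0 : (w * d^`())`_k = 0.
  case: k IH => [|k] IH; first by rewrite mulrBl coefB expr2 -mulrA !coefXM subrr.
  rewrite coef_wM coef_derivE IH // mulr0 sub0r.
  by case: k IH => [|k] IH; rewrite ?oppr0 // coef_derivE IH // mulr0 oppr0.
rewrite -[2%:P * _ * (_ * d^`())]mulrA !coefCM wd0 !mulr0 addr0.
have -> : (if k is k'.+1 then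
     ((w * d^`())^`() + 2%:P * (M%:P * d))`_k' else 0) = 0.
  case: k IH {wd0} => [|k] IH //.
  by rewrite coefD coef_sturm !coefCM !IH // !mulr0 subrr mulr0 add0r.
rewrite subr0 coefD coef_sturm !coefCM (IH k) // !mulr0 subr0 addr0.
by move/eqP; rewrite !mulf_eq0 !pnatr_eq0 /= => /eqP.
Qed.

(** Since w'^2 = 1 - 4w and w'' = -2, the equation can be rewritten with w as the variable; its
    coefficientwise form is then [clausen_coefS]. *)
Lemma square_ode_clausen : square_ode (clausen \Po w) = 0.
Proof.
set h := clausen.
have dw : w^`() = 1 - 2 * 'X :> {poly F}.
  by rewrite derivB derivX derivXn /= expr1 mulr_natl.
have wdw : w^`() ^+ 2 = 1 - 4 * w :> {poly F} by rewrite dw; ring.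
pose D := ('X * h^`())^`().
(* [a] is w times the inner bracket of [square_ode], written in the new variable; [e2] checks
   this. *)
pose a := 'X * (D - 4%:P * ('X * D) - 2%:P * ('X * h^`()) + 2%:P * (M%:P * h)).
have aE : a^`() + 2%:P * (M%:P * ('X * h^`())) = 0.
  have DE k : D`_k = k.+1%:R ^+ 2 * h`_k.+1.
    by rewrite coef_derivE coefXM /= coef_derivE; ring.
  have XhE k : ('X * h^`())`_k = k%:R * h`_k.
    by rewrite coefXM; case: k => [|k]; rewrite ?mul0r //= coef_derivE.
  apply/polyP => k; rewrite coef0 coefD coef_derivE coefXM /=.
  rewrite !(coefD, coefN) !coefCM.
  rewrite !XhE coefXM DE -!/h !coef_clausen.
  have -> : (if k == 0%N then 0 else D`_k.-1) = k%:R ^+ 2 * clausen_coef F n k.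
    by case: k => [|k]; rewrite ?mul0r ?expr0n ?mul0r //= DE coef_clausen.
  have := clausen_coefS F n k; rewrite -![k.+1%:R]natr1 => e.
  transitivity ((k%:R + 1) ^+ 3 * clausen_coef F n k.+1
    - 2 * (2 * k%:R + 1) * (k%:R * (k%:R + 1) - M) * clausen_coef F n k); last first.
    by rewrite e subrr.
  by ring.
have compN q : - q \Po w = - (q \Po w) by rewrite raddfN.
have e1 : w * (h \Po w)^`() = w^`() * (('X * h^`()) \Po w).
  by rewrite deriv_comp rmorphM /= comp_polyX; ring.
have e2 : w * ((w * (h \Po w)^`())^`() + 2 * M%:P * (h \Po w)) = a \Po w.
  rewrite e1 derivM deriv_comp -/D.
  have -> : w^`()^`() = -2 :> {poly F}.
    by rewrite dw mulr_natl derivB derivMn derivX (derivC 1) sub0r.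
  have -> : w^`() * ((D \Po w) * w^`()) = (1 - 4 * w) * (D \Po w) by rewrite -wdw; ring.
  rewrite /a !(comp_polyM, comp_polyD, compN, comp_polyX, comp_polyC).
  by ring.
rewrite /square_ode e2 e1 deriv_comp.
transitivity (w^`() * ((a^`() + 2%:P * (M%:P * ('X * h^`()))) \Po w)); last first.
  by rewrite aE comp_poly0 mulr0.
by rewrite !(comp_polyM, comp_polyD, comp_polyC); ring.
Qed.

(** Both sides solve the same linear equation and have constant term 1. *)
Lemma legendre_sqr : legendre ^+ 2 = clausen \Po w.
Proof.
apply/eqP; rewrite -subr_eq0; apply/eqP/square_ode_uniq.
  have sub d1 d2 : square_ode (d1 - d2) = square_ode d1 - square_ode d2.
    by rewrite /square_ode !(derivB, derivN, mulrN, mulrDr, derivD); ring.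
  by rewrite sub square_ode_legendre square_ode_clausen subrr.
have w0 : w.[0] = 0 by rewrite !hornerE; ring.
rewrite coefB -!horner_coef0 horner_comp w0 horner_exp !horner_coef0.
rewrite coef_legendre coef_clausen.
by rewrite /clausen_coef /legendre_coef muln0 !bin0 !mulr1 expr1n subrr.
Qed.

Lemma coef_exp_XaddC (c : F) k m : (k <= m)%N ->
  (('X + c%:P) ^+ m)`_k = c ^+ (m - k) * 'C(m, k)%:R.
Proof.
move=> le_km; rewrite addrC exprDn coef_sum (bigD1 (Ordinal (le_km : k < m.+1)%N)) //=.
rewrite coefMn -polyC_exp coefCM coefXn eqxx mulr1 mulr_natr big1 ?addr0 // => i ne_ik.
rewrite coefMn -polyC_exp coefCM coefXn (_ : (k == i) = false) ?mulr0 ?mul0rn //.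
by apply: contraNF ne_ik => /eqP e; apply/eqP/val_inj.
Qed.

(* Both sides are the coefficient of t^n in ((t - l)(t - l + 1))^n. *)
Lemma legendre_trinomial (l : F) :
  legendre.[l] = \sum_(j < n.+1) ('C(n, 2 * j) * 'C(2 * j, j))%:R
    * (1 - 2 * l) ^+ (n - 2 * j) * (- (l * (1 - l))) ^+ j.
Proof.
pose q : {poly F} := ('X - l%:P) ^+ n * (1 + ('X - l%:P)) ^+ n.
transitivity q`_n.
  rewrite /q [(1 + _) ^+ n]exprDn mulr_sumr coef_sum (horner_coef_wide _ (size_poly _ _)).
  apply: eq_bigr => i _; rewrite expr1n mul1r mulrnAr coef_legendre coefMn -exprD.
  rewrite -polyCN coef_exp_XaddC ?leq_addr // addKn -mulr_natr /legendre_coef natrM.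
  by rewrite -(bin_sub (leq_addr i n)) addKn [(- l) ^+ _]exprNn; ring.
(* (X - l)(1 + X - l) = X^2 + (1 - 2l) X - l(1 - l). *)
set b := - (l * (1 - l)); set u := 1 - 2 * l.
have -> : q = (u%:P * 'X + ('X ^+ 2 + b%:P)) ^+ n.
  rewrite /q -exprMn_comm; last exact: mulrC.
  by congr (_ ^+ n); rewrite /u /b !(polyCN, polyCM, polyCB); ring.
(* [e i] is the coefficient of X^i in (X^2 + b)^i, what remains once the linear term has been chosen
   n - i times. *)
pose e i := if odd i then 0 else b ^+ i./2 * 'C(i, i./2)%:R : F.
have eE i : (('X ^+ 2 + b%:P) ^+ i)`_i = e i.
  rewrite addrC exprDn coef_sum /e; case: ifPn => odd_i.
    apply: big1 => j _; rewrite coefMn -polyC_exp coefCM -exprM coefXn.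
    by rewrite (_ : (i == _) = false) ?mulr0 ?mul0rn //; lia.
  have lt_i : (i./2 < i.+1)%N by lia.
  rewrite (bigD1 (Ordinal lt_i)) //= coefMn -polyC_exp coefCM -exprM coefXn.
  rewrite (_ : (i == _) = true) ?mulr1; last by lia.
  rewrite (_ : i - i./2 = i./2)%N; last by lia.
  rewrite mulr_natr big1 ?addr0 // => j; rewrite -val_eqE /= => ne_j.
  rewrite coefMn -polyC_exp coefCM -exprM coefXn.
  by rewrite (_ : (i == _) = false) ?mulr0 ?mul0rn //; lia.
rewrite exprDn coef_sum.
pose c i := 'C(n, i)%:R * u ^+ (n - i) * e i.
transitivity (\sum_(i < n.+1) c i).
  apply: eq_bigr => i _; rewrite coefMn exprMn -polyC_exp -mulrA coefCM coefXnM.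
  rewrite ltnNge leq_subr /= subKn ?eE /c; last by rewrite -ltnS.
  by rewrite -[LHS]mulr_natl mulrA.
have even_sum N : \sum_(i < 2 * N) c i = \sum_(j < N) c (2 * j)%N.
  elim: N => [|N IH]; first by rewrite muln0 !big_ord0.
  rewrite mulnS add2n !big_ord_recr /= IH -addrA; congr (_ + _).
  by rewrite [c _.+1]/c /e /= oddM /= mulr0 addr0.
transitivity (\sum_(i < 2 * n.+1) c i).
  rewrite -!(big_mkord xpredT c) [RHS](big_cat_nat (n := n.+1)) /=; try lia.
  rewrite -[LHS]addr0; congr (_ + _); rewrite big_nat_cond big1 // => i.
  by rewrite andbT => /andP[lt_ni _]; rewrite /c bin_small ?mul0r //; lia.
rewrite even_sum; apply: eq_bigr => j _.
by rewrite /c /e oddM /= mul2n doubleK natrM; ring.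
Qed.

End Legendre.

(** * The Lucas sums as values at (2 + sqrt 3) / 4 and (2 - sqrt 3) / 4 *)

Section Sums.
Variables (F : numFieldType) (n : nat).

(** The constant -1/12 is -l(1 - l) / (1 - 2l)^2 at l = (2 + sqrt 3) / 4, where l(1 - l) = 1/16 and
    (1 - 2l)^2 = 3/4. *)
Definition trisum : F :=
  \sum_(j < n.+1) ('C(n, 2 * j) * 'C(2 * j, j))%:R * (- (1 / 12)) ^+ j.
Definition clsum : F := \sum_(k < n.+1) clausen_coef F n k / 16 ^+ k.
Definition kclsum : F := \sum_(k < n.+1) k%:R * clausen_coef F n k / 16 ^+ k.
(** The power is 4^k and not 64^k because [legendre_coef_central] absorbs 16^k into the Legendre
    coefficient. *)
Definition vsum : F := \sum_(k < n.+1) legendre_coef F n k * ((lucas_v 4 1 k)%:~R / 4 ^+ k).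
Definition kvsum : F :=
  \sum_(k < n.+1) legendre_coef F n k * (k%:R * (lucas_v 4 1 k)%:~R / 4 ^+ k).
Definition usum : F := \sum_(k < n.+1) legendre_coef F n k * ((lucas_u 4 1 k)%:~R / 4 ^+ k).
Definition kusum : F :=
  \sum_(k < n.+1) legendre_coef F n k * (k%:R * (lucas_u 4 1 k)%:~R / 4 ^+ k).

End Sums.

Section Sqrt3.
Variables (F : numFieldType) (r : F).
Hypothesis r2 : r ^+ 2 = 3.

Lemma lucas_v_sqrt3 k : (lucas_v 4 1 k)%:~R = (2 + r) ^+ k + (2 - r) ^+ k.
Proof.
suff [] : (lucas_v 4 1 k)%:~R = (2 + r) ^+ k + (2 - r) ^+ k /\
  (lucas_v 4 1 k.+1)%:~R = (2 + r) ^+ k.+1 + (2 - r) ^+ k.+1 by [].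
elim: k => [|k [IH1 IH2]]; first by split; rewrite /= ?expr0 ?expr1; ring.
split=> //; rewrite [lucas_v _ _ _]/= -/(lucas_v 4 1 k.+1) rmorphB !rmorphM /= IH1 IH2.
by rewrite !exprS; ring: r2.
Qed.

Lemma lucas_u_sqrt3 k : 2 * r * (lucas_u 4 1 k)%:~R = (2 + r) ^+ k - (2 - r) ^+ k.
Proof.
suff [] : 2 * r * (lucas_u 4 1 k)%:~R = (2 + r) ^+ k - (2 - r) ^+ k /\
  2 * r * (lucas_u 4 1 k.+1)%:~R = (2 + r) ^+ k.+1 - (2 - r) ^+ k.+1 by [].
elim: k => [|k [IH1 IH2]]; first by split; rewrite /= ?expr0 ?expr1; ring.
split=> //; rewrite [lucas_u _ _ _]/= -/(lucas_u 4 1 k.+1) rmorphB !rmorphM /=.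
by rewrite mulrBr mulrCA IH2 mulrCA IH1 !exprS; ring: r2.
Qed.

Variable n : nat.
Local Notation f := (legendre F n).
Let l1 : F := (2 + r) / 4.
Let l2 : F := (2 - r) / 4.
Local Notation hs := (trisum F n).
Local Notation cl := (clsum F n).
Local Notation kcl := (kclsum F n).
Local Notation vsum := (vsum F n).
Local Notation kvsum := (kvsum F n).
Local Notation usum := (usum F n).
Local Notation kusum := (kusum F n).

Lemma size_XM_deriv (q : {poly F}) m : (size q <= m.+1)%N -> (size ('X * q^`())%R <= m.+1)%N.
Proof.
have [-> | q0] := eqVneq q 0; first by rewrite deriv0 mulr0 size_poly0.
move=> le_qm; apply: leq_trans (size_polyMleq _ _) _; rewrite size_polyX /=.
by rewrite (leq_trans (lt_size_deriv q0)).
Qed.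

(** The three parts are the trinomial expansion, Clausen's formula and its derivative, at a point
    with l - l^2 = 1/16. *)
Lemma legendre_at l : (1 - 2 * l) ^+ 2 = 3 / 4 ->
  [/\ f.[l] = (1 - 2 * l) ^+ n * hs, f.[l] ^+ 2 = cl
    & f.[l] * f^`().[l] = 8 * (1 - 2 * l) * kcl].
Proof.
move=> l_eq; have l2E : l ^+ 2 = l - 1 / 16.
  have -> : l ^+ 2 = ((1 - 2 * l) ^+ 2 - 1 + 4 * l) / 4 by field.
  by rewrite l_eq; field.
have w16 : l - l ^+ 2 = 16^-1 by rewrite l2E; field.
have h0 : (clausen F n).[16^-1] = cl.
  rewrite (horner_coef_wide _ (size_poly _ _)); apply: eq_bigr => i _.
  by rewrite coef_clausen exprVn.
have h1 : (clausen F n)^`().[16^-1] = 16 * kcl.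
  have : ('X * (clausen F n)^`()).[16^-1] = kcl.
    rewrite (@horner_coef_wide _ n.+1) ?size_XM_deriv ?size_poly //.
    apply: eq_bigr => i _; rewrite coefXM; case: (val i) => [|k] /=; first by rewrite !mul0r.
    by rewrite coef_deriv coef_clausen exprVn mulr_natl.
  by rewrite hornerM hornerX => <-; rewrite mulrA mulfV ?mul1r ?pnatr_eq0.
split.
- rewrite legendre_trinomial mulr_sumr; apply: eq_bigr => j _.
  have u0 : 1 - 2 * l != 0.
    by apply/eqP => u0; move/eqP: l_eq; rewrite u0 expr0n eq_sym mulf_eq0 invr_eq0 !pnatr_eq0.
  case: (leqP (2 * j) n) => [le_jn|lt_nj]; last first.
    by rewrite bin_small // mul0n !mul0r mulr0.
  have -> : - (l * (1 - l)) = (1 - 2 * l) ^+ 2 * (- (1 / 12)).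
    by rewrite l_eq mulrBr mulr1 -expr2 l2E; field.
  rewrite exprMn -exprM -[X in _ ^+ X * (_ * _)](subnK le_jn) exprD; ring.
- by rewrite -h0 -horner_exp legendre_sqr horner_comp !hornerE w16.
have := congr1 (fun q : {poly F} => q^`().[l]) (legendre_sqr F n).
rewrite deriv_comp expr2 derivM derivB derivX derivXn !hornerE horner_comp !hornerE.
rewrite w16 h1 /=.
move=> e; apply: (mulfI (_ : 2 != 0 :> F)); first by rewrite pnatr_eq0.
transitivity (f^`().[l] * f.[l] + f.[l] * f^`().[l]); first by ring.
by rewrite e; ring.
Qed.

Let l1_eq : (1 - 2 * l1) = - (r / 2). Proof. by rewrite /l1; field. Qed.
Let l2_eq : (1 - 2 * l2) = r / 2. Proof. by rewrite /l2; field. Qed.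

Let legendre_sum c : \sum_(k < n.+1) legendre_coef F n k * (c / 4) ^+ k = f.[c / 4].
Proof.
rewrite (horner_coef_wide _ (size_poly _ _)); apply: eq_bigr => i _.
by rewrite coef_legendre.
Qed.

Let legendre_dsum c :
  \sum_(k < n.+1) k%:R * legendre_coef F n k * (c / 4) ^+ k = c / 4 * f^`().[c / 4].
Proof.
have -> : c / 4 * f^`().[c / 4] = ('X * f^`()).[c / 4] by rewrite hornerM hornerX.
rewrite (@horner_coef_wide _ n.+1) ?size_XM_deriv ?size_poly //.
apply: eq_bigr => i _; rewrite coefXM; case: (val i) => [|k] /=; first by rewrite !mul0r.
by rewrite coef_derivE coef_legendre.
Qed.

Let u_sqr : (r / 2) ^+ 2 = 3 / 4. Proof. by rewrite expr_div_n r2; field. Qed.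

Let r0 : r != 0.
Proof. by apply/eqP => r0; move/eqP: r2; rewrite r0 expr0n eq_sym pnatr_eq0. Qed.

Let at1 : [/\ f.[l1] = (- (r / 2)) ^+ n * hs, f.[l1] ^+ 2 = cl
  & f.[l1] * f^`().[l1] = - (4 * r * kcl)].
Proof.
have [] := @legendre_at l1 _; first by rewrite l1_eq sqrrN.
by rewrite l1_eq => -> -> ->; split=> //; field.
Qed.

Let at2 : [/\ f.[l2] = (r / 2) ^+ n * hs, f.[l2] ^+ 2 = cl
  & f.[l2] * f^`().[l2] = 4 * r * kcl].
Proof.
have [] := @legendre_at l2 _; first by rewrite l2_eq.
by rewrite l2_eq => -> -> ->; split=> //; field.
Qed.

Lemma vsumE : vsum = f.[l1] + f.[l2].
Proof.
rewrite -!legendre_sum -big_split /=; apply: eq_bigr => k _.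
by rewrite lucas_v_sqrt3 !exprMn !exprVn; field; rewrite expf_neq0 ?pnatr_eq0.
Qed.

Lemma kvsumE : kvsum = l1 * f^`().[l1] + l2 * f^`().[l2].
Proof.
rewrite -!legendre_dsum -big_split /=; apply: eq_bigr => k _.
by rewrite lucas_v_sqrt3 !exprMn !exprVn; field; rewrite expf_neq0 ?pnatr_eq0.
Qed.

Lemma usumE : 2 * r * usum = f.[l1] - f.[l2].
Proof.
rewrite -!legendre_sum -sumrB mulr_sumr /=; apply: eq_bigr => k _.
transitivity (legendre_coef F n k * ((2 * r * (lucas_u 4 1 k)%:~R) / 4 ^+ k)); first by ring.
by rewrite lucas_u_sqrt3 !exprMn !exprVn; field; rewrite expf_neq0 ?pnatr_eq0.
Qed.

Lemma kusumE : 2 * r * kusum = l1 * f^`().[l1] - l2 * f^`().[l2].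
Proof.
rewrite -!legendre_dsum -sumrB mulr_sumr /=; apply: eq_bigr => k _.
transitivity (legendre_coef F n k * (k%:R * (2 * r * (lucas_u 4 1 k)%:~R) / 4 ^+ k)); first by ring.
by rewrite lucas_u_sqrt3 !exprMn !exprVn; field; rewrite expf_neq0 ?pnatr_eq0.
Qed.

(** For even n the polynomial takes one value at l1 and l2, half of [vsum]; multiplying [kvsum] by
    it leaves only products f f', which Clausen's formula controls. *)
Lemma even_sums : ~~ odd n ->
  [/\ vsum = 2 * (3 / 4) ^+ n./2 * hs, vsum ^+ 2 = 4 * cl & vsum * kvsum = - (12 * kcl)].
Proof.
move=> even_n; have [f1 s1 d1] := at1; have [f2 s2 d2] := at2.
have f12 : f.[l1] = f.[l2] by rewrite f1 f2 exprNn -signr_odd (negPf even_n) mul1r.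
rewrite vsumE kvsumE -f12; split.
- have -> : f.[l1] = (3 / 4) ^+ n./2 * hs.
    by rewrite f1 -u_sqr -sqrrN -exprM mul2n even_halfK.
  by ring.
- by rewrite -s1; ring.
transitivity (2 * l1 * (f.[l1] * f^`().[l1]) + 2 * l2 * (f.[l1] * f^`().[l2])); first by ring.
by rewrite d1 f12 d2 /l1 /l2; field: r2.
Qed.

(** For odd n the values at l1 and l2 are opposite. The last clause rests on equal derivatives at l1
    and l2, obtained by cancelling the value of f, hence its condition. *)
Lemma odd_sums : odd n ->
  [/\ usum = - (1 / 2) * (3 / 4) ^+ n./2 * hs, 3 * usum ^+ 2 = cl,
      usum * kusum = - kcl & usum != 0 -> kvsum = 4 * kusum].
Proof.
move=> odd_n; have [f1 s1 d1] := at1; have [f2 s2 d2] := at2.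
have f12 : f.[l1] = - f.[l2] by rewrite f1 f2 exprNn -signr_odd odd_n mulN1r mulNr.
have r20 : 2 * r != 0 by rewrite mulf_neq0 ?pnatr_eq0.
have uE : usum = - (f.[l2] / r).
  by apply: (mulfI r20); rewrite usumE f12; field.
have kuE : kusum = (l1 * f^`().[l1] - l2 * f^`().[l2]) / (2 * r).
  by rewrite -kusumE mulrAC mulfV ?mul1r.
split.
- have e : (r / 2) ^+ n = r / 2 * (3 / 4) ^+ n./2.
    by rewrite -u_sqr -exprM mul2n -exprS -[in LHS](odd_double_half n) odd_n.
  by rewrite uE f2 e; field.
- by rewrite uE sqrrN expr_div_n r2 s2; field.
- transitivity ((l1 * (- f.[l2] * f^`().[l1]) + l2 * (f.[l2] * f^`().[l2])) / (2 * r ^+ 2)).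
    by rewrite uE kuE; field.
  by rewrite -f12 d1 d2 r2 /l1 /l2; field: r2.
rewrite uE oppr_eq0 mulf_eq0 negb_or => /andP[f0 _].
have d12 : f^`().[l1] = f^`().[l2].
  by apply: (mulfI f0); apply: oppr_inj; rewrite -mulNr -f12 d1 d2.
by rewrite kvsumE kuE d12 /l1 /l2; field.
Qed.

End Sqrt3.

Lemma trisum_hsum (F : realFieldType) n : trisum F n = hsum n (1 : F).
Proof.
apply: eq_bigr => j _; rewrite /term poch1.
case: (leqP (2 * j) n) => [le_jn|lt_nj]; last first.
  by rewrite bin_small // mul0n !mul0r ffact_small // !mul0r.
rewrite -bin_ffact !natrM -(@bin_fact (2 * j) j); last by lia.
rewrite (_ : 2 * j - j = j)%N ?natrM; last by lia.
have f0 : j`!%:R != 0 :> F by rewrite pnatr_eq0 -lt0n fact_gt0.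
by field.
Qed.

Section RationalSums.
Variable n : nat.
Local Notation Q2C := (ratr : rat -> algC).

Let ratr_legendre k : ratr (legendre_coef rat n k) = legendre_coef algC n k.
Proof. by rewrite /legendre_coef rmorphM rmorphXn rmorphN1 rmorph_nat. Qed.

Let ratr_clausen k : ratr (clausen_coef rat n k) = clausen_coef algC n k.
Proof. by rewrite /clausen_coef rmorphM /= ratr_legendre rmorph_nat. Qed.

Let ratrs := (ratr_legendre, ratr_clausen, rmorph_nat, rmorph_int, fmorph_div, rmorphM,
  rmorphXn, rmorphN, rmorph1).

Let ratr_tri : ratr (trisum rat n) = trisum algC n.
Proof. by rewrite rmorph_sum; apply: eq_bigr => k _; rewrite rmorphM rmorph_nat rmorphXn rmorphN fmorph_div rmorph1 rmorph_nat. Qed.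
Let ratr_cl : ratr (clsum rat n) = clsum algC n.
Proof. by rewrite rmorph_sum; apply: eq_bigr => k _; rewrite fmorph_div rmorphXn rmorph_nat /= ratr_clausen. Qed.
Let ratr_kcl : ratr (kclsum rat n) = kclsum algC n.
Proof. by rewrite rmorph_sum; apply: eq_bigr => k _; rewrite fmorph_div rmorphM rmorphXn !rmorph_nat /= ratr_clausen. Qed.
Let ratr_v : ratr (vsum rat n) = vsum algC n.
Proof. by rewrite rmorph_sum; apply: eq_bigr => k _; rewrite rmorphM /= ratr_legendre fmorph_div rmorphXn rmorph_int rmorph_nat. Qed.
Let ratr_kv : ratr (kvsum rat n) = kvsum algC n.
Proof. by rewrite rmorph_sum; apply: eq_bigr => k _; rewrite rmorphM /= ratr_legendre fmorph_div rmorphM rmorphXn rmorph_int !rmorph_nat. Qed.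
Let ratr_u : ratr (usum rat n) = usum algC n.
Proof. by rewrite rmorph_sum; apply: eq_bigr => k _; rewrite rmorphM /= ratr_legendre fmorph_div rmorphXn rmorph_int rmorph_nat. Qed.
Let ratr_ku : ratr (kusum rat n) = kusum algC n.
Proof. by rewrite rmorph_sum; apply: eq_bigr => k _; rewrite rmorphM /= ratr_legendre fmorph_div rmorphM rmorphXn rmorph_int !rmorph_nat. Qed.

Let sqrtC3 : sqrtC 3 ^+ 2 = 3 :> algC. Proof. exact: sqrtCK. Qed.

Let inj (x y : rat) : Q2C x = Q2C y -> x = y. Proof. exact: fmorph_inj. Qed.

(** All sums are rational, so the square root of 3 used in [algC] drops out by injectivity of
    [ratr]. *)
Lemma rat_even_sums : ~~ odd n ->
  [/\ vsum rat n = 2 * (3 / 4) ^+ n./2 * hsum n (1 : rat), vsum rat n ^+ 2 = 4 * clsum rat n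
    & vsum rat n * kvsum rat n = - (12 * kclsum rat n)].
Proof.
move=> /(even_sums sqrtC3)[e1 e2 e3]; split; apply: inj; rewrite -?trisum_hsum.
- by rewrite ratr_v e1 !ratrs -ratr_tri.
- by rewrite rmorphXn rmorphM rmorph_nat /= ratr_v e2 ratr_cl.
- by rewrite rmorphN !rmorphM rmorph_nat /= ratr_v ratr_kv e3 ratr_kcl.
Qed.

Lemma rat_odd_sums : odd n ->
  [/\ usum rat n = - (1 / 2) * (3 / 4) ^+ n./2 * hsum n (1 : rat),
      3 * usum rat n ^+ 2 = clsum rat n, usum rat n * kusum rat n = - kclsum rat n
    & usum rat n != 0 -> kvsum rat n = 4 * kusum rat n].
Proof.
move=> /(odd_sums sqrtC3)[e1 e2 e3 e4]; split.
- by apply: inj; rewrite -?trisum_hsum ratr_u e1 !ratrs -ratr_tri.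
- by apply: inj; rewrite rmorphM rmorphXn rmorph_nat /= ratr_u e2 ratr_cl.
- by apply: inj; rewrite rmorphM rmorphN /= ratr_u ratr_ku e3 ratr_kcl.
move=> u0; apply: inj; rewrite rmorphM rmorph_nat /= ratr_kv ratr_ku; apply: e4.
by rewrite -ratr_u fmorph_eq0.
Qed.
End RationalSums.

(** * Arithmetic modulo the square of p *)

Section ModP2.
Variables (p : nat) (p_pr : prime p).
Local Notation R := 'Z_(p ^ 2).
Local Notation P := (p%:R : R).

Lemma sqr_gt1 : (1 < p ^ 2)%N.
Proof. by have := prime_gt1 p_pr; nia. Qed.

Lemma natR_eq (i j : nat) : ((i%:R : R) == j%:R) = (i == j %[mod p ^ 2])%N.
Proof. by rewrite -val_eqE /= !val_Zp_nat ?sqr_gt1. Qed.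

Lemma natR_eq0 (i : nat) : ((i%:R : R) == 0) = (p ^ 2 %| i)%N.
Proof. by rewrite -[0]/(0%:R) natR_eq mod0n. Qed.

Lemma natRP (z : R) : exists k : nat, z = k%:R.
Proof. by exists z; rewrite natr_Zp. Qed.

Lemma unitR (i : nat) : ((i%:R : R) \is a GRing.unit) = coprime p i.
Proof. by rewrite unitZpE ?sqr_gt1 // coprime_pexpl. Qed.

Lemma PP0 : P * P = 0.
Proof. by rewrite -natrM; apply/eqP; rewrite natR_eq0 mulnn. Qed.

Lemma P_mul_eq0 (z : R) : P * z = 0 -> exists w, z = P * w.
Proof.
have [k ->] := natRP z; rewrite -natrM => /eqP; rewrite natR_eq0 dvdn_pmul2l ?prime_gt0 //.
by case/dvdnP => j ->; exists j%:R; rewrite natrM mulrC.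
Qed.

(** An equality P * x = P * y stands for congruence modulo p inside Z/p^2; this lemma and the next
    convert between the two. *)
Lemma P_mul_mod (i j : nat) : (i = j %[mod p])%N -> P * i%:R = P * j%:R.
Proof. by move=> e; rewrite -!natrM; apply/eqP; rewrite natR_eq -!muln_modr e. Qed.

Lemma P_mul_inj (i j : nat) : P * i%:R = P * j%:R -> (i = j %[mod p])%N.
Proof.
rewrite -!natrM => /eqP; rewrite natR_eq -!muln_modr eqn_pmul2l ?prime_gt0 //.
by move/eqP.
Qed.

Lemma P_mulX (x y : R) k : P * x = P * y -> P * x ^+ k = P * y ^+ k.
Proof.
by move=> e; elim: k => // k IH; rewrite !exprS mulrA e mulrAC IH mulrAC mulrA.
Qed.

(** x^p - y^p is x - y times a sum of p terms, all congruent to y^(p - 1) modulo p, so it gains a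
    second factor p. *)
Lemma eq_expp (x y : R) : P * x = P * y -> x ^+ p = y ^+ p.
Proof.
move=> e; have /P_mul_eq0[w xy] : P * (x - y) = 0 by rewrite mulrBr e subrr.
apply/eqP; rewrite -subr_eq0 subrXX xy mulrAC.
rewrite mulr_sumr (eq_bigr (fun=> P * y ^+ p.-1)) => [|i _]; last first.
  have lt_ip := ltn_ord i; rewrite mulrA (P_mulX _ e) -mulrA -exprD.
  by congr (_ * _ ^+ _); lia.
by rewrite sumr_const card_ord -[_ *+ p]mulr_natl !mulrA PP0 !mul0r.
Qed.

Lemma P_fermat (x : R) : P * x ^+ p = P * x.
Proof.
have [k ->] := natRP x; rewrite -natrX; apply: P_mul_mod.
exact: fermat_little.
Qed.

Lemma unit_P_mul (x y : R) : P * x = P * y -> x \is a GRing.unit -> y \is a GRing.unit.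
Proof.
have [i ->] := natRP x; have [j ->] := natRP y => /P_mul_inj e.
by rewrite !unitR -coprime_modr e coprime_modr.
Qed.

Lemma P_fermat1 (x : R) : x \is a GRing.unit -> P * x ^+ p.-1 = P.
Proof.
move=> ux; apply: (mulIr ux); rewrite -mulrA -exprSr prednK ?prime_gt0 //.
exact: P_fermat.
Qed.

Lemma euler_unit (x : R) : x \is a GRing.unit -> (x ^+ p) ^+ p.-1 = 1.
Proof.
have [k ->] := natRP x; rewrite unitR => co; rewrite -exprM -natrX -[1]/(1%:R).
apply/eqP; rewrite natR_eq; apply/eqP.
have := @Euler_exp_totient k (p ^ 2); rewrite totient_pfactor //= expn1 mulnC; apply.
by rewrite coprime_sym coprime_pexpl.
Qed.

End ModP2.

(** * Teichmueller lifts modulo p^2 *)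

Section Teichmuller.
Variables (p : nat) (p_pr : prime p).
Local Notation R := 'Z_(p ^ 2).
Local Notation P := (p%:R : R).
Local Notation F := 'F_p.

(** Modulo p^2 a single p-th power already gives the Teichmueller representative: it depends only on
    the class modulo p and is fixed by p-th powers. *)
Definition teich (a : F) : R := (nat_of_ord a)%:R ^+ p.
Local Notation T := teich.

Lemma FpP (a : F) : exists k : nat, a = k%:R.
Proof. by exists a; rewrite natr_Zp. Qed.

Lemma P_val_nat k : P * (nat_of_ord (k%:R : F))%:R = P * k%:R.
Proof. by apply: (P_mul_mod p_pr); rewrite val_Fp_nat // modn_mod. Qed.

Lemma teich_nat k : T k%:R = k%:R ^+ p.
Proof. by apply: (eq_expp p_pr); exact: P_val_nat. Qed.

Lemma P_teich (a : F) : P * T a = P * (nat_of_ord a)%:R.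
Proof. exact: P_fermat. Qed.

Lemma teich0 : T 0 = 0.
Proof. by rewrite -[0]/(0%:R : F) teich_nat expr0n gtn_eqF ?prime_gt0. Qed.

Lemma teich1 : T 1 = 1.
Proof. by rewrite -[1]/(1%:R : F) teich_nat expr1n. Qed.

Lemma teichM a b : T (a * b) = T a * T b.
Proof.
by have [i ->] := FpP a; have [j ->] := FpP b; rewrite -natrM !teich_nat natrM exprMn.
Qed.

Lemma teichX a k : T (a ^+ k) = T a ^+ k.
Proof. by elim: k => [|k IH]; rewrite ?teich1 // !exprS teichM IH. Qed.

Lemma P_teichB a b : P * (T a - T b) = P * (nat_of_ord (a - b))%:R.
Proof.
rewrite -[in LHS](subrK b a); move: (a - b) => c; rewrite mulrBr !P_teich.
have [i ->] := FpP c; have [j ->] := FpP b; rewrite -natrD !P_val_nat natrD.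
by rewrite mulrDr addrK.
Qed.

Lemma unit_val (a : F) : a != 0 -> ((nat_of_ord a)%:R : R) \is a GRing.unit.
Proof.
move=> a0; rewrite unitR // prime_coprime //; apply: contra a0 => /dvdnP[k e].
by rewrite -(natr_Zp a) e -Fp_nat_mod // modnMl.
Qed.

(** This stands in for the absence of zero divisors: it allows factors such as T(g)^k - 1 to be
    cancelled over Z/p^2. *)
Lemma unit_teichB a b : a != b -> T a - T b \is a GRing.unit.
Proof.
rewrite -subr_eq0 => /unit_val; apply: (unit_P_mul p_pr).
by rewrite P_teichB.
Qed.

Lemma teich_order a : a != 0 -> T a ^+ p.-1 = 1.
Proof. by move=> a0; apply: euler_unit => //; apply: unit_val. Qed.

Lemma teich_expp a : T a ^+ p = T a.
Proof.
have [-> | a0] := eqVneq a 0; first by rewrite teich0 expr0n gtn_eqF ?prime_gt0.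
transitivity (T a ^+ p.-1.+1); last by rewrite exprS teich_order ?mulr1.
by rewrite prednK ?prime_gt0.
Qed.

Lemma Fp_fermat (a : F) : a != 0 -> a ^+ p.-1 = 1.
Proof.
move=> a0; apply: (mulfI a0); rewrite -exprS prednK ?prime_gt0 // mulr1.
by have := expf_card a; rewrite card_Fp.
Qed.

Lemma exists_prim_root : exists g : F, p.-1.-primitive_root g.
Proof.
have p1 : (0 < p.-1)%N by have := prime_gt1 p_pr; lia.
have := @has_prim_root F p.-1 [seq a <- enum F | a != 0] p1.
case/(_ _ _ _)/hasP => [|||g _ gP]; last by exists g.
- apply/allP => a; rewrite mem_filter => /andP[a0 _]; rewrite unity_rootE.
  by rewrite Fp_fermat.
- by rewrite filter_uniq ?enum_uniq.
have : size (enum F) = p by rewrite -cardE card_Fp.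
rewrite -(count_predC (fun a : F => a != 0)) size_filter => e.
have : (count (predC (fun a : F => a != 0%R)) (enum F) <= 1)%N.
  rewrite (@eq_count _ _ (pred1 (0%R : F))) ?count_uniq_mem ?enum_uniq ?leq_b1 // => a.
  by rewrite /= negbK.
move=> le1; rewrite -ltnS prednK ?prime_gt0 //; apply: (leq_trans (eq_leq (esym e))).
rewrite -[X in (_ <= X)%N]addn1.
exact: leq_add (leqnn _) le1.
Qed.

End Teichmuller.

(** * A cubic-quadratic Jacobi sum *)

Section CharacterSums.
Variables (p : nat) (p_pr : prime p).
Local Notation R := 'Z_(p ^ 2).
Local Notation F := 'F_p.
Local Notation T := (@teich p).

Lemma prim_root_neq0 (g : F) : p.-1.-primitive_root g -> g != 0.
Proof.
move=> gP; apply/eqP => g0; have := prim_expr_order gP.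
by rewrite g0 expr0n gtn_eqF ?(prim_order_gt0 gP) // => /eqP; rewrite eq_sym oner_eq0.
Qed.

Lemma sum_prim_root g (f : F -> R) : p.-1.-primitive_root g ->
  \sum_(a | a != 0) f a = \sum_(k < p.-1) f (g ^+ k).
Proof.
move=> gP; have p1 := prim_order_gt0 gP.
rewrite -(big_mkord xpredT (fun k => f (g ^+ k))) /index_iota subn0.
rewrite -(big_map (fun k => g ^+ k) xpredT) big_uniq /=; last first.
  rewrite map_inj_in_uniq ?iota_uniq // => i j; rewrite !mem_iota !add0n => lti ltj.
  by move/eqP; rewrite (eq_prim_root_expr gP) !modn_small // => /eqP.
apply: eq_bigl => a; apply/idP/mapP => [a0 | [k _ ->]].
  have [i ->] := prim_rootP gP (Fp_fermat p_pr a0); exists (i : nat) => //.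
  by rewrite mem_iota add0n ltn_ord.
by rewrite expf_neq0 // prim_root_neq0.
Qed.

(** Character orthogonality: multiplying the variable by a primitive root g multiplies the sum by
    T(g)^k, and T(g)^k - 1 is a unit unless p - 1 divides k. *)
Lemma sum_teichX k : \sum_(a | a != 0) T a ^+ k = if (p.-1 %| k)%N then p.-1%:R else 0.
Proof.
have [g gP] := exists_prim_root p_pr.
have g0 := prim_root_neq0 gP.
case: ifP => [/dvdnP[j ->]|ndvd].
  rewrite (eq_bigr (fun=> 1)) => [|a a0]; last by rewrite mulnC exprM teich_order ?expr1n.
  rewrite sumr_const; congr (_%:R).
  have := cardC1 (0 : F); rewrite card_Fp // => <-.
have u : T g ^+ k - 1 \is a GRing.unit.
  rewrite -(teich1 p_pr) -(teichX p_pr); apply: unit_teichB => //.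
  by rewrite -(prim_order_dvd gP) ndvd.
apply: (mulrI u); rewrite mulr0 mulrBl mul1r; apply/eqP; rewrite subr_eq0; apply/eqP.
rewrite mulr_sumr [RHS](reindex_onto (fun a => g * a) (fun a => g^-1 * a)) /=; last first.
  by move=> a _; rewrite mulVKf.
apply: eq_big => [a|a a0]; last by rewrite teichM // exprMn.
by rewrite mulKf // eqxx andbT mulf_eq0 negb_or g0.
Qed.

End CharacterSums.

Section JacobiSum.
Variables (p m : nat) (p_pr : prime p) (pE : p = (6 * m).+1) (m0 : (0 < m)%N).
Local Notation R := 'Z_(p ^ 2).
Local Notation P := (p%:R : R).
Local Notation F := 'F_p.
Local Notation T := (@teich p).

(* Characters of orders 3, 3 and 2 of F_p with values in Z/p^2, where [jac] and [jacc] play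
   the role of complex conjugate Jacobi sums. *)
Definition chi3 (a : F) : R := T a ^+ (4 * m).
Definition chi3c (a : F) : R := T a ^+ (2 * m).
Definition chi2 (a : F) : R := T a ^+ (3 * m).
Definition jac : R := \sum_(a : F) chi3 a * chi2 (1 - a).
Definition jacc : R := \sum_(a : F) chi3c a * chi2 (1 - a).

Let p1 : p.-1 = (6 * m)%N. Proof. by rewrite pE. Qed.

Lemma teich0X k : (0 < k)%N -> T 0 ^+ k = 0.
Proof. by move=> k0; rewrite teich0 // expr0n gtn_eqF. Qed.

Lemma teich_order6 a : a != 0 -> T a ^+ (6 * m) = 1.
Proof. by rewrite -p1; apply: teich_order. Qed.

Lemma sum_chi k : ~~ (6 * m %| k)%N -> \sum_a T a ^+ k = 0.
Proof.
move=> nd; rewrite (bigD1 0) //= teich0X; last first.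
  by move: nd; rewrite lt0n; apply: contra => /eqP ->; rewrite dvdn0.
by rewrite add0r sum_teichX // p1 (negPf nd).
Qed.

Lemma chi2_sqr a : a != 0 -> chi2 a ^+ 2 = 1.
Proof. by move=> a0; rewrite /chi2 -exprM mulnAC -(teich_order6 a0). Qed.

Lemma chi2M a b : chi2 (a * b) = chi2 a * chi2 b.
Proof. by rewrite /chi2 teichM // exprMn. Qed.

Lemma chi2_1 : chi2 1 = 1. Proof. by rewrite /chi2 teich1 // expr1n. Qed.
Lemma chi2_0 : chi2 0 = 0. Proof. by rewrite /chi2 teich0X // muln_gt0. Qed.

Lemma sum_chi2 : \sum_a chi2 a = 0.
Proof. by apply: sum_chi; apply/negP => /dvdn_leq; lia. Qed.

(** For c = 1 the argument is a square. Otherwise put b = 1 - d, take d^2 out of the character and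
    invert d; the argument becomes affine, and only the missing term has to be restored. *)
Lemma sum_chi2_quad c : c != 0 ->
  \sum_(b | b != 0) chi2 ((1 - c * b) * (1 - b)) = (if c == 1 then P else 0) - chi2 c - 1.
Proof.
move=> c0; case: eqP => [-> | /eqP c1].
  rewrite (eq_bigr (fun b => chi2 (1 - b) ^+ 2)) => [|b _]; last by rewrite mul1r chi2M expr2.
  have : \sum_b chi2 (1 - b) ^+ 2 = p.-1%:R.
    rewrite (reindex_inj (inv_inj (subKr 1))) /= (bigD1 0) //= subKr chi2_0 expr0n add0r.
    transitivity (\sum_(b : F | b != 0) T b ^+ 0); last by rewrite sum_teichX ?dvdn0.
    by apply: eq_bigr => b b0; rewrite subKr chi2_sqr // expr0.
  rewrite (bigD1 0) //= subr0 chi2_1 expr1n => e.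
  apply: (addrI 1); rewrite e pE /= -natr1; ring.
have -> : \sum_(b | b != 0) chi2 ((1 - c * b) * (1 - b))
    = \sum_b chi2 ((1 - c * b) * (1 - b)) - 1.
  by rewrite [in RHS](bigD1 0) //= mulr0 subr0 mulr1 chi2_1 addrC addrK.
congr (_ - 1); rewrite sub0r.
rewrite (reindex_inj (inv_inj (subKr 1))) /= (bigD1 0) //= subKr mulr0 chi2_0 add0r.
transitivity (\sum_(d : F | d != 0) chi2 (d^-1 * (1 - c) + c)).
  apply: eq_bigr => d d0; rewrite subKr.
  transitivity (chi2 (d ^+ 2 * (d^-1 * (1 - c) + c))); last first.
    by rewrite chi2M expr2 chi2M -expr2 chi2_sqr ?mul1r.
  by congr chi2; field.
have c10 : 1 - c != 0 by rewrite subr_eq0 eq_sym.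
transitivity (\sum_(e : F | e != 0) chi2 (e * (1 - c) + c)).
  rewrite [RHS](reindex_inj invr_inj) /=; apply: eq_bigl => d.
  by rewrite invr_eq0.
apply: (addrI (chi2 c)); rewrite addrN -[RHS]sum_chi2.
rewrite [RHS](reindex_inj (h := fun e => e * (1 - c) + c)) /=; last first.
  by move=> x y /addIr /(mulIf c10).
by rewrite [RHS](bigD1 0) //= mul0r add0r.
Qed.

(** In the double sum the cubic characters of a = cb and of b combine to that of c alone. By
    [sum_chi2_quad] and orthogonality only the term with c = 1 survives. *)
Lemma jac_norm : jac * jacc = P.
Proof.
have chi0 : chi3 0 = 0 by rewrite /chi3 teich0X // muln_gt0.
have chic0 : chi3c 0 = 0 by rewrite /chi3c teich0X // muln_gt0.
have s1 : \sum_a chi3 a = 0 by apply: sum_chi; apply/negP => /dvdn_leq; lia.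
have s2 : \sum_a chi3 a * chi2 a = 0.
  rewrite -[RHS](@sum_chi (4 * m + 3 * m)); last first.
    by apply/negP => /dvdnP[k]; case: k => [|[|k]]; nia.
  by apply: eq_bigr => a _; rewrite -exprD.
transitivity (\sum_(b | b != 0) \sum_c chi3 c * chi2 ((1 - c * b) * (1 - b))).
  rewrite mulrC /jacc (bigD1 0) //= chic0 mul0r add0r mulr_suml; apply: eq_bigr => b b0.
  rewrite /jac mulr_sumr (reindex_inj (mulIf b0)) /=; apply: eq_bigr => c _.
  rewrite chi2M mulrACA; congr (_ * _); last exact: mulrC.
  transitivity (chi3 c * (T b ^+ (6 * m))); last by rewrite teich_order6 ?mulr1.
  by rewrite /chi3 /chi3c teichM // exprMn mulrCA -exprD; congr (_ * _ ^+ _); lia.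
rewrite exchange_big /= (bigD1 0) //= big1 ?add0r => [|b _]; last by rewrite chi0 mul0r.
transitivity (\sum_(c : F | c != 0) chi3 c * ((if c == 1 then P else 0) - chi2 c - 1)).
  by apply: eq_bigr => c c0; rewrite -mulr_sumr sum_chi2_quad.
transitivity (\sum_(c : F) chi3 c * ((if c == 1 then P else 0) - chi2 c - 1)).
  by rewrite [RHS](bigD1 0) //= chi0 mul0r add0r.
transitivity (\sum_(c : F) ((if c == 1 then P else 0) - chi3 c * chi2 c - chi3 c)).
  apply: eq_bigr => c _; case: eqP => [-> | _]; last by ring.
  by rewrite /chi3 teich1 // expr1n !mul1r.
by rewrite !sumrB s1 s2 !subr0 -big_mkcond big_pred1_eq.
Qed.

End JacobiSum.

(** * Integer coordinates of the Jacobi sum *)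

Section JacobiInteger.
Variables (p m : nat) (p_pr : prime p) (pE : p = (6 * m).+1) (m0 : (0 < m)%N).
Local Notation R := 'Z_(p ^ 2).
Local Notation P := (p%:R : R).
Local Notation F := 'F_p.
Local Notation T := (@teich p).
Local Notation chi := (@chi2 p m).

Let p1 : p.-1 = (6 * m)%N. Proof. by rewrite pE. Qed.

Lemma intR_eq0 (z : int) : (z%:~R : R) = 0 -> (`|z| < p ^ 2)%N -> z = 0.
Proof.
move=> z0 ltz; apply/eqP; rewrite -absz_eq0.
have : (`|z|%:R : R) == 0.
  by case: z z0 {ltz} => n /= z0; [exact/eqP | rewrite -oppr_eq0; exact/eqP].
rewrite natR_eq0 // => dv; case: (posnP `|z|%N) => [/eqP // | z1].
by have := dvdn_leq z1 dv; rewrite leqNgt ltz.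
Qed.

(** The quadratic character with values in Z, so that the coordinates of the Jacobi sum can be
    bounded. *)
Definition quad_sign (a : F) : int := if a == 0 then 0 else if chi a == 1 then 1 else -1.

Lemma teichN1 : T (-1) = -1.
Proof.
have u : T (-1) - 1 \is a GRing.unit.
  rewrite -(teich1 p_pr); apply: unit_teichB => //.
  rewrite -subr_eq0 -opprD oppr_eq0 -[1 + 1]/(2%:R).
  by rewrite -(dvdn_pcharf (pchar_Fp p_pr)) gtnNdvd //; lia.
apply/eqP; rewrite -addr_eq0; apply/eqP; apply: (mulrI u).
by rewrite mulr0 -subr_sqr expr1n expr2 -teichM // mulrNN mulr1 teich1 // subrr.
Qed.

Lemma chi2E a : chi a = (quad_sign a)%:~R.
Proof.
rewrite /quad_sign; have [-> | a0] := eqVneq a 0; first exact: chi2_0.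
have [-> // | ne1] := eqVneq (chi a) 1.
have : (a ^+ (3 * m)) ^+ 2 == 1.
  by rewrite -exprM mulnAC; apply/eqP; have := Fp_fermat p_pr a0; rewrite p1.
rewrite sqrf_eq1 => /orP[] /eqP e.
  by move: ne1; rewrite /chi2 -teichX // e teich1 // eqxx.
by rewrite /chi2 -teichX // e teichN1.
Qed.

Lemma quad_sign_le1 a : `|quad_sign a| <= 1.
Proof. by rewrite /quad_sign; do 2 case: ifP => // _. Qed.

Lemma quad_sign_odd a : a != 0 -> exists d, quad_sign a = 1 - 2 * d.
Proof.
rewrite /quad_sign => /negPf ->; case: ifP => _; [by exists 0 | by exists 1].
Qed.

Lemma sum_split3 (f : nat -> R) N :
  \sum_(k < 3 * N) f k
  = \sum_(j < N) f (3 * j)%N + \sum_(j < N) f (3 * j).+1 + \sum_(j < N) f (3 * j).+2.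
Proof.
elim: N => [|N IH]; first by rewrite muln0 !big_ord0 !addr0.
rewrite mulnS !addSn add0n !big_ord_recr /= IH.
by ring.
Qed.

(* The coordinates of the Jacobi sum are integers, small enough for the norm equation, a
   priori modulo p^2, to hold in Z. *)
Lemma jac_integer : exists (x b : int) (sg : R),
  [/\ sg ^+ 2 = -3, jac p m = x%:~R + b%:~R * sg, jacc p m = x%:~R - b%:~R * sg,
      p%:Z = x ^+ 2 + 3 * b ^+ 2 & exists d, x = - 1 - 3 * d].
Proof.
have [g gP] := exists_prim_root p_pr.
pose th := T g ^+ (4 * m).
have th3 : th ^+ 3 = 1.
  rewrite /th -!teichX // -exprM (_ : 4 * m * 3 = p.-1 * 2)%N; last by rewrite p1; lia.
  by rewrite exprM (prim_expr_order gP) expr1n teich1.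
have th_min : 1 + th + th ^+ 2 = 0.
  have u : th - 1 \is a GRing.unit.
    rewrite /th -(teich1 p_pr) -teichX //; apply: unit_teichB => //.
    by rewrite -(prim_order_dvd gP) p1; apply/negP => /dvdnP[k]; case: k => [|[|k]]; nia.
  apply: (mulrI u); rewrite mulr0; transitivity (th ^+ 3 - 1); first by ring.
  by rewrite th3 subrr.
pose e k := quad_sign (1 - g ^+ k).
(* Grouping the powers of g by exponent modulo 3 gives J = c0 + c1 th + c2 th^2. *)
pose c i := \sum_(j < 2 * m) e (3 * j + i)%N.
have sumE (f : F -> R) : f 0 = 0 ->
    \sum_a f a * chi (1 - a) = \sum_(k < 6 * m) f (g ^+ k) * (e k)%:~R.
  move=> f0; rewrite (bigD1 0) //= f0 mul0r add0r (sum_prim_root p_pr _ gP) p1.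
  by apply: eq_bigr => k _; rewrite chi2E.
have split (w : R) : w ^+ 3 = 1 -> \sum_(k < 6 * m) w ^+ k * (e k)%:~R
    = (c 0)%:~R + (c 1)%:~R * w + (c 2)%:~R * w ^+ 2.
  move=> w3; rewrite -[(6 * m)%N]/((3 * 2) * m)%N -mulnA.
  rewrite (sum_split3 (fun k => w ^+ k * (e k)%:~R)).
  rewrite /c !rmorph_sum /= !mulr_suml; congr (_ + _ + _); apply: eq_bigr => j _.
  - by rewrite exprM w3 expr1n mul1r addn0.
  - by rewrite exprS exprM w3 expr1n mulr1 addn1 mulrC.
  - by rewrite -(addn2 (3 * j)) exprD exprM w3 expr1n mul1r mulrC.
have jacE : jac p m = (c 0)%:~R + (c 1)%:~R * th + (c 2)%:~R * th ^+ 2.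
  rewrite -split // /jac sumE; last by rewrite /chi3 teich0X // muln_gt0.
  by apply: eq_bigr => k _; rewrite /chi3 teichX // /th exprAC.
have th2m : th ^+ 2 = T g ^+ (2 * m).
  have g0 := prim_root_neq0 gP; rewrite /th -exprM (_ : 4 * m * 2 = 6 * m + 2 * m)%N; last by lia.
  by rewrite exprD (teich_order6 p_pr pE g0) mul1r.
have jaccE : jacc p m = (c 0)%:~R + (c 1)%:~R * th ^+ 2 + (c 2)%:~R * th.
  have e4 : (th ^+ 2) ^+ 2 = th by rewrite -exprM -[(2 * 2)%N]/(3 + 1)%N exprD th3 mul1r.
  have e6 : (th ^+ 2) ^+ 3 = 1 by rewrite exprAC th3 expr1n.
  transitivity ((c 0)%:~R + (c 1)%:~R * th ^+ 2 + (c 2)%:~R * (th ^+ 2) ^+ 2); last by rewrite e4.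
  rewrite -split // /jacc sumE; last by rewrite /chi3c teich0X // muln_gt0.
  by apply: eq_bigr => k _; rewrite /chi3c teichX // th2m exprAC.
have c_le i : `|c i| <= (2 * m)%:Z.
  apply: le_trans (ler_norm_sum _ _ _) _.
  apply: le_trans (ler_sum _ (fun j _ => quad_sign_le1 _)) _.
  by rewrite sumr_const card_ord -mulr_natl mulr1 natz.
(* The quadratic character of 1 - a sums to 0 over all a, and a = 0 contributes 1. *)
have c_sum : c 0%N + c 1%N + c 2%N = -1.
  have z : c 0%N + c 1%N + c 2%N + 1 = 0.
    apply: intR_eq0; last first.
      have := c_le 0%N; have := c_le 1%N; have := c_le 2%N; rewrite pE; nia.
    rewrite !rmorphD /=.
    have := split 1 (expr1n R 3); rewrite expr1n !mulr1 => <-.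
    have := sum_chi2 p_pr pE m0; rewrite (reindex_inj (inv_inj (subKr 1))) /=.
    rewrite (bigD1 0) //= subr0 chi2_1 // (sum_prim_root p_pr _ gP) p1 addrC => s.
    rewrite -[RHS]s; congr (_ + _); apply: eq_bigr => k _.
    by rewrite expr1n mul1r chi2E.
  by rewrite -[LHS](addrK 1) z sub0r.
(* For i = 1, 2 the exponent 3k + i is never divisible by 6m, so [c i] is a sum of 2m odd signs. *)
have c_even i : (i == 1%N) || (i == 2%N) -> exists d, c i = 2 * d.
  move=> i12.
  have ne k : 1 - g ^+ (3 * k + i) != 0.
    rewrite subr_eq0 eq_sym -(prim_order_dvd gP) p1; apply/negP => /dvdnP[q].
    by case/orP: i12 => /eqP ->; lia.
  suff H N : exists d, \sum_(j < N) e (3 * j + i)%N = N%:Z - 2 * d.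
    by have [d cE] := H (2 * m)%N; exists (m%:Z - d); rewrite /c cE; lia.
  elim: N => [|N [d IH]]; first by exists 0; rewrite big_ord0.
  have [d' e'] := quad_sign_odd (ne N).
  by exists (d + d'); rewrite big_ord_recr /= IH /e e'; lia.
have [d1 c1E] := c_even 1%N isT; have [d2 c2E] := c_even 2%N isT.
have c0E : c 0%N = -1 - 2 * (d1 + d2) by lia.
(* With th = (sg - 1) / 2 the rational coordinate is c0 - (d1 + d2), and c0 = -1 - 2 (d1 + d2). Its
   class -1 modulo 3 later fixes the sign. *)
pose x := -1 - 3 * (d1 + d2); pose b := d1 - d2; pose sg := 2 * th + 1.
have sg2 : sg ^+ 2 = -3.
  have -> : sg ^+ 2 = 4 * (1 + th + th ^+ 2) - 3 by rewrite /sg; ring.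
  by rewrite th_min mulr0 sub0r.
have th2 : th ^+ 2 = - 1 - th.
  by apply/eqP; rewrite -subr_eq0; apply/eqP; rewrite -[RHS]th_min; ring.
have jE : jac p m = x%:~R + b%:~R * sg.
  rewrite jacE c0E c1E c2E th2 /x /b /sg; ring.
have jcE : jacc p m = x%:~R - b%:~R * sg.
  rewrite jaccE c0E c1E c2E th2 /x /b /sg; ring.
exists x, b, sg; split => //; last by exists (d1 + d2).
have PE : P = x%:~R ^+ 2 - b%:~R ^+ 2 * sg ^+ 2.
  by rewrite -[LHS](jac_norm p_pr pE m0) jE jcE; ring.
have norm : (x ^+ 2 + 3 * b ^+ 2 - p%:Z)%:~R = 0 :> R.
  rewrite rmorphB rmorphD rmorphXn rmorphM rmorphXn /= -[(p%:Z)%:~R]/P PE sg2; ring.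
apply/eqP; rewrite eq_sym -subr_eq0; apply/eqP; apply: (intR_eq0 norm).
have := c_le 0%N; have := c_le 1%N; have := c_le 2%N.
rewrite c0E c1E c2E /x /b pE; nia.
Qed.

End JacobiInteger.

(** * Alternating binomial sums and harmonic numbers *)

Section HarmonicSums.
Variables (R : comUnitRingType) (M : nat).
Hypothesis unitM : forall i, (0 < i <= M)%N -> (i%:R : R) \is a GRing.unit.
Implicit Types N r : nat.

Definition harm (n : nat) : R := \sum_(i < n) (i.+1%:R)^-1.

Lemma harmS n : harm n.+1 = harm n + (n.+1%:R)^-1.
Proof. exact: big_ord_recr. Qed.

Lemma harm0 : harm 0 = 0. Proof. exact: big_ord0. Qed.

Lemma eq_div_natr (a b i j : nat) : (0 < i <= M)%N -> (0 < j <= M)%N ->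
  (a * j = b * i)%N -> a%:R / i%:R = b%:R / j%:R :> R.
Proof.
move=> /unitM ui /unitM uj e; apply: (mulIr ui); rewrite divrK // mulrAC -natrM -e natrM.
by rewrite mulrK.
Qed.

Definition altsum N r : R := \sum_(j < r) (-1) ^+ j * ('C(N, j)%:R / (r - j)%:R).

Lemma altsumS N r : altsum N.+1 r.+1 = altsum N r.+1 - altsum N r.
Proof.
rewrite /altsum !big_ord_recl /= !bin0 -addrA; congr (_ + _).
rewrite -sumrN -big_split /=; apply: eq_bigr => j _.
by rewrite /bump /= add1n binS natrD exprS subSS; ring.
Qed.

(** Pascal's rule for [altsum N.+1 N.+1] leaves the range r <= N; this boundary value comes from (1
    - 1)^(N + 1) = 0. *)
Lemma altsum_last N : (N < M)%N -> altsum N N.+1 = (-1) ^+ N / N.+1%:R.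
Proof.
move=> lt_NM; have : (1 - 1 : R) ^+ N.+1 = 0 by rewrite subrr expr0n.
rewrite exprBn big_ord_recr /= subnn binn expr0 expr1n !mulr1 mulr1n.
move=> /eqP; rewrite addr_eq0 => /eqP s; apply/eqP; rewrite -subr_eq0; apply/eqP.
have -> : (-1) ^+ N / N.+1%:R = - (-1) ^+ N.+1 / N.+1%:R :> R by rewrite exprS mulN1r opprK.
rewrite -s mulr_suml -sumrB; apply: big1 => j _.
rewrite !expr1n !mulr1 -[(-1) ^+ j *+ _]mulr_natr -mulrA; apply/eqP; rewrite subr_eq0; apply/eqP.
congr (_ * _); apply: eq_div_natr; [have := ltn_ord j; lia | lia |].
by rewrite mulnC [RHS]mulnC -mul_bin_down.
Qed.

Lemma altsumE N r : (r <= N <= M)%N ->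
  altsum N r = (-1) ^+ r.+1 * 'C(N, r)%:R * (harm N - harm (N - r)).
Proof.
elim: N r => [|N IH] [|r] //.
- by rewrite /altsum big_ord0 subnn subrr mulr0.
- by rewrite /altsum big_ord0 subn0 subrr mulr0.
rewrite ltnS => /andP[le_rN lt_NM]; rewrite altsumS subSS.
rewrite (IH r) ?le_rN ?(ltnW lt_NM) //.
have e1 : 'C(N.+1, r.+1)%:R / N.+1%:R = 'C(N, r)%:R / r.+1%:R :> R.
  by apply: eq_div_natr; [lia | lia | rewrite mulnC -mul_bin_diag mulnC].
move: le_rN; rewrite leq_eqVlt => /orP[/eqP ->|lt_rN].
  rewrite altsum_last // !subnn harm0 harmS !binn !exprS; ring.
rewrite (IH r.+1) ?lt_rN ?(ltnW lt_NM) // (_ : N - r = (N - r.+1).+1)%N; last by lia.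
have e2 : 'C(N, r.+1)%:R / (N - r.+1).+1%:R = 'C(N, r)%:R / r.+1%:R :> R.
  apply: eq_div_natr; [lia | lia |].
  by rewrite mulnC mul_bin_left mulnC (_ : (N - r.+1).+1 = N - r)%N //; lia.
rewrite !harmS.
have -> : 'C(N.+1, r.+1)%:R = 'C(N, r.+1)%:R + 'C(N, r)%:R :> R by rewrite binS natrD.
have e3 : ('C(N, r.+1)%:R + 'C(N, r)%:R) / N.+1%:R = 'C(N, r.+1)%:R / (N - r.+1).+1%:R :> R.
  by rewrite -natrD -binS e1 e2.
move: e3; set u := _^-1; set v := _^-1; set c1 : R := 'C(N, r.+1)%:R; set c0 : R := 'C(N, r)%:R.
set h1 := harm N; set h2 := harm _ => e3.
rewrite !exprS; set s := (-1) ^+ r.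
transitivity (s * ((c1 + c0) * (h1 - h2) - c0 * v)); first by ring.
transitivity (s * ((c1 + c0) * u + (c1 + c0) * (h1 - h2) - (c1 + c0) * v)); last by ring.
by rewrite e3; ring.
Qed.

End HarmonicSums.

(** * The Jacobi sum by factorials and harmonic numbers *)

Section JacobiClosedForm.
Variables (p m : nat) (p_pr : prime p) (pE : p = (6 * m).+1) (m0 : (0 < m)%N).
Local Notation R := 'Z_(p ^ 2).
Local Notation P := (p%:R : R).
Local Notation F := 'F_p.
Local Notation T := (@teich p).
Local Notation inv k := ((k%:R : R)^-1).

Let p1 : p.-1 = (6 * m)%N. Proof. by rewrite pE. Qed.
Let PP : P * P = 0. Proof. exact: PP0. Qed.

Lemma unit_small i : (0 < i <= 6 * m)%N -> (i%:R : R) \is a GRing.unit.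
Proof.
by move=> i_bd; rewrite unitR // prime_coprime // gtnNdvd; lia.
Qed.

Lemma unit_fact_small k : (k <= 6 * m)%N -> (k`!%:R : R) \is a GRing.unit.
Proof.
elim: k => [|k IH] le_k; first exact: unitr1.
by rewrite factS natrM unitrM unit_small ?IH // ltnW.
Qed.

Lemma P_bin k : (k <= 6 * m)%N -> P * 'C(6 * m, k)%:R = P * (-1) ^+ k.
Proof.
elim: k => [|k IH] le_k; first by rewrite bin0 expr0.
have e : 'C(p, k.+1) = ('C(6 * m, k.+1) + 'C(6 * m, k))%N by rewrite pE binS.
have dv : (p %| 'C(p, k.+1))%N by apply: prime_dvd_bin => //; rewrite pE; lia.
have /(P_mul_mod p_pr) : (('C(6 * m, k.+1) + 'C(6 * m, k)) = 0 %[mod p])%N.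
  by rewrite -e mod0n; apply/eqP.
rewrite mulr0 natrD mulrDr IH ?(ltnW le_k) // exprS => /eqP.
by rewrite addr_eq0 => /eqP ->; ring.
Qed.

Lemma bin_p k : (k < 6 * m)%N -> ('C(p, k.+1)%:R : R) = P * (-1) ^+ k * inv k.+1.
Proof.
move=> lt_k; have u : (k.+1%:R : R) \is a GRing.unit by apply: unit_small.
apply: (mulIr u); rewrite divrK // -natrM mulnC -mul_bin_diag p1 natrM.
by rewrite P_bin // ltnW.
Qed.

(** The inner binomials are p (-1)^k / (k + 1) by [bin_p], so the part divisible by p is a truncated
    logarithm series. *)
Lemma onesub_expp (t : R) : t ^+ p = t ->
  (1 - t) ^+ p = 1 - t - P * \sum_(i < 6 * m) inv i.+1 * t ^+ i.+1.
Proof.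
move=> tp; pose f i : R := (-1) ^+ i * 1 ^+ (p - i) * t ^+ i *+ 'C(p, i).
have : \sum_(i < (6 * m).+2) f i = f 0 + \sum_(i < 6 * m) f i.+1 + f (6 * m).+1.
  by rewrite big_ord_recl big_ord_recr /= addrA.
rewrite -pE exprBn => ->.
rewrite {1 3}/f subnn subn0 expr0 !expr1n !mulr1 bin0 binn !mulr1n tp.
have -> : (-1) ^+ p = -1 :> R by rewrite -signr_odd pE /= oddM expr1.
rewrite mulN1r -!addrA; congr (_ + _); rewrite addrC; congr (_ + _).
rewrite mulr_sumr -sumrN; apply: eq_bigr => i _.
rewrite /f expr1n mulr1 -mulr_natr bin_p // exprS.
have := sqrr_sign R i; rewrite expr2 => s.
transitivity (- (P * inv i.+1 * t ^+ i.+1 * ((-1) ^+ i * (-1) ^+ i))); first by ring.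
by rewrite s mulr1; ring.
Qed.

Lemma exprB_P (x y : R) s : (x - P * y) ^+ s = x ^+ s - s%:R * P * y * x ^+ s.-1.
Proof.
elim: s => [|s IH]; first by rewrite !mul0r subr0.
rewrite exprS IH /=; case: s {IH} => [|s]; first by rewrite expr0 expr1; ring.
rewrite /= -[s.+2%:R]natr1 !exprS.
transitivity (x * (x * x ^+ s) - (s.+1%:R + 1) * P * y * (x * x ^+ s)
  + P * P * (s.+1%:R * y ^+ 2 * x ^+ s)); first by ring.
by rewrite PP mul0r addr0.
Qed.

(** A finite analogue of the Beta integral. *)
Definition betasum (r s : nat) : R := \sum_(a : F | a != 0) T a ^+ r * (1 - T a) ^+ s.

Lemma betasumE r s : betasum r s =
  (6 * m)%:R * \sum_(j < s.+1 | (6 * m %| r + j)%N) (-1) ^+ j * 'C(s, j)%:R.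
Proof.
rewrite /betasum.
transitivity (\sum_(j < s.+1) (-1) ^+ j * 'C(s, j)%:R * \sum_(a : F | a != 0) T a ^+ (r + j)).
  under [RHS]eq_bigr do rewrite mulr_sumr.
  rewrite exchange_big /=; apply: eq_bigr => a _.
  rewrite exprBn mulr_sumr; apply: eq_bigr => j _.
  by rewrite expr1n mulr1 -mulr_natr exprD; ring.
rewrite mulr_sumr [RHS]big_mkcond /=; apply: eq_bigr => j _.
by rewrite sum_teichX // p1; case: ifP; rewrite ?mulr0 // mulrC.
Qed.

(** T(1 - a) and (1 - T a)^p are p-th powers of elements congruent modulo p, hence equal; the rest
    is expansion to first order in p. *)
Lemma jac_betasum : jac p m = betasum (4 * m) (3 * m)
  - (3 * m)%:R * P * \sum_(i < 6 * m) inv i.+1 * betasum (4 * m + i.+1) (3 * m).-1.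
Proof.
rewrite /jac (bigD1 0) //= /chi3 teich0X ?muln_gt0 // mul0r add0r.
under [X in _ - _ * X]eq_bigr do rewrite /betasum mulr_sumr.
rewrite exchange_big mulr_sumr /= -sumrB; apply: eq_bigr => a a0.
have t1 : T (1 - a) = (1 - T a) ^+ p.
  apply: (eq_expp p_pr); rewrite -(P_teichB p_pr 1 a) teich1 //.
rewrite /chi2 t1 onesub_expp ?teich_expp // exprB_P mulrBr; congr (_ - _).
set K := (3 * m)%:R * P; set y := (1 - _) ^+ _.
transitivity (K * ((\sum_(i < 6 * m) inv i.+1 * T a ^+ i.+1) * (T a ^+ (4 * m) * y))).
  by ring.
congr (_ * _); rewrite mulr_suml; apply: eq_bigr => i _.
by rewrite exprD; ring.
Qed.

Local Notation harm := (@harm R).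

Lemma betasum_main : betasum (4 * m) (3 * m) = (6 * m)%:R * 'C(3 * m, m)%:R.
Proof.
rewrite betasumE; congr (_ * _).
(* For j <= 3m the number 4m + j is a multiple of 6m only at j = 2m. *)
have lt2 : (2 * m < (3 * m).+1)%N by lia.
rewrite (bigD1 (Ordinal lt2)) /=; last by rewrite -mulnDl dvdnn.
rewrite -signr_odd oddM mul1r big1 ?addr0 => [|j /andP[/dvdnP[k e]]].
  by rewrite -bin_sub ?leq_mul2r ?orbT // -mulnBl mul1n.
rewrite -val_eqE /= => ne; have := ltn_ord j; case: k e => [|[|k]]; nia.
Qed.

(* Modulo p the summation index i + 1 is 2m - j or -(j + 1 - 2m). *)
Lemma P_betasum_tail :
  P * \sum_(i < 6 * m) inv i.+1 * betasum (4 * m + i.+1) (3 * m).-1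
  = - (P * (altsum R (3 * m).-1 (2 * m) + (-1) ^+ m * altsum R (3 * m).-1 m)).
Proof.
have P6 : P * (6 * m)%:R = - P.
  have -> : (6 * m)%:R = P - 1 :> R by rewrite pE -natr1 addrK.
  by rewrite mulrBr PP mulr1 sub0r.
pose c j : R := (-1) ^+ j * 'C((3 * m).-1, j)%:R.
have -> : P * \sum_(i < 6 * m) inv i.+1 * betasum (4 * m + i.+1) (3 * m).-1
    = - P * \sum_(j < 3 * m) c j *
        \sum_(i < 6 * m | (6 * m %| 4 * m + i.+1 + j)%N) inv i.+1.
  under [in LHS]eq_bigr do rewrite betasumE prednK ?muln_gt0 // mulrCA.
  rewrite -mulr_sumr mulrA P6; congr (_ * _).
  under [in LHS]eq_bigr do rewrite big_mkcond /= mulr_sumr.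
  rewrite exchange_big /=; apply: eq_bigr => j _.
  rewrite [in RHS]big_mkcond /= mulr_sumr; apply: eq_bigr => i _.
  by case: ifP; rewrite ?mulr0 // mulrC.
rewrite mulNr; congr (- _).
(* For each j exactly one i makes 4m + i + 1 + j a multiple of 6m; the multiple is 6m for j < 2m and
   12m otherwise. *)
have split (f : nat -> R) : \sum_(j < 3 * m) f j
    = \sum_(j < 2 * m) f j + \sum_(j < m) f (2 * m + j)%N.
  by rewrite (_ : 3 * m = 2 * m + m)%N ?big_split_ord //; lia.
rewrite (split (fun j => c j * \sum_(i < 6 * m | (6 * m %| 4 * m + i.+1 + j)%N) inv i.+1)).
rewrite mulrDr [RHS]mulrDr; congr (_ + _).
  congr (_ * _); apply: eq_bigr => j _; have lt_j := ltn_ord j.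
  have lt_i : ((2 * m - j).-1 < 6 * m)%N by lia.
  rewrite (big_pred1 (Ordinal lt_i)) /= => [|i].
    by rewrite prednK ?subn_gt0 // /c mulrA.
  apply/idP/eqP => [/dvdnP[k e]|->].
    by apply/val_inj => /=; have := ltn_ord i; case: k e => [|[|k]] e; nia.
  by apply/dvdnP; exists 1%N => /=; lia.
rewrite !mulr_sumr [RHS](reindex_inj rev_ord_inj) /=; apply: eq_bigr => j _.
have lt_j := ltn_ord j.
have lt_i : ((6 * m - j).-1 < 6 * m)%N by lia.
rewrite (big_pred1 (Ordinal lt_i)) /= => [|i]; last first.
  apply/idP/eqP => [/dvdnP[k e]|->].
    by apply/val_inj => /=; have := ltn_ord i; case: k e => [|[|[|k]]] e; nia.
  by apply/dvdnP; exists 2%N => /=; lia.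
rewrite prednK; last by lia.
have -> : (m - (m - j.+1) = j.+1)%N by lia.
have -> : P * (c (2 * m + j)%N * inv (6 * m - j)) = - (P * c (2 * m + j)%N * inv j.+1).
  have u1 : ((6 * m - j)%:R : R) \is a GRing.unit by apply: unit_small; lia.
  have u2 : (j.+1%:R : R) \is a GRing.unit by apply: unit_small; lia.
  apply: (mulIr u1); rewrite mulrA divrK //; apply: (mulIr u2).
  have -> : (6 * m - j)%:R = P - j.+1%:R :> R.
    by apply/eqP; rewrite eq_sym subr_eq -natrD; apply/eqP; congr (_%:R); lia.
  transitivity (P * c (2 * m + j)%N * (j.+1%:R * inv j.+1 * j.+1%:R)
     - P * P * c (2 * m + j)%N * inv j.+1 * j.+1%:R); last by ring.
  by rewrite PP !mul0r subr0 mulrV // mul1r.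
have -> : c (2 * m + j)%N = (-1) ^+ j * 'C((3 * m).-1, m - j.+1)%:R.
  rewrite /c exprD exprM sqrrN expr1n expr1n mul1r -[in LHS]bin_sub; last by lia.
  by congr (_ * 'C(_, _)%:R); lia.
have -> : (-1) ^+ m = (-1) ^+ (m - j.+1) * (-1) ^+ j * -1 :> R.
  by rewrite -exprD -exprSr; congr (_ ^+ _); lia.
have := sqrr_sign R (m - j.+1); rewrite expr2; set s := (-1) ^+ (m - _) => s2.
transitivity (- (P * ((-1) ^+ j * 'C((3 * m).-1, m - j.+1)%:R * inv j.+1) * (s * s))).
  by rewrite s2; ring.
by ring.
Qed.

Lemma jac_closed : jac p m = - 'C(3 * m, m)%:R *
  (1 + m%:R * P * (3 * harm (3 * m) - harm m - 2 * harm (2 * m))).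
Proof.
rewrite jac_betasum betasum_main -mulrA P_betasum_tail.
have unitM i : (0 < i <= 3 * m)%N -> (i%:R : R) \is a GRing.unit.
  by move=> i_bd; apply: unit_small; lia.
rewrite !(altsumE unitM); try lia.
have -> : ((3 * m).-1 - 2 * m = m.-1)%N by lia.
have -> : ((3 * m).-1 - m = (2 * m).-1)%N by lia.
have harmP k : (0 < k)%N -> harm k.-1 = harm k - inv k.
  by case: k => // k _; rewrite harmS addrK.
rewrite !harmP ?muln_gt0 //.
have um : (m%:R : R) \is a GRing.unit by apply: unitM; lia.
have b1 : (3 * m)%:R * 'C((3 * m).-1, 2 * m)%:R = m%:R * 'C(3 * m, m)%:R :> R.
  rewrite -!natrM mul_bin_down -[in RHS]bin_sub; last by lia.
  by congr (_%:R); congr (_ * 'C(_, _))%N; lia.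
have b2 : (3 * m)%:R * 'C((3 * m).-1, m)%:R = 2 * m%:R * 'C(3 * m, m)%:R :> R.
  by rewrite -natrM mul_bin_down -(natrM _ 2) -natrM; congr (_%:R); congr (_ * 'C(_, _))%N; lia.
have i3 : m%:R * inv (3 * m) * 3 = 1.
  by rewrite mulrAC -natrM mulnC mulrV // unitM //; lia.
have i2 : m%:R * inv (2 * m) * 2 = 1.
  by rewrite mulrAC -natrM mulnC mulrV // unitM //; lia.
have i1 : m%:R * inv m = 1 by rewrite mulrV.
have -> : (6 * m)%:R = P - 1 :> R by rewrite pE -natr1 addrK.
have sm : (-1) ^+ m * (-1) ^+ m.+1 = -1 :> R.
  by rewrite exprS mulrCA -expr2 sqrr_sign mulr1.
have s2 : (-1) ^+ (2 * m).+1 = -1 :> R by rewrite exprS exprM sqrrN expr1n expr1n mulr1.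
rewrite s2; set C := 'C(3 * m, m)%:R in b1 b2 *.
set h1 := harm m; set h2 := harm (2 * m); set h3 := harm (3 * m).
transitivity ((P - 1) * C - P * (
  ((3 * m)%:R * 'C((3 * m).-1, 2 * m)%:R) * (h3 - inv (3 * m) - h1 + inv m)
  - ((-1) ^+ m * (-1) ^+ m.+1) * ((3 * m)%:R * 'C((3 * m).-1, m)%:R)
     * (h3 - inv (3 * m) - h2 + inv (2 * m)))); first by ring.
rewrite sm b1 b2.
(* The leftover multiple of P C is 1 + 1 - 1 - 1 = 0: the first 1 comes from 6m = P - 1, the others
   from the shifts of [harm k.-1] to [harm k]. *)
transitivity (- C * (1 + m%:R * P * (3 * h3 - h1 - 2 * h2)) +
  P * C * (1 + m%:R * inv (3 * m) * 3 - m%:R * inv m - m%:R * inv (2 * m) * 2)); first by ring.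
by rewrite i1 i2 i3; ring.
Qed.

End JacobiClosedForm.

(** * Quadratic reciprocity *)

(* For odd [a] and [b] prime to [a], [gauss_sign a b] is the Jacobi symbol (b / a), computed
   as in Gauss's lemma. *)
Definition mod_sign (a k : nat) : int := if (k %% a <= a./2)%N then 1 else -1.
Definition mod_abs (a k : nat) : nat :=
  (if (k %% a <= a./2) then k %% a else a - k %% a)%N.
Definition gauss_sign (a b : nat) : int := \prod_(j < a./2) mod_sign a (b * j.+1).

Lemma mod_signP a k : mod_sign a k = 1 \/ mod_sign a k = -1.
Proof. by rewrite /mod_sign; case: ifP; [left | right]. Qed.

Lemma mod_sign_sqr a k : mod_sign a k * mod_sign a k = 1.
Proof. by rewrite /mod_sign; case: ifP. Qed.

Lemma gauss_sign_sqr a b : gauss_sign a b * gauss_sign a b = 1.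
Proof.
rewrite /gauss_sign -big_split /=; apply: big1 => j _; exact: mod_sign_sqr.
Qed.

Lemma mod_sign_mod a k k' : (k = k' %[mod a])%N -> mod_sign a k = mod_sign a k'.
Proof. by rewrite /mod_sign => ->. Qed.

Lemma gauss_sign_mod a b b' : (b = b' %[mod a])%N -> gauss_sign a b = gauss_sign a b'.
Proof.
by move=> e; apply: eq_bigr => j _; apply: mod_sign_mod; rewrite -modnMml e modnMml.
Qed.

Lemma mod_signN a k k' : odd a -> ~~ (a %| k)%N -> (a %| k + k')%N ->
  mod_sign a k' = - mod_sign a k.
Proof.
move=> odd_a; rewrite /dvdn -modnDm /mod_sign.
have a0 : (0 < a)%N by case: a odd_a.
have := ltn_pmod k a0; have := ltn_pmod k' a0.
have [h aE] : exists h, a = h.*2.+1 by exists a./2; lia.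
have -> : (a./2 = h)%N by lia.
move: (k %% a)%N (k' %% a)%N => r r' lt_r' lt_r r0 /eqP e.
have s : (r + r' = a)%N.
  have := divn_eq (r + r') a; rewrite e addn0; case: ((r + r') %/ a)%N => [|[|q]]; nia.
by case: ifP; case: ifP => //; lia.
Qed.

(* k is congruent to [mod_sign a k * mod_abs a k] modulo a. *)
Lemma mod_absP a k : (0 < a)%N ->
  if mod_sign a k == 1 then (k = mod_abs a k %[mod a])%N else (a %| k + mod_abs a k)%N.
Proof.
move=> a0; rewrite /mod_sign /mod_abs; case: (leqP (k %% a) a./2) => _ /=; first by rewrite modn_mod.
have lt := ltn_pmod k a0.
by rewrite /dvdn -modnDml subnKC ?modnn // ltnW.
Qed.

Section Reindex.
Variables (a b : nat) (odd_a : odd a) (co_ab : coprime a b).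

Let a0 : (0 < a)%N. Proof. by case: a odd_a. Qed.

Lemma ndvd_mul j : (j < a./2)%N -> ~~ (a %| b * j.+1)%N.
Proof.
move=> lt_j; rewrite Gauss_dvdr // gtnNdvd //; lia.
Qed.

Lemma mod_abs_bound j : (j < a./2)%N -> (0 < mod_abs a (b * j.+1) <= a./2)%N.
Proof.
move=> /ndvd_mul; rewrite /dvdn /mod_abs => r0.
by have := ltn_pmod (b * j.+1) a0; case: ifP; lia.
Qed.

Lemma mod_abs_inj i j : (i < a./2)%N -> (j < a./2)%N ->
  mod_abs a (b * i.+1) = mod_abs a (b * j.+1) -> i = j.
Proof.
move=> lt_i lt_j e.
have [/eqP d|d] : (b * i.+1 = b * j.+1 %[mod a])%N \/ (a %| b * i.+1 + b * j.+1)%N.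
- have := mod_absP (b * i.+1) a0; have := mod_absP (b * j.+1) a0; rewrite -e.
  case: ifP => _ hj; case: ifP => _ hi.
  + by left; rewrite hi hj.
  + by right; rewrite /dvdn -modnDmr hj modnDmr.
  + by right; rewrite /dvdn addnC -modnDmr hi modnDmr.
  + left; apply/eqP; rewrite -(eqn_modDr (mod_abs a (b * i.+1))).
    by move: hi hj; rewrite /dvdn => /eqP -> /eqP ->.
- wlog le_ij : i j lt_i lt_j {e} d / (i <= j)%N.
    move=> H; case: (leqP i j) => [|/ltnW] le; first exact: H.
    by apply/esym/H => //; rewrite eq_sym.
  move: d; rewrite eq_sym eqn_mod_dvd ?leq_mul2l ?ltnS ?le_ij ?orbT // -mulnBr Gauss_dvdr //.
  rewrite subSS; case: (posnP (j - i)) => [|ji /(dvdn_leq ji)]; lia.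
by move: d; rewrite -mulnDr Gauss_dvdr // => /dvdn_leq; lia.
Qed.

Lemma prod_mod_abs (R : comNzRingType) (f : nat -> R) :
  \prod_(j < a./2) f (mod_abs a (b * j.+1)) = \prod_(j < a./2) f j.+1.
Proof.
pose g (j : 'I_(a./2)) : 'I_(a./2) := insubd j (mod_abs a (b * j.+1)).-1.
have gE j : (g j).+1 = mod_abs a (b * j.+1).
  have /andP[h0 h1] := mod_abs_bound (ltn_ord j).
  by rewrite /g val_insubd prednK // h1 prednK.
have g_inj : injective g.
  move=> i j /(congr1 (fun k : 'I_(a./2) => (k : nat).+1)); rewrite !gE => e.
  by apply/val_inj/(mod_abs_inj _ _ e); exact: ltn_ord.
rewrite [RHS](reindex_inj g_inj) /=; apply: eq_bigr => j _.
by rewrite gE.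
Qed.

(** Up to sign, multiplication by b permutes 1, ..., (a - 1) / 2, and each replacement of b j by its
    absolute residue costs the sign of b j. As a may be composite, Jacobi symbols need no
    factorization. *)
Lemma gauss_signM c : coprime a c ->
  gauss_sign a (c * b) = gauss_sign a c * gauss_sign a b.
Proof.
move=> co_ac; rewrite /gauss_sign -(prod_mod_abs (fun k => mod_sign a (c * k))) -big_split /=.
apply: eq_bigr => j _; rewrite -mulnA.
have := mod_absP (b * j.+1) a0; have := mod_abs_bound (ltn_ord j).
move=> bd; have [-> | ->] := mod_signP a (b * j.+1); rewrite /= => e.
  by rewrite mulr1; apply: mod_sign_mod; rewrite -modnMmr e modnMmr.
rewrite mulrN1; apply: mod_signN => //.
  by rewrite Gauss_dvdr // gtnNdvd //; lia.
by rewrite -mulnDr dvdn_mull // addnC.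
Qed.

Lemma prod_sign_exp (s : int) (f : nat -> nat) N :
  \prod_(j < N) s ^+ f j = s ^+ (\sum_(j < N) f j).
Proof.
by elim: N => [|N IH]; rewrite ?big_ord0 // !big_ord_recr /= IH exprD.
Qed.

(** Eisenstein's form of Gauss's lemma. Modulo 2, j + 1 is the quotient plus the remainder of b (j +
    1) by a, and the remainder differs in parity from [mod_abs] exactly when the sign is -1; the
    permuted product then cancels. *)
Lemma gauss_sign_floor : odd b ->
  gauss_sign a b = (-1) ^+ (\sum_(j < a./2) (b * j.+1) %/ a)%N.
Proof.
move=> odd_b.
have termE j : (-1) ^+ j.+1 = (-1) ^+ ((b * j.+1) %/ a)%N * (-1) ^+ mod_abs a (b * j.+1)
    * mod_sign a (b * j.+1) :> int.
  rewrite -[in LHS]signr_odd (_ : odd j.+1 = odd (b * j.+1)%N); last by rewrite oddM odd_b.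
  rewrite [in LHS](divn_eq (b * j.+1) a) oddD oddM odd_a andbT signr_addb signr_odd -mulrA.
  congr (_ * _); rewrite /mod_abs /mod_sign.
  have := ltn_pmod (b * j.+1) a0; move: ((b * j.+1) %% a)%N => r lt_r.
  case: ifP => _; first by rewrite mulr1 signr_odd.
  rewrite -[in RHS]signr_odd oddB ?(ltnW lt_r) // odd_a /= signrN; ring.
have e : \prod_(j < a./2) (-1) ^+ j.+1 = (-1) ^+ (\sum_(j < a./2) (b * j.+1) %/ a)%N
    * \prod_(j < a./2) (-1) ^+ j.+1 * gauss_sign a b :> int.
  under [in LHS]eq_bigr do rewrite termE.
  by rewrite !big_split /= (prod_mod_abs (fun k => (-1) ^+ k : int)) (prod_sign_exp (-1) (fun j => (b * j.+1) %/ a)%N).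
have u : (\prod_(j < a./2) (-1) ^+ j.+1 : int) != 0.
  by apply/prodf_neq0 => j _; rewrite signr_eq0.
have : (-1) ^+ (\sum_(j < a./2) (b * j.+1) %/ a)%N * gauss_sign a b = 1.
  by apply: (mulIf u); rewrite mul1r [RHS]e; ring.
move=> e1; apply: (mulfI (_ : (-1) ^+ (\sum_(j < a./2) (b * j.+1) %/ a)%N != 0 :> int)).
  by rewrite signr_eq0.
by rewrite e1 -expr2 sqrr_sign.
Qed.

End Reindex.

Lemma gauss_euler p b : prime p -> odd p -> coprime p b ->
  (gauss_sign p b)%:~R = b%:R ^+ p./2 :> 'F_p.
Proof.
move=> p_pr odd_p co_pb; have p0 := prime_gt0 p_pr.
have signE j : ((b * j.+1)%:R : 'F_p) = (mod_sign p (b * j.+1))%:~R * (mod_abs p (b * j.+1))%:R.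
  have := mod_absP (b * j.+1) p0; have [-> | ->] := mod_signP p (b * j.+1); rewrite /= => e.
    by rewrite mul1r -Fp_nat_mod // e Fp_nat_mod.
  by rewrite mulN1r; apply/eqP; rewrite -addr_eq0 -natrD -(dvdn_pcharf (pchar_Fp p_pr)).
have e : b%:R ^+ p./2 * \prod_(j < p./2) (j.+1)%:R
    = (gauss_sign p b)%:~R * \prod_(j < p./2) (j.+1)%:R :> 'F_p.
  rewrite -[X in _ = _ * X](prod_mod_abs odd_p co_pb (fun k => k%:R)) rmorph_prod -big_split /=.
  rewrite -[p./2 in X in X * _]card_ord -prodr_const -big_split /=.
  by apply: eq_bigr => j _; rewrite -natrM signE.
apply/esym/(mulIf _ e); apply/prodf_neq0 => j _.
by rewrite -(dvdn_pcharf (pchar_Fp p_pr)) gtnNdvd //; have := ltn_ord j; lia.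
Qed.

Lemma floor_count (a k x : nat) : (0 < a)%N -> (x < a * k.+1)%N ->
  (x %/ a = \sum_(i < k) (a * i.+1 <= x))%N.
Proof.
move=> a0; elim: k x => [|k IH] x lt_x.
  by rewrite big_ord0 divn_small //; lia.
rewrite big_ord_recr /=; case: (leqP (a * k.+1) x) => [le_x | lt_x']; last first.
  by rewrite addn0 -IH.
rewrite (eq_bigr (fun=> 1%N)) => [|i _]; last first.
  by rewrite (leq_trans _ le_x) // leq_mul2l ltnS (ltnW (ltn_ord i)) orbT.
rewrite sum1_card card_ord addn1; apply/eqP; rewrite eqn_leq.
rewrite -ltnS ltn_divLR // mulnC lt_x /= leq_divRL //; lia.
Qed.

(** The two exponents count the lattice points on either side of the diagonal in a rectangle;
    coprimality keeps points off the diagonal. *)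
Lemma gauss_reciprocity a b : odd a -> odd b -> coprime a b ->
  gauss_sign a b * gauss_sign b a = (-1) ^+ (a./2 * b./2).
Proof.
move=> odd_a odd_b co_ab.
have a0 : (0 < a)%N by case: a odd_a {co_ab}.
have b0 : (0 < b)%N by case: b odd_b {co_ab}.
rewrite !gauss_sign_floor // 1?coprime_sym // -exprD; congr (_ ^+ _).
rewrite (eq_bigr (fun j : 'I_(a./2) => \sum_(i < b./2) (a * i.+1 <= b * j.+1))%N); last first.
  by move=> j _; apply: floor_count => //; have := ltn_ord j; nia.
rewrite [X in (_ + X)%N](eq_bigr (fun i : 'I_(b./2) =>
    \sum_(j < a./2) (b * j.+1 <= a * i.+1))%N); last first.
  by move=> j _; apply: floor_count => //; have := ltn_ord j; nia.
rewrite [X in (_ + X)%N]exchange_big /= -big_split /=.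
rewrite (eq_bigr (fun=> b./2)) ?sum_nat_const ?card_ord // => j _.
rewrite -big_split /= (eq_bigr (fun=> 1%N)) ?sum1_card ?card_ord // => i _.
have ne : (a * i.+1 != b * j.+1)%N.
  apply/eqP => e; have : (a %| b * j.+1)%N by rewrite -e dvdn_mulr.
  by rewrite Gauss_dvdr // => /dvdn_leq; have := ltn_ord j; lia.
by case: (ltngtP (a * i.+1) (b * j.+1)) ne.
Qed.

Lemma gauss_sign2 h : gauss_sign h.*2.+1 2 = (-1) ^+ (h - h./2).
Proof.
have a2 : (h.*2.+1)./2 = h by lia.
rewrite /gauss_sign a2 (eq_bigr (fun j : 'I_h => (-1) ^+ (h < 2 * j.+1)%N)) => [|j _].
  rewrite (prod_sign_exp (-1) (fun j => (h < 2 * j.+1)%N : nat)); congr (_ ^+ _).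
  suff S k : (\sum_(j < k) (h < 2 * j.+1))%N = (k - h./2)%N by rewrite S.
  elim: k => [|k IH]; first by rewrite big_ord0.
  by rewrite big_ord_recr /= IH; case: ltnP; lia.
rewrite /mod_sign a2 modn_small; last by have := ltn_ord j; lia.
by case: leqP.
Qed.

Lemma gauss_signX a b s : odd a -> coprime a b -> gauss_sign a (b ^ s) = gauss_sign a b ^+ s.
Proof.
move=> odd_a co_ab; elim: s => [|s IH].
  rewrite expn0 expr0; apply: big1 => j _; rewrite mul1n /mod_sign modn_small.
    by rewrite ltn_ord.
  by have := ltn_ord j; lia.
by rewrite expnS gauss_signM ?coprimeXr // IH exprS.
Qed.

Lemma odd_part Y : (0 < Y)%N -> exists s Y1, [/\ Y = (2 ^ s * Y1)%N & odd Y1].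
Proof.
elim/ltn_ind: Y => Y IH Y0; case: (boolP (odd Y)) => [oddY | evY].
  by exists 0%N, Y; rewrite mul1n.
have [||s [Y1 [e o]]] := IH Y./2; [lia | lia |].
by exists s.+1, Y1; split=> //; rewrite expnS -mulnA -e; lia.
Qed.

(** * Powers of 3 modulo p from p = X^2 + 3 Y^2 *)

Section NormForm.
Variables (p X Y : nat) (p_pr : prime p) (pE : p = (X ^ 2 + 3 * Y ^ 2)%N).
Hypothesis p_gt3 : (3 < p)%N.
Local Notation gs := gauss_sign.

Let XY0 : (0 < X)%N /\ (0 < Y)%N.
Proof.
split.
  case: X pE => // e; have : (3 %| p)%N by rewrite e /= dvdn_mulr.
  by rewrite dvdn_prime2 // => /eqP; lia.
case: Y pE => // e; have : (X %| p)%N by rewrite e addn0 expnS dvdn_mulr.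
by case/primeP: p_pr => _ h /h /orP[] /eqP; nia.
Qed.

Let ltX : (X < p)%N. Proof. by have [] := XY0; nia. Qed.
Let ltY : (Y < p)%N. Proof. by have [] := XY0; nia. Qed.

Let co_p k : (0 < k < p)%N -> coprime p k.
Proof. by move=> bd; rewrite prime_coprime // gtnNdvd //; lia. Qed.

Let odd_p : odd p. Proof. by case: (even_prime p_pr) => // e; lia. Qed.

Let co3 : coprime 3 X.
Proof.
rewrite prime_coprime //; apply/negP => /dvdnP[q e].
have : (3 %| p)%N by apply/dvdnP; exists (3 * q ^ 2 + Y ^ 2)%N; rewrite pE e; nia.
by rewrite dvdn_prime2 // => /eqP; lia.
Qed.

Let co_dvd k Z : (k %| Z)%N -> (0 < Z < p)%N -> coprime p k.
Proof.
move=> kZ bd; apply: co_p; have := dvdn_leq _ kZ; case: k kZ => [|k] kZ; last lia.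
by move: kZ; rewrite dvd0n => /eqP e; rewrite e in bd.
Qed.

(* The Jacobi symbol of p modulo an odd divisor of Y is that of X^2. *)
Let gs_Ypart Y1 : odd Y1 -> (Y1 %| Y)%N -> gs p Y1 = (-1) ^+ (p./2 * Y1./2).
Proof.
move=> oddY1 dvY; have [X0 Y0] := XY0.
have co : coprime p Y1 by apply: co_dvd dvY _; lia.
have coX : coprime Y1 X.
  move: co; rewrite coprime_sym pE; case/dvdnP: dvY => q ->.
  rewrite -!mulnn addnC (_ : 3 * (q * Y1 * (q * Y1)) = 3 * q * q * Y1 * Y1)%N; last by lia.
  by rewrite /coprime gcdnMDl -/(coprime _ _) coprimeMr andbb.
have e : gs Y1 p = 1.
  rewrite (@gauss_sign_mod Y1 p (X * X)%N); last first.
    rewrite pE; case/dvdnP: dvY => q ->; rewrite -!mulnn.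
    by rewrite (_ : _ + _ = (3 * q * q * Y1) * Y1 + X * X)%N ?modnMDl //; lia.
  by rewrite gauss_signM // gauss_sign_sqr.
by have := gauss_reciprocity odd_p oddY1 co; rewrite e mulr1.
Qed.

(** Modulo X1 the prime p is 3 Y^2, so its symbol is that of 3; a second reciprocity turns it into
    [gs 3 X1] at the cost of the exponent [X1./2]. *)
Let gs_Xpart X1 : odd X1 -> (X1 %| X)%N ->
  gs p X1 = (-1) ^+ (p./2 * X1./2 + X1./2) * gs 3 X1.
Proof.
move=> oddX1 dvX; have [X0 Y0] := XY0.
have co : coprime p X1 by apply: co_dvd dvX _; lia.
have co3' : coprime 3 X1 by apply: coprime_dvdr dvX co3.
have coY : coprime X1 Y.
  move: co; rewrite coprime_sym pE; case/dvdnP: dvX => q ->.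
  rewrite -!mulnn (_ : q * X1 * (q * X1) = q * q * X1 * X1)%N; last by lia.
  by rewrite /coprime gcdnMDl -/(coprime _ _) !coprimeMr andbb => /andP[].
have e : gs X1 p = gs X1 3.
  rewrite (@gauss_sign_mod X1 p (3 * (Y * Y))%N); last first.
    rewrite pE; case/dvdnP: dvX => q ->; rewrite -!mulnn.
    by rewrite (_ : q * X1 * (q * X1) = (q * q * X1) * X1)%N ?modnMDl //; lia.
  by rewrite gauss_signM ?gauss_signM ?gauss_sign_sqr ?mulr1 ?coprimeMr ?coY // coprime_sym.
have r1 := gauss_reciprocity odd_p oddX1 co.
have r2 := gauss_reciprocity oddX1 (isT : odd 3) (_ : coprime X1 3).
rewrite coprime_sym in r2; move/(_ co3'): r2; rewrite (_ : X1./2 * 3./2 = X1./2)%N ?muln1 // => r2.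
have s2 := gauss_sign_sqr X1 3; rewrite e in r1.
transitivity (gs p X1 * gs X1 3 * (gs X1 3 * gs 3 X1) * gs 3 X1); last first.
  by rewrite r1 r2 exprD.
transitivity (gs p X1 * (gs X1 3 * gs X1 3) * (gs 3 X1 * gs 3 X1)); last by ring.
by rewrite s2 gauss_sign_sqr !mulr1.
Qed.

Let formE : 3 * Y%:R ^+ 2 = - X%:R ^+ 2 :> 'F_p.
Proof.
apply/eqP; rewrite -addr_eq0 addrC -!natrX -natrM -natrD -pE.
by rewrite pchar_Fp_0.
Qed.

(** Raising 3 Y^2 = -X^2 to the power (p - 1) / 4 turns the powers of X and Y into quadratic
    symbols, which reciprocity evaluates. *)
Lemma norm_form_1mod12 k : p = (12 * k).+1 ->
  3 ^+ (3 * k) = ((-1) ^+ X./2 * gs 3 X)%:~R :> 'F_p.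
Proof.
move=> pk; have [X0 Y0] := XY0.
have p2 : p./2 = (6 * k)%N by lia.
have [s [Y1 [YE oddY1]]] := odd_part Y0.
have [oddX s0] : odd X /\ (0 < s)%N.
  have parity : odd X (+) odd Y.
    by move: odd_p; rewrite pE oddD oddM !oddX.
  have [x xE] : exists x, X = (2 * x + odd X)%N by exists X./2; lia.
  have [y yE] : exists y, Y = (2 * y + odd Y)%N by exists Y./2; lia.
  case: s YE => [|s] YE.
    have oddY : odd Y by rewrite YE mul1n.
    have evX : odd X = false by move: parity; rewrite oddY; case: (odd X).
    by move: pE; rewrite pk xE yE oddY evX; nia.
  have evY : odd Y = false by rewrite YE expnS -mulnA oddM.
  by split=> //; move: parity; rewrite evY addbF.
have co2 : coprime p 2 by apply: co_p; lia.
have gsY : gs p Y = (-1) ^+ k.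
  have dY1 : (Y1 %| Y)%N by rewrite YE dvdn_mull.
  have co1 : coprime p Y1 by apply: co_dvd dY1 _; lia.
  rewrite YE gauss_signM ?coprimeXr // gauss_signX // (gs_Ypart oddY1 dY1) p2.
  have -> : gs p 2 = (-1) ^+ k.
    rewrite (_ : p = ((6 * k).*2).+1)%N ?gauss_sign2; last by lia.
    by rewrite -signr_odd -[in RHS]signr_odd; congr (_ ^+ _); lia.
  rewrite (_ : 6 * k * Y1./2 = 2 * (3 * k * Y1./2))%N; last by lia.
  rewrite [(-1) ^+ (2 * _)]exprM sqrrN !expr1n mulr1 -exprM.
  (* Either s = 1, or 4 divides Y and then k is even; in both cases k s and k have the same
     parity. *)
  case: s s0 YE => [|[|s]] // _ YE; first by rewrite muln1.
  have evk : odd k = false.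
    have [x xE] : exists x, X = (2 * x).+1 by exists X./2; lia.
    have Y4 : Y = (4 * (2 ^ s * Y1))%N by rewrite YE !expnS; lia.
    have e : (3 * k = x * x.+1 + 12 * (2 ^ s * Y1 * (2 ^ s * Y1)))%N.
      by move: pE; rewrite -!mulnn pk xE Y4; lia.
    move/(congr1 odd): e; rewrite oddD 3!oddM /= andbN.
    by case: (odd k).
  by rewrite -[LHS]signr_odd -[RHS]signr_odd oddM evk.
have gsX : gs p X = (-1) ^+ X./2 * gs 3 X.
  rewrite gs_Xpart // p2 exprD (_ : 6 * k * X./2 = 2 * (3 * k * X./2))%N; last by lia.
  by rewrite exprM sqrrN !expr1n mul1r.
have euler Z : (0 < Z < p)%N -> Z%:R ^+ (2 * (3 * k)) = (gs p Z)%:~R :> 'F_p.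
  by move=> bd; rewrite gauss_euler ?co_p // p2 mulnA.
have := congr1 (fun z => z ^+ (3 * k)) formE.
rewrite exprMn [(- X%:R ^+ 2) ^+ _]exprNn -!exprM !euler ?X0 ?Y0 //.
rewrite gsY -gsX rmorphXn rmorphN1 => e.
have s1 : (-1) ^+ (3 * k) = (-1) ^+ k :> 'F_p.
  by rewrite -signr_odd oddM /= signr_odd.
apply: (mulIf (_ : (-1) ^+ k != 0 :> 'F_p)); first by rewrite signr_eq0.
by rewrite e s1 mulrC.
Qed.

(** Now (p - 1) / 2 = 2 (3k + 1) + 1 is odd, so 3 Y^2 = -X^2 is raised to the power 3k + 1 and
    multiplied by XY before symbols appear; this leaves the ratio Y / X. *)
Lemma norm_form_7mod12 k : p = (12 * k + 7)%N ->
  3 ^+ (3 * k + 1) * X%:R = ((-1) ^+ Y./2 * gs 3 X)%:~R * Y%:R :> 'F_p.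
Proof.
move=> pk; have [X0 Y0] := XY0.
have p2 : p./2 = (6 * k + 3)%N by lia.
have [s [X1 [XE oddX1]]] := odd_part X0.
have [oddY s0] : odd Y /\ (0 < s)%N.
  have parity : odd X (+) odd Y.
    by move: odd_p; rewrite pE oddD oddM !oddX.
  have [x xE] : exists x, X = (2 * x + odd X)%N by exists X./2; lia.
  have [y yE] : exists y, Y = (2 * y + odd Y)%N by exists Y./2; lia.
  case: s XE => [|s] XE.
    have oddX : odd X by rewrite XE mul1n.
    have evY : odd Y = false by move: parity; rewrite oddX; case: (odd Y).
    by move: pE; rewrite pk xE yE oddX evY; nia.
  have evX : odd X = false by rewrite XE expnS -mulnA oddM.
  by split=> //; move: parity; rewrite evX.
have co2 : coprime p 2 by apply: co_p; lia.
have gsX : gs p X = (-1) ^+ k.+1 * gs 3 X.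
  have dX1 : (X1 %| X)%N by rewrite XE dvdn_mull.
  have co1 : coprime p X1 by apply: co_dvd dX1 _; lia.
  rewrite XE gauss_signM ?coprimeXr // gauss_signX // (gs_Xpart oddX1 dX1) p2.
  have -> : gs p 2 = (-1) ^+ k.
    rewrite (_ : p = ((6 * k + 3).*2).+1)%N ?gauss_sign2; last by lia.
    by rewrite -signr_odd -[in RHS]signr_odd; congr (_ ^+ _); lia.
  rewrite gauss_signM ?coprimeXr //; last by apply: coprime_dvdr dX1 co3.
  rewrite gauss_signX // -[3%N]/((1.*2).+1) gauss_sign2 -[(1.*2).+1]/3%N.
  rewrite (_ : (6 * k + 3) * X1./2 + X1./2 = 2 * ((3 * k + 2) * X1./2))%N; last by lia.
  rewrite [(-1) ^+ (2 * _)]exprM sqrrN !expr1n mul1r mulrA; congr (_ * _).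
  rewrite expr1 -exprM -exprD.
  (* The sign of 2 modulo 3 is -1, which settles s = 1; for s >= 2 the number 4 divides X and k is
     odd. *)
  case: s s0 XE => [|[|s]] // _ XE.
    by rewrite muln1 addn1 !exprS mulN1r mulN1r opprK.
  suff odk : odd k.
    by rewrite -[LHS]signr_odd -[RHS]signr_odd oddD oddM odk /= odk.
  have [y yE] : exists y, Y = (2 * y).+1 by exists Y./2; lia.
  have X4 : X = (4 * (2 ^ s * X1))%N by rewrite XE !expnS; lia.
  have e : ((3 * k).+1 = 4 * (2 ^ s * X1 * (2 ^ s * X1)) + 3 * (y * y.+1))%N.
    by move: pE; rewrite -!mulnn pk yE X4; lia.
  move/(congr1 odd): e; rewrite oddD /= !oddM /= andbN.
  by case: (odd k).
have gsY : gs p Y = (-1) ^+ Y./2.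
  rewrite gs_Ypart // p2 -signr_odd -[in RHS]signr_odd; congr (_ ^+ _).
  by rewrite oddM oddD oddM.
have euler Z : (0 < Z < p)%N -> Z%:R ^+ (2 * (3 * k + 1)).+1 = (gs p Z)%:~R :> 'F_p.
  by move=> bd; rewrite gauss_euler ?co_p // p2; congr (_ ^+ _); lia.
have := congr1 (fun z => z ^+ (3 * k + 1) * (X%:R * Y%:R)) formE.
rewrite exprMn [(- X%:R ^+ 2) ^+ _]exprNn -!exprM => e0.
have : 3 ^+ (3 * k + 1) * X%:R * (gs p Y)%:~R
    = (-1) ^+ (3 * k + 1) * (gs p X)%:~R * Y%:R :> 'F_p.
  rewrite -!euler ?X0 ?Y0 // !exprS; move: e0.
  set A := Y%:R ^+ _; set B := X%:R ^+ _ => e0.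
  transitivity (3 ^+ (3 * k + 1) * A * (X%:R * Y%:R)); first by ring.
  by rewrite e0; ring.
rewrite gsY gsX => e.
have s1 : (-1) ^+ (3 * k + 1) = (-1) ^+ k.+1 :> 'F_p.
  by rewrite addn1 -signr_odd -[in RHS]signr_odd /= oddM.
have ss : ((-1) ^+ Y./2)%:~R * ((-1) ^+ Y./2)%:~R = 1 :> 'F_p.
  by rewrite -rmorphM -expr2 sqrr_sign.
have kk : ((-1) ^+ k.+1)%:~R * ((-1) ^+ k.+1) = 1 :> 'F_p.
  by rewrite rmorphXn rmorphN1 -expr2 sqrr_sign.
transitivity ((3 ^+ (3 * k + 1) * X%:R * ((-1) ^+ Y./2)%:~R) * ((-1) ^+ Y./2)%:~R : 'F_p).
  by rewrite -mulrA ss mulr1.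
rewrite e s1 !rmorphM /=.
transitivity ((((-1) ^+ k.+1)%:~R * (-1) ^+ k.+1) * ((gs 3 X)%:~R * ((-1) ^+ Y./2)%:~R * Y%:R) : 'F_p).
  by ring.
by rewrite kk; ring.
Qed.

End NormForm.

(** * Reduction of rational numbers modulo the square of p *)

Section Reduction.
Variables (p : nat) (p_pr : prime p).
Local Notation R := 'Z_(p ^ 2).
Local Notation P := (p%:R : R).

(* [reduces x z]: the p-integral rational x has residue z modulo p^2. *)
Definition reduces (x : rat) (z : R) : Prop :=
  exists (a : int) (b : nat), [/\ coprime p b, x = a%:~R / b%:R & z = a%:~R / b%:R].

Let natq_neq0 b : coprime p b -> b%:R != 0 :> rat.
Proof.
move=> co; rewrite pnatr_eq0; apply: contraTneq co => ->.
by rewrite /coprime gcdn0 gtn_eqF ?prime_gt1.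
Qed.

(** This carries identities from Q to Z/p^2: a rational computed in two ways has two residues, which
    must agree. *)
Lemma reduces_fun x z w : reduces x z -> reduces x w -> z = w.
Proof.
move=> [a [b [co -> ->]]] [a' [b' [co' e ->]]].
have e' : a * b'%:Z = a' * b%:Z.
  apply: (@intr_inj rat); rewrite !rmorphM /= -[(b%:Z)%:~R]/(b%:R) -[(b'%:Z)%:~R]/(b'%:R).
  have n0 := natq_neq0 co; have n0' := natq_neq0 co'.
  by rewrite -[a%:~R](divfK n0) e; field.
have u : (b%:R : R) \is a GRing.unit by rewrite unitR.
have u' : (b'%:R : R) \is a GRing.unit by rewrite unitR.
apply: (mulIr u); rewrite divrK //; apply: (mulIr u').
rewrite mulrAC divrK // -[b'%:R]/((b'%:Z)%:~R) -[b%:R]/((b%:Z)%:~R) -!rmorphM.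
by rewrite e'.
Qed.

Lemma reduces_int a : reduces a%:~R a%:~R.
Proof. by exists a, 1%N; rewrite coprimen1 !divr1. Qed.

Lemma reduces_nat k : reduces k%:R k%:R.
Proof. exact: (reduces_int k%:Z). Qed.

Lemma reducesN x z : reduces x z -> reduces (- x) (- z).
Proof. by move=> [a [b [co -> ->]]]; exists (- a), b; split; rewrite ?rmorphN ?mulNr. Qed.

Lemma reducesM x y z w : reduces x z -> reduces y w -> reduces (x * y) (z * w).
Proof.
move=> [a [b [co -> ->]]] [a' [b' [co' -> ->]]].
exists (a * a'), (b * b')%N; rewrite coprimeMr co co' !natrM !rmorphM /=.
have n0 := natq_neq0 co; have n0' := natq_neq0 co'; split=> //; first by field; rewrite ?n0 ?n0'.
have u : (b%:R : R) \is a GRing.unit by rewrite unitR.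
have u' : (b'%:R : R) \is a GRing.unit by rewrite unitR.
by rewrite invrM //; ring.
Qed.

Lemma reducesD x y z w : reduces x z -> reduces y w -> reduces (x + y) (z + w).
Proof.
move=> [a [b [co -> ->]]] [a' [b' [co' -> ->]]].
exists (a * b'%:Z + a' * b%:Z), (b * b')%N; rewrite coprimeMr co co' !natrM !rmorphD !rmorphM /=.
rewrite -![(_%:Z)%:~R]/(_%:R).
have n0 := natq_neq0 co; have n0' := natq_neq0 co'; split=> //; first by field; rewrite n0 n0'.
have u : (b%:R : R) \is a GRing.unit by rewrite unitR.
have u' : (b'%:R : R) \is a GRing.unit by rewrite unitR.
apply: (mulIr u); apply: (mulIr u'); rewrite -[RHS]mulrA divrK ?unitrM ?u //.
set B : R := b%:R in u *; set B' : R := b'%:R in u' *.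
transitivity (a%:~R * (B^-1 * B) * B' + a'%:~R * (B'^-1 * B') * B); first by ring.
by rewrite !mulVr ?mulr1.
Qed.

Lemma reducesB x y z w : reduces x z -> reduces y w -> reduces (x - y) (z - w).
Proof. by move=> h /reducesN; apply: reducesD. Qed.

Lemma reducesX x z k : reduces x z -> reduces (x ^+ k) (z ^+ k).
Proof.
move=> h; elim: k => [|k IH]; first exact: (reduces_nat 1).
by rewrite !exprS; apply: reducesM.
Qed.

Lemma reducesV x z : reduces x z -> z \is a GRing.unit -> reduces x^-1 z^-1.
Proof.
move=> [a [b [co -> ->]]]; have u : (b%:R : R) \is a GRing.unit by rewrite unitR.
have uV : (b%:R : R)^-1 \is a GRing.unit by rewrite unitrV.
rewrite unitrMl // => ua.
have aE : a%:~R = (-1) ^+ (a < 0)%R * `|a|%N%:R :> R.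
  by rewrite {1}[a]intEsign rmorphM rmorph_sign.
have co_a : coprime p `|a|.
  by move: ua; rewrite aE unitrMr ?unitrX ?unitrN1 // unitR.
exists ((-1) ^+ (a < 0)%R * b%:Z), `|a|%N; split=> //.
- have n0 := natq_neq0 co; have n1 := natq_neq0 co_a.
  rewrite invfM invrK {1}[a]intEsign !rmorphM !rmorph_sign /= -[(b%:Z)%:~R]/(b%:R) mulrC.
  by rewrite invfM invr_sign; ring.
rewrite rmorphM rmorph_sign /= -[(b%:Z)%:~R]/(b%:R) invrM // invrK aE.
rewrite invrM ?unitrX ?unitrN1 // ?invr_sign; last by rewrite unitR.
by ring.
Qed.

Lemma reduces_div x y z w : reduces x z -> reduces y w -> w \is a GRing.unit ->
  reduces (x / y) (z / w).
Proof. by move=> h h' u; apply: reducesM h (reducesV h' u). Qed.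

Lemma reduces_sum (I : Type) (r : seq I) (Q : pred I) (f : I -> rat) (g : I -> R) :
  (forall i, Q i -> reduces (f i) (g i)) ->
  reduces (\sum_(i <- r | Q i) f i) (\sum_(i <- r | Q i) g i).
Proof.
move=> h; apply: (big_ind2 reduces) => //; first exact: (reduces_nat 0).
by move=> *; apply: reducesD.
Qed.

Lemma reduces_prod (I : Type) (r : seq I) (Q : pred I) (f : I -> rat) (g : I -> R) :
  (forall i, Q i -> reduces (f i) (g i)) ->
  reduces (\prod_(i <- r | Q i) f i) (\prod_(i <- r | Q i) g i).
Proof.
move=> h; apply: (big_ind2 reduces) => //; first exact: (reduces_nat 1).
by move=> *; apply: reducesM.
Qed.

Lemma intR_eq0_dvd (a : int) : (a%:~R : R) = 0 -> exists c, a = (p ^ 2)%:Z * c.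
Proof.
move=> a0; have : (`|a|%N%:R : R) == 0.
  by apply/eqP; move: a0; case: a => k //= /eqP; rewrite oppr_eq0 => /eqP.
rewrite natR_eq0 // => /dvdnP[q e]; exists ((-1) ^+ (a < 0)%R * q%:Z).
by rewrite {1}[a]intEsign e PoszM; ring.
Qed.

Lemma reduces_congr x y z : reduces x z -> reduces y z -> rat_congr_mod_p2 p x y.
Proof.
move=> h h'; have := reducesB h h'; rewrite subrr => -[a [b [co e z0]]].
have u : (b%:R : R) \is a GRing.unit by rewrite unitR.
have a0 : (a%:~R : R) = 0 by rewrite -[LHS](divrK u) -z0 mul0r.
have [c aE] := intR_eq0_dvd a0; exists (c%:~R / b%:R); last first.
  by rewrite e aE rmorphM /= -[((p ^ 2)%:Z)%:~R]/((p ^ 2)%:R) natrX mulrA.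
rewrite /Zloc coprime_sym; apply: (coprime_dvdr _ co).
have n0 := natq_neq0 co; set r := _ / _.
(* b need not be the denominator in lowest terms, but [denq r] divides it by Gauss's lemma. *)
have e1 : numq r * b%:Z = c * denq r.
  apply: (@intr_inj rat); rewrite !rmorphM /= numqE /r -[(b%:Z)%:~R]/(b%:R).
  by field.
have : (denq r %| numq r * b%:Z)%Z by rewrite e1 dvdz_mull.
by rewrite Gauss_dvdzr ?dvdzE // coprimezE coprime_sym coprime_num_den.
Qed.

End Reduction.

Lemma five_neq0 (F : realFieldType) (n i : nat) : 5 / 4 + n%:R / 2 + i%:R != 0 :> F.
Proof. by have := ler0n F n; have := ler0n F i; lra. Qed.

(** * The binomial sums modulo p^2 and Ramanujan's relation *)

Section Congruences.
Variables (p m : nat) (p_pr : prime p) (pE : p = (6 * m).+1) (m0 : (0 < m)%N).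
Local Notation R := 'Z_(p ^ 2).
Local Notation P := (p%:R : R).
Local Notation reduces := (@reduces p).
Local Notation n := (3 * m)%N.

Let PP : P * P = 0. Proof. exact: PP0. Qed.
Let usmall i : (0 < i <= 6 * m)%N -> (i%:R : R) \is a GRing.unit.
Proof. exact: unit_small. Qed.
Let u4 : (4 : R) \is a GRing.unit. Proof. by apply: (@usmall 4); lia. Qed.
Let u16 : (16 : R) \is a GRing.unit.
Proof. by rewrite -[16]/((4 * 4)%:R) natrM unitrM u4. Qed.
Let ufact k : (k <= 6 * m)%N -> (k`!%:R : R) \is a GRing.unit.
Proof. exact: unit_fact_small. Qed.

Let nP : (n%:R : R) *+ 2 = P - 1.
Proof. by rewrite -mulrnA (_ : n * 2 = 6 * m)%N ?pE -?natr1 ?addrK //; lia. Qed.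

(** Both sides obey one recurrence because 4n(n + 1) = (2n + 1)^2 - 1 = p^2 - 1, so the error is
    quadratic in p. *)
Lemma legendre_coef_central k : (k <= n)%N ->
  16 ^+ k * legendre_coef R n k = 'C(2 * k, k)%:R ^+ 2.
Proof.
elim: k => [|k IH] le_k.
  by rewrite /legendre_coef muln0 !bin0 !expr0 expr1n !mulr1.
have u : (k.+1%:R : R) ^+ 2 \is a GRing.unit by rewrite unitrX // usmall //; lia.
apply: (mulrI u); rewrite -exprMn [16 ^+ k.+1]exprS.
rewrite mul_central_bin exprMn -IH ?(ltnW le_k) //.
transitivity (16 * 16 ^+ k * (k.+1%:R ^+ 2 * legendre_coef R n k.+1)); first by ring.
rewrite legendre_coefS.
have e : 4 * (n%:R * (n%:R + 1)) = - 1 :> R.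
  transitivity (n%:R *+ 2 * (n%:R *+ 2 + 2) : R); first by ring.
  rewrite nP; transitivity (P * P - 1); first by ring.
  by rewrite PP sub0r.
transitivity (16 ^+ k * legendre_coef R n k * (16 * k%:R * (k%:R + 1) - 4 * (4 * (n%:R * (n%:R + 1))))).
  by ring.
by rewrite e; ring.
Qed.

Lemma reduces_legendre_coef k : reduces (legendre_coef rat n k) (legendre_coef R n k).
Proof.
apply: reducesM => //; last exact: reduces_nat.
by apply: reducesX => //; apply: reducesN => //; apply: (reduces_nat _ 1).
Qed.

Lemma central_bin_dvd k : (n < k < p)%N -> (p %| 'C(2 * k, k))%N.
Proof.
move=> bd; have : (p %| (2 * k)`!)%N by apply: dvdn_fact; lia.
rewrite -(@bin_fact (2 * k) k); last by lia.
rewrite (_ : 2 * k - k = k)%N; last by lia.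
have ndv : (p %| k`!)%N = false.
  have := ufact (_ : k <= 6 * m)%N; rewrite unitR // prime_coprime // => h.
  by apply/negbTE/h; lia.
by rewrite !Euclid_dvdM // ndv !orbF.
Qed.

(** Terms with n < k < p vanish since p divides the binomial, which is squared. The weight [a] is
    arbitrary so as to serve u_k and v_k, with or without a factor k or k - 1. *)
Lemma central_sum_reduces (a : nat -> int) : exists2 z,
    reduces (\sum_(0 <= k < p) 'C(2 * k, k)%:R ^+ 2 * ((a k)%:~R / 64 ^+ k)) z
  & reduces (\sum_(k < n.+1) legendre_coef rat n k * ((a k)%:~R / 4 ^+ k)) z.
Proof.
have r4 k : reduces ((a k)%:~R / 4 ^+ k) ((a k)%:~R / 4 ^+ k).
  apply: reduces_div; rewrite ?unitrX //; first exact: reduces_int.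
  by apply: reducesX => //; apply: (reduces_nat _ 4).
exists (\sum_(k < n.+1) legendre_coef R n k * ((a k)%:~R / 4 ^+ k)); last first.
  apply: reduces_sum => // k _; apply: reducesM => //; first exact: reduces_legendre_coef.
rewrite (big_cat_nat (n := n.+1)) //=; last by lia.
rewrite -[X in reduces _ X]addr0; apply: reducesD => //.
  rewrite big_mkord; apply: reduces_sum => // k _.
  have -> : legendre_coef R n k * ((a k)%:~R / 4 ^+ k)
      = 'C(2 * k, k)%:R ^+ 2 * ((a k)%:~R / 64 ^+ k).
    have u64 : (64 ^+ k : R) \is a GRing.unit.
      by rewrite unitrX // -[64]/((4 * 16)%:R) natrM unitrM u4.
    have u4k : (4 ^+ k : R) \is a GRing.unit by rewrite unitrX.
    rewrite -legendre_coef_central; last by rewrite -ltnS.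
    apply: (mulIr u64); apply: (mulIr u4k).
    have e64 : 64 ^+ k = 16 ^+ k * 4 ^+ k :> R by rewrite -exprMn; congr (_ ^+ _); ring.
    transitivity (legendre_coef R n k * (a k)%:~R * ((4 ^+ k)^-1 * 4 ^+ k) * 64 ^+ k).
      by ring.
    rewrite mulVr // mulr1 e64.
    transitivity (16 ^+ k * legendre_coef R n k * (a k)%:~R
      * ((64 ^+ k)^-1 * 64 ^+ k) * 4 ^+ k); last by rewrite e64; ring.
    by rewrite mulVr // mulr1; ring.
  apply: reducesM => //; first by apply: reducesX => //; apply: reduces_nat.
  apply: reduces_div => //; first exact: reduces_int.
    by apply: reducesX => //; apply: (reduces_nat _ 64).
  by rewrite unitrX // -[64]/((4 * 16)%:R) natrM unitrM u4.
have <- : \sum_(n.+1 <= k < p) (0 : R) = 0 by apply: big1.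
rewrite !big_nat; apply: reduces_sum => // k bd.
have /dvdnP[q e] : (p %| 'C(2 * k, k))%N by apply: central_bin_dvd; lia.
have -> : 0 = (q%:R * P) ^+ 2 * ((a k)%:~R / 64 ^+ k) :> R.
  by rewrite exprMn [P ^+ 2]expr2 PP mulr0 mul0r.
apply: reducesM => //; first by rewrite e natrM; apply: reducesX => //; apply: reducesM => //; apply: reduces_nat.
apply: reduces_div => //; first exact: reduces_int.
  by apply: reducesX => //; apply: (reduces_nat _ 64).
by rewrite unitrX // -[64]/((4 * 16)%:R) natrM unitrM u4.
Qed.

(* The denominators are k!^2 times a product of factors 1 - (p / 4 i)^2. *)
Lemma rterm_clausen k :
  rterm rat n k * \prod_(i < k) ((1 + i%:R) ^+ 2 - (p%:R / 4) ^+ 2)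
  = (6 * k%:R + 1) * (clausen_coef rat n k / 16 ^+ k) * k`!%:R ^+ 2 :> rat.
Proof.
have f0 : k`!%:R != 0 :> rat by rewrite pnatr_eq0 -lt0n fact_gt0.
have half : poch (1 / 2) k = 'C(2 * k, k)%:R * k`!%:R / 4 ^+ k :> rat.
  elim: k {f0} => [|k IH]; first by rewrite poch0 muln0 bin0 fact0 expr0; field.
  rewrite pochS IH factS natrM mulrA [_ * k.+1%:R]mulrC mul_central_bin exprS; field.
  by rewrite expf_neq0.
have denom : poch (3 / 4 - n%:R / 2) k * poch (5 / 4 + n%:R / 2) k
    = \prod_(i < k) ((1 + i%:R) ^+ 2 - (p%:R / 4) ^+ 2) :> rat.
  rewrite /poch -big_split /=; apply: eq_bigr => i _.
  by rewrite pE -natr1 !natrM; field.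
have rise : poch (n%:R + 1) k = 'C(n + k, k)%:R * k`!%:R :> rat.
  rewrite -natrM bin_ffact; elim: k {f0 half denom} => [|k IH]; first by rewrite poch0 ffactn0.
  by rewrite pochS IH addnS ffactSS (natrM _ (n + k).+1) -[(n + k).+1%:R]natr1 natrD; ring.
have d0 : poch (3 / 4 - n%:R / 2) k * poch (5 / 4 + n%:R / 2) k != 0 :> rat.
  by apply: mulf_neq0; apply: poch_neq0 => i _; [exact: four_neq0 | exact: five_neq0].
rewrite -denom /rterm /clausen_coef /legendre_coef half rise -bin_ffact !(natrM _ 'C(n, k)).
have e16 : 16 ^+ k = 4 ^+ k * 4 ^+ k :> rat by rewrite -exprMn; congr (_ ^+ _).
have e4 : (- (1 / 4)) ^+ k = (-1) ^+ k / 4 ^+ k :> rat.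
  by rewrite -[- (1 / 4)]mulN1r exprMn mul1r exprVn.
have p4 : 4 ^+ k != 0 :> rat by rewrite expf_neq0.
rewrite e16 e4; move: d0; rewrite mulf_eq0 negb_or.
move: (poch (3 / 4 - _) k) (poch (5 / 4 + _) k) => A B /andP[d1 d2].
by field; do ?[apply/andP; split].
Qed.

Lemma reduces_clausen_coef k :
  reduces (clausen_coef rat n k / 16 ^+ k) (clausen_coef R n k / 16 ^+ k).
Proof.
apply: reduces_div; rewrite ?unitrX //.
  by apply: reducesM => //; [exact: reduces_legendre_coef | exact: reduces_nat].
by apply: reducesX => //; apply: (reduces_nat _ 16).
Qed.

(** Modulo p^2 the product in [rterm_clausen] is k!^2, so [rterm] becomes 6k + 1 times a Clausen
    term and [rsum_eval] relates the two sums. *)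
Lemma ramanujan_sum : exists h kap : R,
  [/\ reduces (clsum rat n) h, reduces (kclsum rat n) kap & h + 6 * kap = (-1) ^+ n * P].
Proof.
exists (\sum_(k < n.+1) clausen_coef R n k / 16 ^+ k),
  (\sum_(k < n.+1) k%:R * (clausen_coef R n k / 16 ^+ k)).
have r1 : reduces (clsum rat n) (\sum_(k < n.+1) clausen_coef R n k / 16 ^+ k).
  by apply: reduces_sum => // k _; apply: reduces_clausen_coef.
have r2 : reduces (kclsum rat n) (\sum_(k < n.+1) k%:R * (clausen_coef R n k / 16 ^+ k)).
  apply: reduces_sum => // k _; rewrite -mulrA; apply: reducesM => //.
    exact: reduces_nat.
  exact: reduces_clausen_coef.
split=> //.
have r3 : reduces (\sum_(k < n.+1) rterm rat n k)
    (\sum_(k < n.+1) (6 * k%:R + 1) * (clausen_coef R n k / 16 ^+ k)).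
  apply: reduces_sum => // k _.
  have lt_k := ltn_ord k.
  pose D : rat := \prod_(i < k) ((1 + i%:R) ^+ 2 - (p%:R / 4) ^+ 2).
  have rD : reduces D (k`!%:R ^+ 2).
    have -> : k`!%:R ^+ 2 = \prod_(i < k) ((1 + i%:R) ^+ 2 - (P / 4) ^+ 2) :> R.
      elim: (k : nat) => [|j IH]; first by rewrite big_ord0 fact0 expr1n.
      rewrite big_ord_recr /= -IH factS natrM exprMn -natr1.
      have -> : (P / 4) ^+ 2 = 0 by rewrite expr_div_n expr2 PP mul0r.
      by ring.
    apply: reduces_prod => // i _; apply: reducesB => //; apply: reducesX => //.
      by apply: reducesD => //; [exact: (reduces_nat _ 1) | exact: reduces_nat].
    by apply: reduces_div => //; [exact: reduces_nat | exact: (reduces_nat _ 4)].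
  have uf : (k`!%:R : R) ^+ 2 \is a GRing.unit by rewrite unitrX // ufact //; lia.
  have D0 : D != 0.
    apply/eqP => D0; move: rD; rewrite D0 => rD.
    have := reduces_fun p_pr rD (reduces_nat _ 0) => e; move: uf; rewrite e unitr0.
    by [].
  have -> : rterm rat n k = (6 * k%:R + 1) * (clausen_coef rat n k / 16 ^+ k) * k`!%:R ^+ 2 / D.
    by rewrite -rterm_clausen mulfK.
  rewrite -[X in reduces _ X](mulrK uf); apply: reduces_div => //.
  apply: reducesM => //; last by apply: reducesX => //; apply: reduces_nat.
  apply: reducesM => //; last exact: reduces_clausen_coef.
  apply: reducesD => //; last exact: (reduces_nat _ 1).
  by apply: reducesM => //; [exact: (reduces_nat _ 6) | exact: reduces_nat].
have -> : \sum_(k < n.+1) clausen_coef R n k / 16 ^+ k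
    + 6 * \sum_(k < n.+1) k%:R * (clausen_coef R n k / 16 ^+ k)
    = \sum_(k < n.+1) (6 * k%:R + 1) * (clausen_coef R n k / 16 ^+ k).
  by rewrite mulr_sumr -big_split /=; apply: eq_bigr => k _; ring.
apply: (reduces_fun p_pr r3); rewrite rsum_eval.
have -> : 2 * n%:R + 1 = p%:R :> rat by rewrite pE -natr1 !natrM; ring.
apply: reducesM => //; last exact: reduces_nat.
by apply: reducesX => //; apply: reducesN => //; apply: (reduces_nat _ 1).
Qed.

End Congruences.

(** * The quartic relation between the hypergeometric sum and the Jacobi sum *)

Section ArithmeticProducts.
Variables (F : realFieldType) (p m : nat) (pE : p = (6 * m).+1).

(** Each factor differs from d (l + 1) by p, so modulo p^2 only a factorial and a harmonic number
    remain. *)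
Definition apprd (d : int) (k : nat) : F := \prod_(l < k) (p%:R + d%:~R * l.+1%:R).

Let pF : p%:R = 6 * m%:R + 1 :> F.
Proof. by rewrite pE -natr1 natrM. Qed.

Let natr_rev N (l : 'I_N) : (N - l.+1)%:R = N%:R - l%:R - 1 :> F.
Proof. by rewrite natrB // -[l.+1%:R]natr1; ring. Qed.

Lemma apprd_m3 : apprd (-3) (2 * m) = \prod_(i < 2 * m) (3 * i%:R + 1).
Proof.
rewrite /apprd [RHS](reindex_inj rev_ord_inj) /=; apply: eq_bigr => l _.
by rewrite natr_rev pF (natrM _ 2) -[l.+1%:R]natr1; ring.
Qed.

Lemma apprd_m3_half : apprd (-3) m = \prod_(i < m) (3 * (m%:R + i%:R) + 1).
Proof.
rewrite /apprd [RHS](reindex_inj rev_ord_inj) /=; apply: eq_bigr => l _.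
by rewrite natr_rev pF -[l.+1%:R]natr1; ring.
Qed.

Lemma apprd_m6 : apprd (-6) m = \prod_(i < m) (6 * i%:R + 1).
Proof.
rewrite /apprd [RHS](reindex_inj rev_ord_inj) /=; apply: eq_bigr => l _.
by rewrite natr_rev pF -[l.+1%:R]natr1; ring.
Qed.

Lemma apprd_m2 : apprd (-2) (3 * m) = apprd (-2) (2 * m) * \prod_(i < m) (2 * i%:R + 1).
Proof.
rewrite /apprd (_ : 3 * m = 2 * m + m)%N; last by lia.
rewrite big_split_ord /=; congr (_ * _).
rewrite [RHS](reindex_inj rev_ord_inj) /=; apply: eq_bigr => l _.
by rewrite natr_rev pF -[(2 * m + l).+1%:R]natr1 natrD (natrM _ 2); ring.
Qed.

Lemma double_fact k : (2 * k)`!%:R = 2 ^+ k * k`!%:R * \prod_(i < k) (2 * i%:R + 1) :> F.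
Proof.
elim: k => [|k IH]; first by rewrite muln0 big_ord0 expr0 !mulr1.
rewrite (_ : 2 * k.+1 = (2 * k).+2)%N; last by lia.
rewrite !factS !(natrM _ (2 * k).+2) !(natrM _ (2 * k).+1) IH big_ord_recr /= exprS.
by rewrite -[(2 * k).+2%:R]natr1 -[(2 * k).+1%:R]natr1 (natrM _ k.+1) -[k.+1%:R]natr1 (natrM _ 2); ring.
Qed.

(** A duplication formula; modulo p^2 it relates m!, (2m)! and (3m)!. *)
Lemma fact_apprd : (2 * m)`!%:R * apprd (-2) (2 * m) = 2 ^+ m * m`!%:R * apprd (-2) (3 * m).
Proof. by rewrite double_fact apprd_m2; ring. Qed.

Lemma odd_prod N : 2 ^+ N * \prod_(i < N) (2 * i%:R + 3)
  = (2 * N).+1%:R * \prod_(l < N) (2 * N%:R - l%:R) :> F.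
Proof.
have f0 : N`!%:R != 0 :> F by rewrite pnatr_eq0 -lt0n fact_gt0.
have e1 : \prod_(i < N) (2 * i%:R + 3) = \prod_(i < N) (2 * i%:R + 1) * (2 * N).+1%:R :> F.
  elim: N {f0} => [|N IH]; first by rewrite !big_ord0 mul1r.
  rewrite !big_ord_recr /= IH (_ : (2 * N.+1).+1 = (2 * N).+3)%N; last by lia.
  by rewrite -[(2 * N).+3%:R]natr1 -[(2 * N).+2%:R]natr1 -[(2 * N).+1%:R]natr1 natrM; ring.
have e2 M k : (M ^_ k)%:R = \prod_(l < k) (M%:R - l%:R) :> F.
  elim: k => [|k IH]; first by rewrite big_ord0.
  by rewrite natr_ffactS IH big_ord_recr.
rewrite e1 -(natrM _ 2) -e2; apply: (mulfI f0).
transitivity ((2 * N)`!%:R * (2 * N).+1%:R : F); first by rewrite double_fact; ring.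
rewrite -(@ffact_fact (2 * N) N); last by lia.
by rewrite (_ : 2 * N - N = N)%N ?(natrM _ (_ ^_ _)); [ring | lia].
Qed.

(** Numerator and denominator of the closed form share the factor p: 3i + 4 passes through 6m + 1,
    and the odd numbers 2i + 3 end with it. It is cancelled in the field, before any reduction. *)
Lemma hsum1_apprd : hsum (3 * m) ((3 * m)%:R + 3 / 2 : F) * 3 ^+ (3 * m)
  * apprd (-3) (2 * m) * apprd 3 m = 2 ^+ (3 * m) * apprd (-1) (3 * m).
Proof.
set N := (3 * m)%N.
have p0 : p%:R != 0 :> F by rewrite pnatr_eq0 pE.
have i4 (i : nat) : 3 * i%:R + 4 != 0 :> F by have := ler0n F i; lra.
pose D : F := \prod_(i < N) (3 * i%:R + 4).
have D0 : D != 0 by apply/prodf_neq0 => i _.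
have DE : D = p%:R * (apprd (-3) (2 * m) * apprd 3 m).
  transitivity (\prod_(i < N.+1) (3 * i%:R + 1) : F).
    rewrite big_ord_recl mulr0 add0r mul1r; apply: eq_bigr => i _.
    by rewrite /bump /= ?add1n -[i.+1%:R]natr1; ring.
  rewrite apprd_m3 /N (_ : (3 * m).+1 = 2 * m + m.+1)%N; last by lia.
  rewrite big_split_ord big_ord_recl /= addn0 (natrM _ 2).
  rewrite mulrCA; congr (_ * _); first by rewrite pF; ring.
  congr (_ * _); apply: eq_bigr => i _.
  by rewrite /bump /= ?add1n natrD natrM -[i.+1%:R]natr1 pF; ring.
have hE : hsum N (N%:R + 3 / 2 : F) * (3 ^+ N * D) = 4 ^+ N * \prod_(i < N) (2 * i%:R + 3).
  rewrite hsum1_eval mulrA /D -(card_ord N) -!prodr_const card_ord -!big_split /=.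
  by apply: eq_bigr => i _; have := i4 i; rewrite -!natr1 => h; field; have := ler0n F i; lra.
apply: (mulfI p0); transitivity (hsum N (N%:R + 3 / 2 : F) * (3 ^+ N * D)).
  by rewrite DE; ring.
have e4 : 4 ^+ N = 2 ^+ N * 2 ^+ N :> F by rewrite -exprMn; congr (_ ^+ _); ring.
rewrite hE e4 -mulrA odd_prod mulrCA; congr (_ * (_ * _)).
  by congr (_%:R); rewrite pE /N; lia.
apply: eq_bigr => l _; rewrite pF /N natrM -[l.+1%:R]natr1; ring.
Qed.

(** The closed form needs the factors 3i + 1 with i < m, the lower half of [apprd (-3) (2 * m)]; the
    upper half is [apprd (-3) m]. *)
Lemma hsum2_apprd : hsum (3 * m) (5 / 6 - m%:R : F) * apprd (-6) m * apprd (-3) m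
  = 4 ^+ m * apprd (-3) (2 * m).
Proof.
rewrite hsum2_eval apprd_m6 apprd_m3_half apprd_m3 (_ : 2 * m = m + m)%N; last by lia.
rewrite big_split_ord /= mulrA.
have -> : \prod_(i < m) (3 * (m + i)%:R + 1) = \prod_(i < m) (3 * (m%:R + i%:R) + 1) :> F.
  by apply: eq_bigr => i _; rewrite natrD.
congr (_ * _); rewrite -[in 4 ^+ m](card_ord m) -prodr_const -!big_split /=.
by apply: eq_bigr => i _; field; have := ler0n F i; lra.
Qed.

End ArithmeticProducts.

(* a, b, c stand for m!, (2m)!, (3m)!, v1, v2, v3 for 1 + mp H_m, 1 + mp H_2m, 1 + mp H_3m,
   and E1, E2 for the two sums with closed forms. *)
Lemma quartic_elimination (S : comNzRingType) (a b c E1 E2 J v1 v2 v3 t s T : S) :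
  s * s = 1 -> v1 = v2 * v3 ->
  T * a * b * v2 ^+ 2 * E1 = t ^+ 3 * s * c * v3 ^+ 6 * v1 ^+ 2 ->
  a ^+ 2 * v1 ^+ 3 * E2 = t * b * v2 ^+ 2 ->
  b ^+ 2 * v2 ^+ 3 = s * (t * t) * a * c * v3 ^+ 3 ->
  a * b * J * (v1 * v2 ^+ 2) = - (c * v3 ^+ 3) ->
  T * (E1 * E2 ^+ 3) * (a ^+ 7 * b ^+ 4 * v1 ^+ 9 * v2 ^+ 8)
  = t ^+ 12 * J ^+ 4 * (a ^+ 7 * b ^+ 4 * v1 ^+ 9 * v2 ^+ 8).
Proof.
(* A common cofactor, a unit in the application, replaces division; there t = 2^m, s = (-1)^m and T
   = 3^(6m). *)
move=> ss v123 R1 R2 R3 R4.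
transitivity ((T * a * b * v2 ^+ 2 * E1) * (a ^+ 2 * v1 ^+ 3 * E2) ^+ 3
  * (b ^+ 3 * v2 ^+ 6)); first by ring.
rewrite R1 R2.
transitivity (t ^+ 6 * s * c * v3 ^+ 6 * v1 ^+ 2 * v2 ^+ 3 * (b ^+ 2 * v2 ^+ 3) ^+ 3); first by ring.
rewrite R3.
transitivity (t ^+ 12 * (s * s) * (s * s) * a ^+ 3 * c ^+ 4 * v3 ^+ 12 * v1 ^+ 2 * (v2 * v3) ^+ 3).
  by ring.
rewrite ss -v123.
transitivity (t ^+ 12 * (a * b * J * (v1 * v2 ^+ 2)) ^+ 4 * (a ^+ 3 * v1 ^+ 5)); last by ring.
by rewrite R4; ring.
Qed.

Section Quartic.
Variables (p m : nat) (p_pr : prime p) (pE : p = (6 * m).+1) (m0 : (0 < m)%N).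
Local Notation R := 'Z_(p ^ 2).
Local Notation P := (p%:R : R).
Local Notation reduces := (@reduces p).
Local Notation n := (3 * m)%N.
Local Notation q := (m%:R * p%:R : R).
Local Notation harm := (@harm R).

Let PP : P * P = 0. Proof. exact: PP0. Qed.
Let usmall i : (0 < i <= 6 * m)%N -> (i%:R : R) \is a GRing.unit.
Proof. exact: unit_small. Qed.
Let u2 : (2 : R) \is a GRing.unit. Proof. by apply: (@usmall 2); lia. Qed.
Let u3 : (3 : R) \is a GRing.unit. Proof. by apply: (@usmall 3); lia. Qed.
Let u6 : (6 : R) \is a GRing.unit. Proof. by apply: (@usmall 6); lia. Qed.
Let ufact k : (k <= 6 * m)%N -> (k`!%:R : R) \is a GRing.unit.
Proof. exact: unit_fact_small. Qed.

Let unit1P (w : R) : 1 + P * w \is a GRing.unit.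
Proof.
have e : P * 1 = P * (1 + P * w) by rewrite mulrDr mulrA PP mul0r addr0.
by apply: (unit_P_mul p_pr e); apply: unitr1.
Qed.

(** As 6m = -1 modulo p, first-order terms can be written with q = mp instead of fractions p/d. *)
Let P6 : P = - (6 * q).
Proof.
have e : P * (6 * m%:R) = - P.
  have -> : 6 * m%:R = P - 1 :> R by rewrite -natrM pE -natr1 addrK.
  by rewrite mulrBr PP mulr1 sub0r.
by rewrite -[LHS]opprK -e; ring.
Qed.

Let qq : q * q = 0. Proof. by rewrite mulrACA PP mulr0. Qed.

(* The third parameter c matters only to first order in p, so two closed forms at values of c
   congruent to 1 modulo p determine the sum at c = 1. *)
Lemma hsum_affine : exists F0 K : R, forall (c : rat) (w : R),
  reduces c (1 + P * w) -> reduces (hsum n c) (F0 + P * w * K).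
Proof.
pose dn (w : R) j : R := \prod_(i < j) (1 + P * w + i%:R).
have dnE j : exists h, forall w, dn w j = j`!%:R + P * w * h.
  elim: j => [|j [h IH]]; first by exists 0 => w; rewrite /dn big_ord0 mulr0 addr0.
  exists (h * j.+1%:R + j`!%:R) => w.
  rewrite /dn big_ord_recr /= -/(dn w j) IH factS natrM -[j.+1%:R]natr1.
  transitivity ((j%:R + 1) * j`!%:R + P * w * (h * (j%:R + 1) + j`!%:R)
    + P * P * (w * h * w)); first by ring.
  by rewrite PP mul0r addr0.
pose t w j : R := (n ^_ (2 * j))%:R / (j`!%:R * dn w j) * (- (1 / 12)) ^+ j.
have u12 : (12 : R) \is a GRing.unit.
  by rewrite -[12]/((2 * 6)%:R) natrM unitrM u2.
have udn w j : (j <= n)%N -> dn w j \is a GRing.unit.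
  elim: j => [|j IH] le_j; first by rewrite /dn big_ord0 unitr1.
  rewrite /dn big_ord_recr /= -/(dn w j) unitrM IH ?(ltnW le_j) //=.
  have e : P * (j.+1)%:R = P * (1 + P * w + j%:R).
    by rewrite -[j.+1%:R]natr1 !mulrDr mulrA PP mul0r addr0 mulr1 addrC.
  by apply: (unit_P_mul p_pr e); apply: usmall; lia.
have tE j : (j <= n)%N -> exists k, forall w, t w j = t 0 j + P * w * k.
  move=> le_j; have [h hE] := dnE j.
  have uf : (j`!%:R : R) \is a GRing.unit by apply: ufact; lia.
  have d0 : dn 0 j = j`!%:R by rewrite hE mulr0 mul0r addr0.
  exists (- ((n ^_ (2 * j))%:R * (- (1 / 12)) ^+ j * h / j`!%:R ^+ 3)) => w.
  have e : (dn w j)^-1 = j`!%:R^-1 - P * w * h / j`!%:R ^+ 2.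
    apply: (mulrI (udn w _ le_j)); rewrite divrr ?udn // hE.
    set G : R := j`!%:R in uf *; rewrite expr2 invrM //.
    transitivity (G * G^-1 - P * w * h * (G * G^-1) * G^-1 + P * w * h * G^-1
      - P * P * (w * h * w * h * G^-1 * G^-1)); last by ring.
    by rewrite mulrV // PP; ring.
  by rewrite /t d0 !invrM ?udn ?unitrM ?uf // e expr2 invrM //; ring.
have [K' K'E] : exists K' : R, forall w, \sum_(j < n.+1) t w j
    = \sum_(j < n.+1) t 0 j + P * w * K'.
  have : forall N, (N <= n.+1)%N -> exists K' : R, forall w, \sum_(j < N) t w j
      = \sum_(j < N) t 0 j + P * w * K'.
    elim=> [|N IH] le_N; first by exists 0 => w; rewrite !big_ord0 mulr0 addr0.
    have [k1 e1] := IH (ltnW le_N); have [k2 e2] := tE N le_N.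
    by exists (k1 + k2) => w; rewrite !big_ord_recr /= e1 e2; ring.
  exact.
exists (\sum_(j < n.+1) t 0 j), K' => c w rc; rewrite -K'E /hsum.
apply: reduces_sum => // j _; have le_j : (j <= n)%N by rewrite -ltnS.
apply: reducesM => //; last first.
  apply: reducesX => //; apply: reducesN => //.
  by apply: reduces_div => //; [exact: (reduces_nat _ 1) | exact: (reduces_nat _ 12)].
apply: reduces_div => //; first exact: reduces_nat; last first.
  by rewrite unitrM udn // ufact //; lia.
apply: reducesM => //; first exact: reduces_nat.
apply: reduces_prod => // i _; apply: reducesD => //; exact: reduces_nat.
Qed.

(** The displacements p/2 and -p/6 are in the ratio 3 to -1, so one nilpotent y describes both. *)
Lemma hsums_reduce : exists F0 y : R, [/\ reduces (hsum n 1) F0, P * y = 0, y * y = 0,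
  reduces (hsum n (n%:R + 3 / 2)) (F0 + 3 * y) & reduces (hsum n (5 / 6 - m%:R)) (F0 - y)].
Proof.
have [F0 [K h]] := hsum_affine; exists F0, (P / 6 * K).
split.
- by have := h 1 0; rewrite mulr0 addr0 mul0r addr0; apply; exact: (reduces_nat _ 1).
- by rewrite -!mulrA mulrA PP mul0r.
- by rewrite mulrACA [P / 6 * _]mulrACA PP !mul0r.
- have -> : F0 + 3 * (P / 6 * K) = F0 + P * 2^-1 * K.
    congr (_ + _); have -> : (6 : R)^-1 = 2^-1 * 3^-1.
      by rewrite -[6]/((3 * 2)%:R) natrM invrM.
    transitivity (P * 2^-1 * K * (3 * 3^-1)); first by ring.
    by rewrite mulrV // mulr1.
  apply: h; have -> : n%:R + 3 / 2 = 1 + p%:R / 2 :> rat by rewrite pE -[(6 * m).+1%:R]natr1 !natrM; field.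
  apply: reducesD => //; first exact: (reduces_nat _ 1).
  by apply: reduces_div => //; [exact: reduces_nat | exact: (reduces_nat _ 2)].
have -> : F0 - P / 6 * K = F0 + P * - 6^-1 * K by ring.
apply: h; have -> : 5 / 6 - m%:R = 1 + p%:R * - 6^-1 :> rat by rewrite pE -[(6 * m).+1%:R]natr1 !natrM; field.
apply: reducesD => //; first exact: (reduces_nat _ 1).
apply: reducesM => //; first exact: reduces_nat.
apply: reducesN => //; apply: reducesV => //; exact: (reduces_nat _ 6).
Qed.

(** Here e q plays the role of p/d: a factor is d (l + 1) times 1 + e q / (l + 1), and q^2 = 0. *)
Lemma apprd_reduces (d : int) (e : R) k : (k <= 6 * m)%N -> d%:~R * e * q = P ->
  reduces (apprd rat p d k) (d%:~R ^+ k * k`!%:R * (1 + e * q * harm k)).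
Proof.
move=> le_k dE; have -> : d%:~R ^+ k * k`!%:R * (1 + e * q * harm k)
    = \prod_(l < k) (P + d%:~R * l.+1%:R).
  elim: k le_k => [|k IH] le_k; first by rewrite big_ord0 harm0 mulr0 addr0 !mulr1.
  rewrite big_ord_recr /= -IH ?(ltnW le_k) // harmS exprS factS natrM -{3}dE.
  have u : (k.+1%:R : R) \is a GRing.unit by apply: usmall; lia.
  set v := k.+1%:R^-1; set h := harm k; set D := d%:~R.
  transitivity (D * D ^+ k * k`!%:R * (k.+1%:R + e * q * h * k.+1%:R + e * q * (k.+1%:R * v))).
    by ring.
  rewrite mulrV //.
  transitivity (D * D ^+ k * k`!%:R * (k.+1%:R + e * q * h * k.+1%:R + e * q)
    + D ^+ k * k`!%:R * h * D * e * e * (q * q)); last by ring.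
  by rewrite qq mulr0 addr0 mulr1.
apply: reduces_prod => // l _; apply: reducesD => //; first exact: reduces_nat.
by apply: reducesM => //; [exact: reduces_int | exact: reduces_nat].
Qed.

(** From (2i + 1) + 2 (3m - i) = p, the odd reciprocals in H_2m become -1/2 times those of H_3m -
    H_2m modulo p, while the even ones give half of H_m. *)
Lemma harm_relation : q * (harm m - harm (2 * m) - harm (3 * m)) = 0.
Proof.
have h2E : harm (2 * m) = \sum_(i < m) ((2 * i).+1%:R^-1 + (2 * i).+2%:R^-1).
  rewrite /harm; elim: (m) => [|k IH]; first by rewrite muln0 !big_ord0.
  rewrite (_ : 2 * k.+1 = (2 * k).+2)%N; last by lia.
  by rewrite !big_ord_recr /= IH addrA.
have h3E : harm (3 * m) = harm (2 * m) + \sum_(i < m) (3 * m - i)%:R^-1.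
  rewrite [in LHS](_ : 3 * m = 2 * m + m)%N; last by lia.
  rewrite /harm big_split_ord /=; congr (_ + _).
  rewrite (reindex_inj rev_ord_inj) /=; apply: eq_bigr => i _.
  by congr (_%:R^-1); have := ltn_ord i; lia.
have e : 2 * (q * harm (2 * m)) = q * harm m - q * (harm (3 * m) - harm (2 * m)).
  rewrite h3E addrAC subrr add0r {1}h2E /harm !mulr_sumr -sumrB.
  apply: eq_bigr => i _; have lt_i := ltn_ord i.
  have ua : ((2 * i).+1%:R : R) \is a GRing.unit by apply: usmall; lia.
  have ub : ((3 * m - i)%:R : R) \is a GRing.unit by apply: usmall; lia.
  have ud : (i.+1%:R : R) \is a GRing.unit by apply: usmall; lia.
  have -> : (2 * i).+2%:R^-1 = i.+1%:R^-1 * 2^-1 :> R.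
    by rewrite (_ : (2 * i).+2 = 2 * i.+1)%N ?natrM ?invrM //; lia.
  have k1 : q * (2 * i).+1%:R = - (2 * (q * (3 * m - i)%:R)).
    apply/eqP; rewrite -addr_eq0 mulrCA -mulrDr -(natrM _ 2) -natrD.
    rewrite (_ : (2 * i).+1 + 2 * (3 * m - i) = p)%N; last by rewrite pE; lia.
    by rewrite -mulrA PP mulr0.
  have k2 : 2 * (q * (2 * i).+1%:R^-1) = - (q * (3 * m - i)%:R^-1).
    set x := _%:R^-1; set y := _%:R^-1.
    transitivity (2 * (q * x * ((3 * m - i)%:R * y))); first by rewrite mulrV // mulr1.
    transitivity (2 * (q * (3 * m - i)%:R) * x * y); first by ring.
    rewrite -[2 * (q * _)]opprK -k1.
    transitivity (- (q * ((2 * i).+1%:R * x) * y)); first by ring.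
    by rewrite mulrV // mulr1.
  transitivity (2 * (q * (2 * i).+1%:R^-1) + q * i.+1%:R^-1 * (2 * 2^-1)); first by ring.
  by rewrite k2 mulrV // mulr1 addrC.
transitivity (q * harm m - q * (harm (3 * m) - harm (2 * m)) - 2 * (q * harm (2 * m))).
  by ring.
by rewrite e subrr.
Qed.

Local Notation h1 := (harm m).
Local Notation h2 := (harm (2 * m)).
Local Notation h3 := (harm (3 * m)).
Local Notation a := (m`!%:R : R).
Local Notation b := ((2 * m)`!%:R : R).
Local Notation c := ((3 * m)`!%:R : R).
Local Notation v1 := (1 + q * h1).
Local Notation v2 := (1 + q * h2).
Local Notation v3 := (1 + q * h3).

Let uv h : 1 + q * h \is a GRing.unit.
Proof. by have := unit1P (m%:R * h); rewrite mulrA [P * _]mulrC. Qed.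

Let vX h e : (1 + q * h) ^+ e = 1 + e%:R * q * h.
Proof.
elim: e => [|e IH]; first by rewrite !mul0r addr0.
rewrite exprS IH -natr1.
transitivity (1 + (e%:R + 1) * q * h + q * q * (e%:R * h * h)); first by ring.
by rewrite qq mul0r addr0.
Qed.

Let v123 : v1 = v2 * v3.
Proof.
transitivity (1 + q * (h2 + h3) + q * q * (h2 * h3)); last by ring.
rewrite qq mul0r addr0; apply/eqP; rewrite -subr_eq0; apply/eqP.
by rewrite -[RHS]harm_relation; ring.
Qed.

Let ua : a \is a GRing.unit. Proof. by apply: ufact; lia. Qed.
Let ub : b \is a GRing.unit. Proof. by apply: ufact; lia. Qed.
Let uc : c \is a GRing.unit. Proof. by apply: ufact; lia. Qed.

Let ap_m3 k : (k <= 6 * m)%N ->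
  reduces (apprd rat p (-3) k) ((-3) ^+ k * k`!%:R * (1 + 2 * q * harm k)).
Proof. by move=> le_k; apply: (@apprd_reduces (-3) 2) => //; rewrite [RHS]P6 /=; ring. Qed.

Let ap_m6 k : (k <= 6 * m)%N ->
  reduces (apprd rat p (-6) k) ((-6) ^+ k * k`!%:R * (1 + 1 * q * harm k)).
Proof. by move=> le_k; apply: (@apprd_reduces (-6) 1) => //; rewrite [RHS]P6 /=; ring. Qed.

Let ap_m2 k : (k <= 6 * m)%N ->
  reduces (apprd rat p (-2) k) ((-2) ^+ k * k`!%:R * (1 + 3 * q * harm k)).
Proof. by move=> le_k; apply: (@apprd_reduces (-2) 3) => //; rewrite [RHS]P6 /=; ring. Qed.

Let ap_m1 k : (k <= 6 * m)%N ->
  reduces (apprd rat p (-1) k) ((-1) ^+ k * k`!%:R * (1 + 6 * q * harm k)).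
Proof. by move=> le_k; apply: (@apprd_reduces (-1) 6) => //; rewrite [RHS]P6 /=; ring. Qed.

Let ap_3 k : (k <= 6 * m)%N ->
  reduces (apprd rat p 3 k) (3 ^+ k * k`!%:R * (1 + (-2) * q * harm k)).
Proof. by move=> le_k; apply: (@apprd_reduces 3 (-2)) => //; rewrite [RHS]P6 /=; ring. Qed.

Let red_pow (k e : nat) : reduces (k%:R ^+ e) (k%:R ^+ e).
Proof. by apply: reducesX => //; exact: reduces_nat. Qed.

Let R3 : b ^+ 2 * v2 ^+ 3 = (-4) ^+ m * a * c * v3 ^+ 3.
Proof.
have := fact_apprd rat pE => e.
have l : reduces ((2 * m)`!%:R * apprd rat p (-2) (2 * m))
    (b * ((-2) ^+ (2 * m) * b * (1 + 3 * q * h2))).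
  by apply: reducesM => //; [exact: reduces_nat | apply: ap_m2; lia].
rewrite e in l.
have r : reduces (2 ^+ m * m`!%:R * apprd rat p (-2) (3 * m))
    (2 ^+ m * a * ((-2) ^+ (3 * m) * c * (1 + 3 * q * h3))).
  apply: reducesM => //; last by apply: ap_m2; lia.
  by apply: reducesM => //; exact: reduces_nat.
have := reduces_fun p_pr l r; rewrite !exprM sqrrN.
have -> : ((-2) ^+ 3) ^+ m = (-4) ^+ m * 2 ^+ m :> R.
  by rewrite -exprMn; congr (_ ^+ _); ring.
rewrite -!vX => e'.
have u4 : (2 ^+ 2 : R) ^+ m \is a GRing.unit by rewrite !unitrX.
have f : (2 ^+ 2) ^+ m = 2 ^+ m * 2 ^+ m :> R by rewrite -exprM mulnC exprM expr2.
apply: (mulrI u4); rewrite f in e' *.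
transitivity (b * (2 ^+ m * 2 ^+ m * b * v2 ^+ 3)); first by ring.
by rewrite e'; ring.
Qed.

Variables (F0 y : R).
Hypothesis Py : P * y = 0.
Hypothesis yy : y * y = 0.
Hypothesis r1 : reduces (hsum n (n%:R + 3 / 2)) (F0 + 3 * y).
Hypothesis r2 : reduces (hsum n (5 / 6 - m%:R)) (F0 - y).
Local Notation E1 := (F0 + 3 * y).
Local Notation E2 := (F0 - y).
Local Notation J := (jac p m).

Let R1 : 3 ^+ (6 * m) * a * b * v2 ^+ 2 * E1 = 2 ^+ (3 * m) * (-1) ^+ m * c * v3 ^+ 6 * v1 ^+ 2.
Proof.
have e := hsum1_apprd rat pE.
have l : reduces (hsum n (n%:R + 3 / 2) * 3 ^+ n * apprd rat p (-3) (2 * m) * apprd rat p 3 m)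
   (E1 * 3 ^+ n * ((-3) ^+ (2 * m) * b * (1 + 2 * q * h2)) * (3 ^+ m * a * (1 + (-2) * q * h1))).
  apply: reducesM => //; last by apply: ap_3; lia.
  apply: reducesM => //; last by apply: ap_m3; lia.
  by apply: reducesM.
rewrite e in l.
have r : reduces (2 ^+ n * apprd rat p (-1) n) (2 ^+ n * ((-1) ^+ n * c * (1 + 6 * q * h3))).
  by apply: reducesM => //; apply: ap_m1; lia.
have e' := reduces_fun p_pr l r.
(* q is nilpotent, so 1 - 2 q h1 is inverse to v1^2. *)
have v1V : (1 + (-2) * q * h1) * v1 ^+ 2 = 1.
  rewrite vX; transitivity (1 - q * q * (4 * h1 * h1)); first by ring.
  by rewrite qq mul0r subr0.
have s1 : (-1) ^+ n = (-1) ^+ m :> R by rewrite -signr_odd oddM signr_odd.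
have s3 : (-3) ^+ (2 * m) = 3 ^+ (2 * m) :> R by rewrite !exprM sqrrN.
have p3 : 3 ^+ (6 * m) = 3 ^+ n * 3 ^+ (2 * m) * 3 ^+ m :> R.
  by rewrite -!exprD; congr (_ ^+ _); lia.
rewrite s1 s3 -!vX in e'.
transitivity ((E1 * 3 ^+ n * (3 ^+ (2 * m) * b * v2 ^+ 2) *
  (3 ^+ m * a * (1 + (-2) * q * h1))) * v1 ^+ 2); last by rewrite e'; ring.
transitivity (3 ^+ (6 * m) * a * b * v2 ^+ 2 * E1 * ((1 + (-2) * q * h1) * v1 ^+ 2)).
  by rewrite v1V mulr1.
by rewrite p3; ring.
Qed.

Let R2 : a ^+ 2 * v1 ^+ 3 * E2 = 2 ^+ m * b * v2 ^+ 2.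
Proof.
have e := hsum2_apprd rat pE.
have l : reduces (hsum n (5 / 6 - m%:R) * apprd rat p (-6) m * apprd rat p (-3) m)
   (E2 * ((-6) ^+ m * a * (1 + 1 * q * h1)) * ((-3) ^+ m * a * (1 + 2 * q * h1))).
  apply: reducesM => //; last by apply: ap_m3; lia.
  by apply: reducesM => //; apply: ap_m6; lia.
rewrite e in l.
have r : reduces (4 ^+ m * apprd rat p (-3) (2 * m)) (4 ^+ m * ((-3) ^+ (2 * m) * b * (1 + 2 * q * h2))).
  by apply: reducesM => //; apply: ap_m3; lia.
have e' := reduces_fun p_pr l r.
have u : (18 ^+ m : R) \is a GRing.unit.
  by rewrite unitrX // -[18]/((3 * 6)%:R) natrM unitrM u3.
apply: (mulrI u).
have s1 : (-6) ^+ m * (-3) ^+ m = 18 ^+ m :> R by rewrite -exprMn; congr (_ ^+ _); ring.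
have s2 : 4 ^+ m * (-3) ^+ (2 * m) = 18 ^+ m * 2 ^+ m :> R.
  by rewrite exprM -!exprMn; congr (_ ^+ _); ring.
have w1 : 1 + 1 * q * h1 = v1 by rewrite mul1r.
have w2 : 1 + 2 * q * h1 = v1 ^+ 2 by rewrite vX.
have w3 : 1 + 2 * q * h2 = v2 ^+ 2 by rewrite vX.
rewrite w1 w2 w3 in e'.
transitivity ((-6) ^+ m * (-3) ^+ m * (a ^+ 2 * v1 ^+ 3 * E2)); first by rewrite s1.
transitivity (E2 * ((-6) ^+ m * a * v1) * ((-3) ^+ m * a * v1 ^+ 2)); first by ring.
rewrite e'; transitivity (4 ^+ m * (-3) ^+ (2 * m) * (b * v2 ^+ 2)); first by ring.
by rewrite s2; ring.
Qed.

Let R4 : a * b * J * (v1 * v2 ^+ 2) = - (c * v3 ^+ 3).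
Proof.
have e : 'C(3 * m, m)%:R * (a * b) = c.
  rewrite -natrM -natrM (_ : 2 * m = 3 * m - m)%N; last by lia.
  by rewrite bin_fact //; lia.
have w : (1 + q * (3 * h3 - h1 - 2 * h2)) * (v1 * v2 ^+ 2) = v3 ^+ 3.
  rewrite !vX; transitivity (1 + 3%:R * q * h3 + q * q * (2 * h1 * h2
    + (3 * h3 - h1 - 2 * h2) * (h1 + 2 * h2 + 2 * q * h1 * h2))); first by ring.
  by rewrite qq mul0r addr0.
rewrite jac_closed // -w -e; ring.
Qed.

Lemma jac_unit : J \is a GRing.unit.
Proof.
have : a * b * J * (v1 * v2 ^+ 2) \is a GRing.unit.
  by rewrite R4 unitrN unitrM uc; apply: unitrX; exact: uv.
by rewrite !unitrM => /andP[/andP[_ ->]].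
Qed.

Lemma hsum_quartic : 3 ^+ (6 * m) * F0 ^+ 4 = 2 ^+ (12 * m) * J ^+ 4.
Proof.
have F4 : E1 * E2 ^+ 3 = F0 ^+ 4.
  transitivity (F0 ^+ 4 + y * y * (- 6 * F0 ^+ 2 + 8 * F0 * y - 3 * (y * y))); first by ring.
  by rewrite yy mul0r addr0.
rewrite -F4.
have uX : a ^+ 7 * b ^+ 4 * v1 ^+ 9 * v2 ^+ 8 \is a GRing.unit.
  have uM (x z : R) : x \is a GRing.unit -> z \is a GRing.unit -> x * z \is a GRing.unit.
    by rewrite unitrM => -> ->.
  exact: (uM _ _ (uM _ _ (uM _ _ (unitrX 7 ua) (unitrX 4 ub)) (unitrX 9 (uv h1))) (unitrX 8 (uv h2))).
apply: (mulIr uX).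
have s8 : 2 ^+ (3 * m) = (2 ^+ m) ^+ 3 :> R by rewrite -exprM mulnC.
have s12 : 2 ^+ (12 * m) = (2 ^+ m) ^+ 12 :> R by rewrite -exprM mulnC.
have s4 : (-4) ^+ m = (-1) ^+ m * (2 ^+ m * 2 ^+ m) :> R.
  by rewrite -!exprMn; congr (_ ^+ _); ring.
rewrite s12; apply: (quartic_elimination (s := (-1) ^+ m) (c := c) _ v123).
- by rewrite -expr2 sqrr_sign.
- by rewrite R1 s8.
- exact: R2.
- by rewrite R3 s4.
exact: R4.
Qed.

(** Modulo p the v_i and 3^(6m) become 1, and comparing [R1] with [R4] gives F0 in terms of J. This
    singles out the fourth root in [hsum_quartic]. *)
Lemma hsum_mod_p : P * F0 = - ((-1) ^+ m * 2 ^+ (3 * m)) * (P * J).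
Proof.
have Pv h : P * (1 + q * h) = P.
  transitivity (P + P * P * (m%:R * h)); first by ring.
  by rewrite PP mul0r addr0.
have PvX h e z : P * (z * (1 + q * h) ^+ e) = P * z.
  elim: e => [|e IH]; first by rewrite expr0 mulr1.
  transitivity (P * (1 + q * h) * (z * (1 + q * h) ^+ e)); first by rewrite exprS; ring.
  by rewrite Pv IH.
have F3 : P * 3 ^+ (6 * m) = P.
  by have := P_fermat1 p_pr u3; rewrite (_ : p.-1 = 6 * m)%N // pE.
have PE : P * E1 = P * F0.
  transitivity (P * F0 + 3 * (P * y)); first by ring.
  by rewrite Py mulr0 addr0.
have uab : a * b \is a GRing.unit by rewrite unitrM ua.
apply: (mulrI uab); rewrite -PE.
have e1 := congr1 (fun z => P * z) R1.
have e4 := congr1 (fun z => P * z) R4.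
transitivity (P * (2 ^+ (3 * m) * (-1) ^+ m * c)).
  transitivity (P * (3 ^+ (6 * m) * a * b * v2 ^+ 2 * E1)).
    transitivity (P * 3 ^+ (6 * m) * (a * b * E1)); first by rewrite F3; ring.
    rewrite -[LHS](mulrA P) -(PvX h2 2); congr (_ * _); ring.
  by rewrite e1 !PvX.
transitivity (- ((-1) ^+ m * 2 ^+ (3 * m)) * (P * (a * b * J))); last by ring.
transitivity (- ((-1) ^+ m * 2 ^+ (3 * m)) * (P * (a * b * J * (v1 * v2 ^+ 2)))).
  by rewrite e4 mulrN PvX; ring.
by congr (_ * _); rewrite [a * b * J * (_ * _)]mulrA PvX -[v1]expr1 PvX.
Qed.

End Quartic.

(** * Identification of the residues *)

(** p divides one factor z of (xv - uy)(xv + uy), and p^2 = w^2 + 3 z^2 by Brahmagupta's identity. A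
    nonzero multiple of p is too large for z. *)
Lemma norm_form_uniq (p : nat) (x y u v : int) : prime p ->
  p%:Z = x ^+ 2 + 3 * y ^+ 2 -> p%:Z = u ^+ 2 + 3 * v ^+ 2 -> x ^+ 2 = u ^+ 2 /\ y ^+ 2 = v ^+ 2.
Proof.
move=> p_pr e1 e2; have p0 : 0 < p%:Z by have := prime_gt0 p_pr.
suff e : y ^+ 2 = v ^+ 2 by split=> //; move: e1; rewrite e2 e => /addIr.
have key : (x * v - u * y) * (x * v + u * y) = p%:Z * (v ^+ 2 - y ^+ 2).
  transitivity ((x ^+ 2 + 3 * y ^+ 2) * v ^+ 2 - (u ^+ 2 + 3 * v ^+ 2) * y ^+ 2); first by ring.
  by rewrite -e1 -e2; ring.
have small z w : p%:Z ^+ 2 = w ^+ 2 + 3 * z ^+ 2 -> (p%:Z %| z)%Z -> z = 0.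
  move=> e /dvdzP[c zc]; move: e; rewrite zc exprMn => e.
  have c2 : 3 * c ^+ 2 <= 1.
    have pp : 0 < p%:Z ^+ 2 by rewrite exprn_gt0.
    rewrite -(ler_pM2r pp) mul1r [leRHS]e -mulrA.
    by rewrite lerDr sqr_ge0.
  have [-> | c0] := eqVneq c 0; first by rewrite mul0r.
  have c1 : 0 < c ^+ 2 by rewrite exprn_even_gt0.
  by clear -c1 c2; move: (c ^+ 2) c1 c2 => C; lia.
suff z0 : (x * v - u * y) * (x * v + u * y) = 0.
  move: key; rewrite z0 => /esym/eqP; rewrite mulf_eq0 gt_eqF //= subr_eq0 => /eqP.
  by [].
have : (p %| `|(x * v - u * y)%R| * `|(x * v + u * y)%R|)%N.
  by rewrite -abszM key abszM dvdn_mulr.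
rewrite Euclid_dvdM // => /orP[] dv.
  have -> : x * v - u * y = 0; last by rewrite mul0r.
  apply: (small _ (x * u + 3 * y * v)); last by rewrite dvdzE.
  by rewrite expr2 {1}e1 e2; ring.
have -> : x * v + u * y = 0; last by rewrite mulr0.
apply: (small _ (x * u - 3 * y * v)); last by rewrite dvdzE.
by rewrite expr2 {1}e1 e2; ring.
Qed.

Lemma gauss_sign_mod3 (X : nat) (x' : int) : `|x'|%N = X -> (exists d, x' = - 1 - 3 * d) ->
  x' = - (gauss_sign 3 X * X%:Z).
Proof.
move=> <- [d xE]; rewrite /gauss_sign big_ord1 muln1 /mod_sign -[(3./2)%N]/1%N.
by case: ifP => h; lia.
Qed.

Section Residues.
Variables (p m : nat) (p_pr : prime p) (pE : p = (6 * m).+1) (m0 : (0 < m)%N).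
Local Notation R := 'Z_(p ^ 2).
Local Notation P := (p%:R : R).
Local Notation n := (3 * m)%N.
Local Notation J := (jac p m).
Local Notation Jc := (jacc p m).

Let PP : P * P = 0. Proof. exact: PP0. Qed.
Let u2 : (2 : R) \is a GRing.unit. Proof. by apply: (@unit_small p m p_pr pE m0 2); lia. Qed.

(** Hensel uniqueness: for u = v + P w one has u^4 - v^4 = 4 v^3 P w, and 4 v^3 is a unit. *)
Lemma eq_of_quartic (u v : R) : u ^+ 4 = v ^+ 4 -> P * u = P * v ->
  v \is a GRing.unit -> u = v.
Proof.
move=> e4 eP uv; have /(P_mul_eq0 p_pr)[w uw] : P * (u - v) = 0 by rewrite mulrBr eP subrr.
have uE : u = v + P * w by rewrite -uw addrC subrK.
have u4 : 4 * v ^+ 3 \is a GRing.unit.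
  by rewrite unitrM unitrX // -[4]/((2 * 2)%:R) natrM unitrM u2.
rewrite uE; apply/eqP; rewrite -subr_eq0 addrAC subrr add0r; apply/eqP.
apply: (mulrI u4); rewrite mulr0.
transitivity (u ^+ 4 - v ^+ 4); last by rewrite e4 subrr.
rewrite uE; transitivity ((v + P * w) ^+ 4 - v ^+ 4 - P * P * (6 * v ^+ 2 * w ^+ 2
  + 4 * v * w ^+ 3 * P + w ^+ 4 * (P * P))); first by ring.
by rewrite PP mul0r subr0.
Qed.

Lemma P_int (z w : int) : (z%:~R : 'F_p) = w%:~R -> P * z%:~R = P * w%:~R.
Proof.
move=> e; apply/eqP; rewrite -subr_eq0 -mulrBr -rmorphB.
have : ((z - w)%:~R : 'F_p) = 0 by rewrite rmorphB /= e subrr.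
move: (z - w) => {e}z z0.
have : (`|z|%N%:R : 'F_p) == 0.
  by move: z0; case: z => k z0; apply/eqP => //; apply: oppr_inj; rewrite oppr0.
rewrite -(dvdn_pcharf (pchar_Fp p_pr)) => /dvdnP[c zc].
rewrite [z]intEsign zc rmorphM rmorph_sign /= -[((c * p)%:Z)%:~R]/((c * p)%:R) natrM.
set s := (-1) ^+ _; apply/eqP; transitivity (P * P * (s * c%:R)); first by ring.
by rewrite PP mul0r.
Qed.

(** J is a unit and J Jc = P, so Jc is p times a unit. This nilpotent conjugate is the source of the
    terms p/x and p/(6y). *)
Lemma Jc_sqr : Jc * Jc = 0.
Proof.
have uJ := jac_unit p_pr pE m0; have e := jac_norm p_pr pE m0.
apply: (mulrI uJ); apply: (mulrI uJ); rewrite !mulr0.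
transitivity ((J * Jc) * (J * Jc)); first by ring.
by rewrite e PP.
Qed.

Lemma P_Jc : P * Jc = 0.
Proof. by rewrite -(jac_norm p_pr pE m0) -mulrA Jc_sqr mulr0. Qed.


Variables (x' b : int) (sg : R).
Hypothesis sg2 : sg ^+ 2 = -3.
Hypothesis JE : J = x'%:~R + b%:~R * sg.
Hypothesis JcE : Jc = x'%:~R - b%:~R * sg.

Variables (F0 : R).
Hypothesis F4 : 3 ^+ (6 * m) * F0 ^+ 4 = 2 ^+ (12 * m) * J ^+ 4.
Hypothesis FP : P * F0 = - ((-1) ^+ m * 2 ^+ (3 * m)) * (P * J).

Let uJ : J \is a GRing.unit. Proof. exact: jac_unit. Qed.
Let JJc : J * Jc = P. Proof. exact: jac_norm. Qed.

Let pow4 k : 4 ^+ k = 2 ^+ (2 * k) :> R.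
Proof. by rewrite exprM; congr (_ ^+ _); ring. Qed.

(* The residue of (3 / 4)^(n / 2) times the hypergeometric sum, for p = 1 mod 12. *)
Lemma even_residue k (x eps : int) (A : R) : m = (2 * k)%N ->
  4 ^+ (3 * k) * A = 3 ^+ (3 * k) * F0 -> eps * eps = 1 -> x = - (eps * x') ->
  P * 3 ^+ (3 * k) = P * eps%:~R -> 2 * A * x%:~R = 4 * x%:~R ^+ 2 - P.
Proof.
move=> mk AE ee xE e3.
have eeR : (eps%:~R : R) * eps%:~R = 1 by rewrite -rmorphM ee.
have u4 : (4 ^+ (3 * k) : R) \is a GRing.unit.
  by rewrite unitrX // -[4]/((2 * 2)%:R) natrM unitrM u2.
have A_eq : A = - (eps%:~R * J).
  apply: eq_of_quartic.
  - apply: (mulrI (unitrX 4 u4)); rewrite -exprMn AE exprMn -exprM.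
    rewrite (_ : 3 * k * 4 = 6 * m)%N ?F4; last by lia.
    have <- : (4 ^+ (3 * k)) ^+ 4 = 2 ^+ (12 * m) :> R.
      by rewrite pow4 -exprM; congr (_ ^+ _); lia.
    by transitivity ((4 ^+ (3 * k)) ^+ 4 * (eps%:~R * eps%:~R) ^+ 2 * J ^+ 4); [rewrite eeR; ring | ring].
  - apply: (mulrI u4); rewrite mulrCA AE mulrCA FP.
    have -> : (-1) ^+ m = 1 :> R by rewrite mk exprM sqrrN !expr1n.
    have -> : 2 ^+ (3 * m) = 4 ^+ (3 * k) :> R.
      by rewrite pow4; congr (_ ^+ _); lia.
    transitivity (- (4 ^+ (3 * k) * (P * 3 ^+ (3 * k)) * J)); first by ring.
    by rewrite e3; ring.
  rewrite unitrN unitrM uJ andbT; apply/unitrPr; exists eps%:~R; exact: eeR.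
have xR : x%:~R = - (eps%:~R * x'%:~R) :> R by rewrite xE rmorphN rmorphM.
have tr : J + Jc = 2 * x'%:~R by rewrite JE JcE; ring.
(* 2 x' J = J^2 + J Jc = (J + Jc)^2 - P, because Jc^2 = 0. *)
transitivity (J * (2 * x'%:~R) * (eps%:~R * eps%:~R)); first by rewrite A_eq xR; ring.
transitivity ((eps%:~R * eps%:~R) * (2 * x'%:~R) ^+ 2 - P); last by rewrite xR; ring.
rewrite eeR -tr; transitivity (J * J + J * Jc); first by ring.
transitivity (J * J + 2 * (J * Jc) + Jc * Jc - P); last by ring.
by rewrite JJc Jc_sqr; ring.
Qed.

(* The same residue for p = 7 mod 12, where it is a multiple of sqrt(-3). *)
Lemma odd_residue k (y e : int) (U : R) : m = (2 * k).+1 ->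
  2 * 4 ^+ (3 * k + 1) * U = - (3 ^+ (3 * k + 1) * F0) -> e * e = 1 -> y = e * b ->
  (b%:~R : R) \is a GRing.unit ->
  P * (3 ^+ (3 * k + 1) * x'%:~R) = - (P * y%:~R) -> 6 * y%:~R * U = 12 * y%:~R ^+ 2 - P.
Proof.
move=> mk UE ee yE ub e3.
have eeR : (e%:~R : R) * e%:~R = 1 by rewrite -rmorphM ee.
have yR : y%:~R = e%:~R * b%:~R :> R by rewrite yE rmorphM.
have u3 : (3 : R) \is a GRing.unit by apply: (@unit_small p m p_pr pE m0 3); lia.
have usg : sg \is a GRing.unit.
  have : sg ^+ 2 \is a GRing.unit by rewrite sg2 unitrN.
  by rewrite expr2 unitrM => /andP[].
have u4 : (2 * 4 ^+ (3 * k + 1) : R) \is a GRing.unit.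
  by rewrite unitrM u2 unitrX // -[4]/((2 * 2)%:R) natrM unitrM u2.
have two_pow : 2 * 4 ^+ (3 * k + 1) = 2 ^+ (3 * m) :> R.
  by rewrite pow4 -exprS; congr (_ ^+ _); lia.
have U_eq : U * sg = e%:~R * J.
  apply: eq_of_quartic.
  - apply: (mulrI (unitrX 4 u4)).
    transitivity ((2 * 4 ^+ (3 * k + 1) * U) ^+ 4 * (sg ^+ 2) ^+ 2); first by ring.
    rewrite UE sg2.
    transitivity (3 ^+ 2 * (3 ^+ (3 * k + 1)) ^+ 4 * F0 ^+ 4); first by ring.
    rewrite -exprM -exprD (_ : 2 + (3 * k + 1) * 4 = 6 * m)%N ?F4; last by lia.
    transitivity (2 ^+ (12 * m) * (e%:~R * e%:~R) ^+ 2 * J ^+ 4).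
      by rewrite eeR; ring.
    by rewrite two_pow -exprM (_ : 3 * m * 4 = 12 * m)%N; [ring | lia].
  - apply: (mulrI u4); apply: (mulrI ub).
    transitivity (b%:~R * sg * (P * (2 * 4 ^+ (3 * k + 1) * U))); first by ring.
    rewrite UE two_pow mulrN.
    transitivity (- (b%:~R * sg * 3 ^+ (3 * k + 1) * (P * F0))); first by ring.
    rewrite FP; have -> : (-1) ^+ m = -1 :> R by rewrite mk exprS exprM sqrrN !expr1n mulr1.
    (* Jc vanishes modulo p, so b sg is congruent to x', the quantity in [e3]. *)
    have Pbs : P * (b%:~R * sg) = P * x'%:~R.
      have : P * Jc = 0 by exact: P_Jc.
      by rewrite JcE mulrBr => /eqP; rewrite subr_eq0 => /eqP.
    transitivity (- (2 ^+ (3 * m) * 3 ^+ (3 * k + 1) * (P * (b%:~R * sg)) * J)); first by ring.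
    rewrite Pbs; transitivity (- (2 ^+ (3 * m) * (P * (3 ^+ (3 * k + 1) * x'%:~R)) * J)); first by ring.
    by rewrite e3 yR; ring.
  rewrite unitrM uJ andbT; apply/unitrPr; exists e%:~R; exact: eeR.
apply: (mulIr usg); apply: (mulIr usg).
have df : J - Jc = 2 * (b%:~R * sg) by rewrite JE JcE; ring.
transitivity ((6 * y%:~R * (U * sg)) * sg); first by ring.
rewrite U_eq yR.
transitivity ((e%:~R * e%:~R) * (3 * (2 * (b%:~R * sg)) * J)); first by ring.
transitivity ((e%:~R * e%:~R) * (3 * (2 * (b%:~R * sg)) ^+ 2) - P * sg ^+ 2); last by ring.
(* (J - Jc) J = (J - Jc)^2 + P, again from Jc^2 = 0. *)
rewrite eeR -df sg2.
transitivity (3 * (J * J) - 3 * (J * Jc)); first by ring.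
transitivity (3 * (J * J) - 6 * (J * Jc) + 3 * (Jc * Jc) + 3 * P); last by ring.
by rewrite JJc Jc_sqr; ring.
Qed.

End Residues.

Lemma sqr_int_nat (p : nat) (x y : int) : p%:Z = x ^+ 2 + 3 * y ^+ 2 ->
  p = (`|x| ^ 2 + 3 * `|y| ^ 2)%N.
Proof.
have sq z : z ^+ 2 = (`|z| ^ 2)%N%:Z by rewrite expr2 -mulnn; case: z => k; lia.
by rewrite !sq -PoszM -PoszD => -[].
Qed.

Lemma norm_form_bounds (p : nat) (x y : int) : prime p -> (3 < p)%N ->
  p%:Z = x ^+ 2 + 3 * y ^+ 2 -> (0 < `|x| < p)%N && (0 < `|y| < p)%N.
Proof.
move=> p_pr p_gt3 /sqr_int_nat; move: `|x|%N `|y|%N => X Y e.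
have X0 : X != 0%N.
  apply: contraTneq p_pr => X0; apply/negP => /primeP[_ /(_ 3%N)].
  rewrite e X0 add0n dvdn_mulr // => /(_ isT)/orP[] // /eqP.
  by rewrite X0 in e; lia.
have Y0 : Y != 0%N.
  apply: contraTneq p_pr => Y0; apply/negP => /primeP[p1 /(_ X)].
  rewrite e Y0 addn0 dvdn_mulr // => /(_ isT)/orP[] /eqP; rewrite e Y0 in p1; nia.
nia.
Qed.

(** The normalization 1 mod 4 matches the sign that reciprocity produces in the norm form lemmas. *)
Lemma abs_1mod4 (z d : int) : z = 1 + 4 * d -> z = (-1) ^+ (`|z|%N)./2 * (`|z|%N)%:Z.
Proof.
move=> e; rewrite -signr_odd; case h: (odd _) => /=; rewrite ?expr1 ?expr0; lia.
Qed.

(** * Solving for the weighted sums *)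

Section Elimination.
Variables (p : nat) (p_pr : prime p).
Local Notation R := 'Z_(p ^ 2).
Local Notation P := (p%:R : R).
Hypothesis u2 : (2 : R) \is a GRing.unit.
Let PP : P * P = 0. Proof. exact: PP0. Qed.

Let nilp_unit (a w : R) : a \is a GRing.unit -> a - P * w \is a GRing.unit.
Proof.
by move=> ua; apply: (unit_P_mul p_pr _ ua); rewrite mulrBr mulrA PP mul0r subr0.
Qed.

(** z and z' stand for the sums weighted by v_k and (k - 1) v_k. The hypotheses give 2 z z' = -z^2 -
    4P, that is z' = -(z + 4P/z) / 2, and 4P/z = P/x cancels the correction in z. This explains the
    weight k - 1. *)
Lemma even_elimination (x z z' h kap : R) : x \is a GRing.unit ->
  z * x = 4 * x ^+ 2 - P -> z ^+ 2 = 4 * h -> z * (z' + z) = - (12 * kap) ->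
  h + 6 * kap = P -> z = 4 * x - P / x /\ z' = - (2 * x).
Proof.
move=> ux zx zh zk hk; have zE : z = 4 * x - P / x.
  apply: (mulIr ux); rewrite zx mulrBl divrK //; ring.
split=> //; have uz : 2 * z \is a GRing.unit.
  rewrite unitrM u2 zE; apply: nilp_unit.
  by rewrite unitrM ux andbT -[4]/((2 * 2)%:R) natrM unitrM u2.
apply: (mulrI uz); apply: (mulIr ux); apply: (mulIr ux).
transitivity ((2 * (z * (z' + z)) - 2 * z ^+ 2) * x * x); first by ring.
transitivity ((- (z * x) ^+ 2 - 4 * P * x * x) : R).
  by rewrite zk -hk; transitivity (- (4 * h) * x * x - 4 * (h + 6 * kap) * x * x); [rewrite zh; ring | rewrite -zh; ring].
rewrite zx; transitivity (- (4 * x ^+ 2 * (4 * x ^+ 2 - P)) - P * P); first by ring.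
by rewrite PP subr0 -zx; ring.
Qed.

(** Here 6 z z' = 3 z^2 + P, so z' = z/2 + P/(6z), and P/(6z) = P/(12y) cancels the correction in
    z/2. *)
Lemma odd_elimination (y z z' h kap : R) : y \is a GRing.unit -> 6 \is a @GRing.unit R ->
  6 * y * z = 12 * y ^+ 2 - P -> 3 * z ^+ 2 = h -> z * z' = - kap ->
  h + 6 * kap = - P -> [/\ z = 2 * y - P / (6 * y), z' = y & z \is a GRing.unit].
Proof.
move=> uy u6 zy zh zk hk; have u6y : 6 * y \is a GRing.unit by rewrite unitrM u6.
have zE : z = 2 * y - P / (6 * y).
  by apply: (mulrI u6y); rewrite zy mulrBr [_ * (P / _)]mulrC divrK //; ring.
have uz : z \is a GRing.unit by rewrite zE; apply: nilp_unit; rewrite unitrM u2.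
split=> //; apply: (mulrI uz); apply: (mulrI u6).
apply: (mulrI u6y); apply: (mulrI u6y).
transitivity ((6 * y) ^+ 2 * 6 * (z * z')); first by ring.
rewrite zk; transitivity ((6 * y) ^+ 2 * (h - (h + 6 * kap))); first by ring.
rewrite hk -zh; transitivity (3 * (6 * y * z) ^+ 2 + 36 * y ^+ 2 * P); first by ring.
rewrite zy; transitivity (36 * y ^+ 2 * (12 * y ^+ 2 - P) + 3 * (P * P)); first by ring.
by rewrite PP mulr0 addr0 -zy; ring.
Qed.
End Elimination.

(** * The two classes of p modulo 12 *)

Section MainCases.
Variables (p m : nat) (p_pr : prime p) (pE : p = (6 * m).+1) (m0 : (0 < m)%N).
Local Notation R := 'Z_(p ^ 2).
Local Notation P := (p%:R : R).
Local Notation n := (3 * m)%N.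
Local Notation reduces := (@reduces p).

Let usmall i : (0 < i <= 6 * m)%N -> (i%:R : R) \is a GRing.unit.
Proof. exact: unit_small. Qed.
Let u2 : (2 : R) \is a GRing.unit. Proof. by apply: (@usmall 2); lia. Qed.
Let u4 : (4 : R) \is a GRing.unit. Proof. by apply: (@usmall 4); lia. Qed.
Let u6 : (6 : R) \is a GRing.unit. Proof. by apply: (@usmall 6); lia. Qed.
Let p_gt3 : (3 < p)%N. Proof. by clear -pE m0; lia. Qed.

Let unit_int (z : int) : (0 < `|z|%N < p)%N -> (z%:~R : R) \is a GRing.unit.
Proof.
move=> bd; have uz : (`|z|%N%:R : R) \is a GRing.unit by apply: usmall; clear -bd pE; lia.
by rewrite [z]intEsign rmorphM rmorph_sign unitrM unitrX ?unitrN1.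
Qed.

Lemma even_case k (x y : int) : m = (2 * k)%N -> p%:Z = x ^+ 2 + 3 * y ^+ 2 ->
  (exists d, x = 1 + 4 * d) ->
  rat_congr_mod_p2 p
    (\sum_(0 <= k < p) 'C(2 * k, k)%:R ^+ 2 * ((lucas_v 4 1 k)%:~R / 64 ^+ k))
    (4 * x%:~R - p%:R / x%:~R)
  /\ rat_congr_mod_p2 p
    (\sum_(0 <= k < p) 'C(2 * k, k)%:R ^+ 2 * ((k%:R - 1) * (lucas_v 4 1 k)%:~R / 64 ^+ k))
    (- (2 * x%:~R)).
Proof.
move=> mk form [d xd].
have nform := sqr_int_nat form.
have [x' [b [sg [sg2 JE JcE form' x'E]]]] := jac_integer p_pr pE m0.
have [F0 [w [r0 Pw ww r1 r2]]] := hsums_reduce p_pr pE m0.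
have F4 := hsum_quartic p_pr pE m0 ww r1 r2.
have FP := hsum_mod_p p_pr pE m0 Pw r1.
have [xx _] := norm_form_uniq p_pr form form'.
have x'X : `|x'|%N = `|x|%N.
  by move/eqP: xx; rewrite eqf_sqr => /orP[] /eqP ->; rewrite ?abszN.
have x'gs := gauss_sign_mod3 x'X x'E.
have pk : p = (12 * k).+1 by clear -mk pE; lia.
have nf := norm_form_1mod12 p_pr nform p_gt3 pk.
set eps := _ * gauss_sign 3 _ in nf.
have ee : eps * eps = 1.
  by rewrite /eps mulrACA gauss_sign_sqr -expr2 sqrr_sign mulr1.
have xe : x = - (eps * x').
  rewrite x'gs mulrN opprK /eps -mulrA [gauss_sign _ _ * (_ * _)]mulrA gauss_sign_sqr mul1r.
  exact: abs_1mod4 xd.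
have Pe : P * 3 ^+ (3 * k) = P * eps%:~R.
  have := @P_int p p_pr (3 ^+ (3 * k)) eps; rewrite !rmorphXn /=; exact.
have u4k : (4 : R) ^+ (3 * k) \is a GRing.unit by rewrite unitrX.
have key := even_residue p_pr pE m0 JE JcE F4 FP mk
  (_ : 4 ^+ (3 * k) * (3 ^+ (3 * k) * F0 / 4 ^+ (3 * k)) = _) ee xe Pe.
have {}key := key (etrans (mulrC _ _) (divrK u4k _)).
have := norm_form_bounds p_pr p_gt3 form => /andP[/unit_int ux _].
have n_even : ~~ odd n by rewrite mk; clear; lia.
have [s1 s2 s3] := rat_even_sums n_even.
have [z1 c1 c1'] := central_sum_reduces p_pr pE m0 (lucas_v 4 1).
have [z2 c2 c2'] := central_sum_reduces p_pr pE m0 (fun k => (k%:Z - 1) * lucas_v 4 1 k).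
have [h [kap [rh rk hk]]] := ramanujan_sum p_pr pE m0.
have rv : reduces (vsum rat n) z1 by exact: c1'.
(* The congruence has weight k - 1 while Clausen's relation needs weight k; adding [vsum] restores
   it. *)
have rkv : reduces (kvsum rat n) (z2 + z1).
  rewrite (_ : kvsum rat n = (kvsum rat n - vsum rat n) + vsum rat n); last by rewrite subrK.
  apply: reducesD => //; move: c2'; congr reduces.
  rewrite /kvsum /vsum -sumrB; apply: eq_bigr => i _.
  by rewrite rmorphM rmorphB /= -[(i%:Z)%:~R]/(i%:R) -[1%:~R]/(1); ring.
have z1E : z1 = 2 * (3 ^+ (3 * k) * F0 / 4 ^+ (3 * k)).
  apply: (reduces_fun p_pr rv); rewrite s1 mk (_ : (3 * (2 * k))./2 = 3 * k)%N; last by clear; lia.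
  rewrite -mulrA -mk; apply: reducesM => //; first exact: (reduces_nat _ 2).
  rewrite expr_div_n mulrAC; apply: reduces_div => //.
    by apply: reducesM => //; apply: reducesX => //; exact: (reduces_nat _ 3).
  by apply: reducesX => //; exact: (reduces_nat _ 4).
have z1x : z1 * x%:~R = 4 * x%:~R ^+ 2 - P by rewrite z1E.
have h4 : z1 ^+ 2 = 4 * h.
  apply: (reduces_fun p_pr (reducesX p_pr 2 rv)); rewrite s2.
  by apply: reducesM => //; exact: (reduces_nat _ 4).
have k12 : z1 * (z2 + z1) = - (12 * kap).
  apply: (reduces_fun p_pr (reducesM p_pr rv rkv)); rewrite s3.
  by apply: reducesN => //; apply: reducesM => //; exact: (reduces_nat _ 12).
have hkP : h + 6 * kap = P by rewrite hk -signr_odd (negPf n_even) mul1r.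
have [e1 e2] := even_elimination p_pr u2 ux z1x h4 k12 hkP.
split.
  apply: (reduces_congr p_pr c1); rewrite e1.
  apply: reducesB => //; first by apply: reducesM => //; [exact: (reduces_nat _ 4) | exact: reduces_int].
  by apply: reduces_div => //; [exact: reduces_nat | exact: reduces_int].
have c3 : reduces (\sum_(0 <= k < p) 'C(2 * k, k)%:R ^+ 2
    * ((k%:R - 1) * (lucas_v 4 1 k)%:~R / 64 ^+ k)) z2.
  move: c2; congr reduces; apply: eq_bigr => i _.
  by rewrite rmorphM rmorphB.
apply: (reduces_congr p_pr c3); rewrite e2.
apply: reducesN => //; apply: reducesM => //; [exact: (reduces_nat _ 2) | exact: reduces_int].
Qed.

Lemma odd_case k (x y : int) : m = (2 * k).+1 -> p%:Z = x ^+ 2 + 3 * y ^+ 2 ->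
  (exists d, y = 1 + 4 * d) ->
  [/\ rat_congr_mod_p2 p
        (\sum_(0 <= k < p) (lucas_u 4 1 k)%:~R / 64 ^+ k * 'C(2 * k, k)%:R ^+ 2)
        (2 * y%:~R - p%:R / (6 * y%:~R)),
      rat_congr_mod_p2 p y%:~R
        (\sum_(0 <= k < p) 'C(2 * k, k)%:R ^+ 2 * (k%:R * (lucas_u 4 1 k)%:~R / 64 ^+ k))
    & rat_congr_mod_p2 p
        (\sum_(0 <= k < p) 'C(2 * k, k)%:R ^+ 2 * (k%:R * (lucas_u 4 1 k)%:~R / 64 ^+ k))
        (1 / 4 * \sum_(0 <= k < p)
          'C(2 * k, k)%:R ^+ 2 * (k%:R * (lucas_v 4 1 k)%:~R / 64 ^+ k))].
Proof.
move=> mk form [d yd].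
have nform := sqr_int_nat form.
have [x' [b [sg [sg2 JE JcE form' x'E]]]] := jac_integer p_pr pE m0.
have [F0 [w [r0 Pw ww r1 r2]]] := hsums_reduce p_pr pE m0.
have F4 := hsum_quartic p_pr pE m0 ww r1 r2.
have FP := hsum_mod_p p_pr pE m0 Pw r1.
have [xx yy] := norm_form_uniq p_pr form form'.
have x'X : `|x'|%N = `|x|%N.
  by move/eqP: xx; rewrite eqf_sqr => /orP[] /eqP ->; rewrite ?abszN.
have x'gs := gauss_sign_mod3 x'X x'E.
have [e [ee ye]] : exists e : int, e * e = 1 /\ y = e * b.
  by move/eqP: yy; rewrite eqf_sqr => /orP[] /eqP ->; [exists 1 | exists (-1)]; split=> //; ring.
have pk : p = (12 * k + 7)%N by clear -mk pE; lia.
have nf := norm_form_7mod12 p_pr nform p_gt3 pk.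
set X := `|x|%N in nf x'gs; set Y := `|y|%N in nf.
(* The symbol [gauss_sign 3 X] is absorbed into x' and the power of -1 into y. *)
have Pe : P * (3 ^+ (3 * k + 1) * x'%:~R) = - (P * y%:~R).
  have := @P_int p p_pr (3 ^+ (3 * k + 1) * X%:Z) ((-1) ^+ Y./2 * gauss_sign 3 X * Y%:Z).
  rewrite !rmorphM !rmorphXn /= -[(X%:Z)%:~R]/(X%:R) -[(Y%:Z)%:~R]/(Y%:R).
  move: nf; rewrite rmorphM rmorphXn /= => nf /(_ nf) e3.
  have yE : y%:~R = (-1) ^+ Y./2 * Y%:R :> R.
    by rewrite {1}(abs_1mod4 yd) rmorphM rmorphXn.
  have gg : (gauss_sign 3 X)%:~R * (gauss_sign 3 X)%:~R = 1 :> R.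
    by rewrite -rmorphM gauss_sign_sqr.
  rewrite x'gs rmorphN rmorphM /= -[(X%:Z)%:~R]/(X%:R).
  transitivity (- ((gauss_sign 3 X)%:~R * (P * (3 ^+ (3 * k + 1) * X%:R)))); first by ring.
  rewrite e3 yE.
  transitivity (- ((gauss_sign 3 X)%:~R * (gauss_sign 3 X)%:~R * (P * ((-1) ^+ Y./2 * Y%:R)))).
    by ring.
  by rewrite gg mul1r.
have u4k : (2 * 4 ^+ (3 * k + 1) : R) \is a GRing.unit by rewrite unitrM u2 unitrX.
have := norm_form_bounds p_pr p_gt3 form' => /andP[_ /unit_int ub].
have key := odd_residue p_pr pE m0 sg2 JE JcE F4 FP mk
  (_ : 2 * 4 ^+ (3 * k + 1) * (- (3 ^+ (3 * k + 1) * F0) / (2 * 4 ^+ (3 * k + 1))) = _) ee ye ub Pe.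
have {}key := key (etrans (mulrC _ _) (divrK u4k _)).
have := norm_form_bounds p_pr p_gt3 form => /andP[_ /unit_int uy].
have n_odd : odd n by rewrite mk; clear; lia.
have [s1 s2 s3 s4] := rat_odd_sums n_odd.
have [z1 c1 c1'] := central_sum_reduces p_pr pE m0 (lucas_u 4 1).
have [z2 c2 c2'] := central_sum_reduces p_pr pE m0 (fun k => k%:Z * lucas_u 4 1 k).
have [z3 c3 c3'] := central_sum_reduces p_pr pE m0 (fun k => k%:Z * lucas_v 4 1 k).
have [h [kap [rh rk hk]]] := ramanujan_sum p_pr pE m0.
have ru : reduces (usum rat n) z1 by exact: c1'.
have rku : reduces (kusum rat n) z2.
  by move: c2'; congr reduces; apply: eq_bigr => i _; rewrite rmorphM.
have rkv : reduces (kvsum rat n) z3.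
  by move: c3'; congr reduces; apply: eq_bigr => i _; rewrite rmorphM.
have z1E : z1 = - (3 ^+ (3 * k + 1) * F0) / (2 * 4 ^+ (3 * k + 1)).
  apply: (reduces_fun p_pr ru).
  have -> : usum rat n = - (3 ^+ (3 * k + 1) * hsum n 1) / (2 * 4 ^+ (3 * k + 1)).
    rewrite s1 (_ : n./2 = 3 * k + 1)%N; last by rewrite mk; clear; lia.
    rewrite expr_div_n; move: (hsum n 1) => H; field.
    by rewrite expf_neq0.
  apply: reduces_div => //.
    by apply: reducesN => //; apply: reducesM => //; apply: reducesX => //; exact: (reduces_nat _ 3).
  apply: reducesM => //; first exact: (reduces_nat _ 2).
  by apply: reducesX => //; exact: (reduces_nat _ 4).
have z1y : 6 * y%:~R * z1 = 12 * y%:~R ^+ 2 - P by rewrite z1E.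
have h3 : 3 * z1 ^+ 2 = h.
  apply: (reduces_fun p_pr _ rh); rewrite -s2.
  by apply: reducesM => //; [exact: (reduces_nat _ 3) | exact: reducesX].
have k1 : z1 * z2 = - kap.
  by apply: (reduces_fun p_pr (reducesM p_pr ru rku)); rewrite s3; apply: reducesN.
have hkP : h + 6 * kap = - P by rewrite hk -signr_odd n_odd mulN1r.
have [e1 e2 uz1] := odd_elimination p_pr u2 uy u6 z1y h3 k1 hkP.
have c2k : reduces (\sum_(0 <= k < p) 'C(2 * k, k)%:R ^+ 2
    * (k%:R * (lucas_u 4 1 k)%:~R / 64 ^+ k)) z2.
  by move: c2; congr reduces; apply: eq_bigr => i _; rewrite rmorphM.
have c3k : reduces (\sum_(0 <= k < p) 'C(2 * k, k)%:R ^+ 2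
    * (k%:R * (lucas_v 4 1 k)%:~R / 64 ^+ k)) z3.
  by move: c3; congr reduces; apply: eq_bigr => i _; rewrite rmorphM.
split.
- apply: (@reduces_congr _ p_pr _ _ z1); last first.
    rewrite e1; apply: reducesB => //.
      by apply: reducesM => //; [exact: (reduces_nat _ 2) | exact: reduces_int].
    apply: reduces_div; rewrite ?unitrM ?u6 //; first exact: reduces_nat.
    by apply: reducesM => //; [exact: (reduces_nat _ 6) | exact: reduces_int].
  by move: c1; congr reduces; apply: eq_bigr => i _; rewrite mulrC.
- by apply: (reduces_congr p_pr _ c2k); rewrite e2; exact: reduces_int.
(* Its residue is a unit, so the sum cannot vanish over Q. *)
have u0 : usum rat n != 0.
  apply/eqP => u0; rewrite u0 in ru.
  have z10 := reduces_fun p_pr ru (reduces_nat _ 0).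
  by move: uz1; rewrite z10 unitr0.
have z3E : z3 = 4 * z2.
  apply: (reduces_fun p_pr rkv); rewrite s4 //.
  by apply: reducesM => //; exact: (reduces_nat _ 4).
apply: (reduces_congr p_pr c2k).
rewrite (_ : z2 = 1 / 4 * z3); last by rewrite z3E mulrA divrK // mul1r.
apply: reducesM => //; apply: reduces_div => //; [exact: (reduces_nat _ 1) | exact: (reduces_nat _ 4)].
Qed.

End MainCases.

Theorem theorem1p4 (p : nat) (p_prime : prime p) (p_gt3 : (3 < p)%N) :
  ((p = 1 %[mod 12])%N ->
   forall x y : int, p%:Z = x ^+ 2 + 3 * y ^+ 2 -> (x = 1 %[mod 4])%Z ->
     rat_congr_mod_p2 p
       (\sum_(0 <= k < p)
          'C(2 * k, k)%:R ^+ 2 * ((lucas_v 4 1 k)%:~R / 64 ^+ k))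
       (4 * x%:~R - p%:R / x%:~R)
     /\
     rat_congr_mod_p2 p
       (\sum_(0 <= k < p)
          'C(2 * k, k)%:R ^+ 2 *
            ((k%:R - 1) * (lucas_v 4 1 k)%:~R / 64 ^+ k))
       (- (2 * x%:~R)))
  /\
  ((p = 7 %[mod 12])%N ->
   forall x y : int, p%:Z = x ^+ 2 + 3 * y ^+ 2 -> (y = 1 %[mod 4])%Z ->
     [/\ rat_congr_mod_p2 p
           (\sum_(0 <= k < p)
              (lucas_u 4 1 k)%:~R / 64 ^+ k * 'C(2 * k, k)%:R ^+ 2)
           (2 * y%:~R - p%:R / (6 * y%:~R)),
         rat_congr_mod_p2 p
           y%:~R
           (\sum_(0 <= k < p)
              'C(2 * k, k)%:R ^+ 2 *
                (k%:R * (lucas_u 4 1 k)%:~R / 64 ^+ k))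
       & rat_congr_mod_p2 p
           (\sum_(0 <= k < p)
              'C(2 * k, k)%:R ^+ 2 *
                (k%:R * (lucas_u 4 1 k)%:~R / 64 ^+ k))
           (1 / 4 *
            \sum_(0 <= k < p)
              'C(2 * k, k)%:R ^+ 2 *
                (k%:R * (lucas_v 4 1 k)%:~R / 64 ^+ k))]).
Proof.
have mod4 z : (z = 1 %[mod 4])%Z -> exists d, z = 1 + 4 * d.
  by move=> e; exists (z %/ 4)%Z; rewrite {1}(divz_eq z 4) e; ring.
split=> pk x y form /mod4 h.
  have pE : p = (6 * (2 * (p %/ 12))).+1 by rewrite {1}(divn_eq p 12) pk; lia.
  by apply: (even_case p_prime pE _ (erefl _) form h); lia.
have pE : p = (6 * (2 * (p %/ 12)).+1).+1 by rewrite {1}(divn_eq p 12) pk; lia.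
exact: (odd_case p_prime pE isT (erefl _) form h).
Qed.
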